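(* Let $M$ be an irreducible quasi-finite highest weight $\widehat{\mathrm{gl}}_{\infty|\infty}$-module with highest weight $\xi$. Then $M$ is unitarizable with respect to the $\ast$-structure $\omega$ if and only if $\xi=\Lambda(\lambda)$ for some generalized partition $\lambda$. In other words, $M$ is unitarizable if and only if $$\xi=\sum_{j\in\frac12\mathbb Z,\ s+\frac12\le j\le r}\xi_j\omega_j+d\Lambda_0$$ for some $d\in\mathbb Z_+$, $-s,r\in\mathbb N$ and $\xi_j\in\mathbb Z$ satisfying: (i) $\xi_{\frac12}>\xi_{\frac32}>\cdots>\xi_{r-\frac12}\ge0$, $\ \xi_1>\xi_2>\cdots>\xi_r\ge0$, and $\xi_{r-\frac12}=0$ if and only if $r=1$ and $\xi_{\frac12}=\xi_1=0$; (ii) $0\ge\xi_{s+\frac12}>\xi_{s+\frac32}>\cdots>\xi_{-\frac12}$, $\ 0\ge\xi_{s+1}>\xi_{s+2}>\cdots>\xi_0$, and $\xi_{s+1}=0$ if and only if $s=-1$ and $\xi_{-\frac12}=\xi_0=0$; (iii) $\min\{\xi_{\frac12},1\}+\xi_1-\xi_0\le d$.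
   Context: All vector spaces are over $\mathbb C$; $\mathbb N=\{1,2,\dots\}$, $\mathbb Z_+=\{0,1,2,\dots\}$. Let $\mathrm{gl}_{\infty|\infty}$ be the space of complex matrices $(a_{ij})_{i,j\in\frac12\mathbb Z}$ with $a_{ij}=0$ for $|i-j|\gg0$; $e_{pq}$ denotes the matrix unit. It is $\frac12\mathbb Z$-graded: the degree-$k$ component consists of all $\sum_{j\in\frac12\mathbb Z}a_je_{j-k,j}$. Elements of integer degree are even, elements of degree in $\frac12+\mathbb Z$ are odd, and $[A,B]=AB-(-1)^{|A||B|}BA$. Let $J=\sum_{r\le0}e_{rr}$, $\mathrm{Str}(D)=\sum_{r}(-1)^{2r}d_{rr}$, $\alpha(A,B)=\mathrm{Str}([J,A]B)$. Then $\widehat{\mathrm{gl}}_{\infty|\infty}=\mathrm{gl}_{\infty|\infty}\oplus\mathbb CC$ is the central extension with $C$ even, central, of degree $0$, and the bracket of $A,B\in\mathrm{gl}_{\infty|\infty}$ equal to $[A,B]+\alpha(A,B)C$. Weights $\omega_s$ ($s\in\frac12\mathbb Z$), $\Lambda_0\in((\widehat{\mathrm{gl}}_{\infty|\infty})_0)^*$: $\omega_s(\sum_ra_re_{rr}+dC)=a_s$, $\Lambda_0(\sum_ra_re_{rr}+dC)=d$. For a $\frac12\mathbb Z$-graded Lie superalgebra $\mathfrak g$ with $\mathfrak g_0$ abelian, put $\mathfrak g_\pm=\bigoplus_{r>0}\mathfrak g_{\pm r}$. A highest weight module with highest weight $\xi\in\mathfrak g_0^*$ is a module $M$ containing $v_\xi\neq0$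 with $hv_\xi=\xi(h)v_\xi$ for $h\in\mathfrak g_0$, $\mathfrak g_+v_\xi=0$, $\mathcal U(\mathfrak g_-)v_\xi=M$; it is graded by giving $v_\xi$ degree $0$, and is quasi-finite if all homogeneous components are finite dimensional. $\ast$-structure: $\omega$ is the anti-linear map of $\widehat{\mathrm{gl}}_{\infty|\infty}$ with $\omega(C)=C$, $\omega(\sum_pa_pe_{p-k,p})=\sum_p(-1)^{[p]+[p-k]}\overline{a_p}\,e_{p,p-k}$, where $[r]=1$ if $r\in\frac12+\mathbb Z$ and $r<0$, and $[r]=0$ otherwise; it satisfies $\omega([x,y])=[\omega(y),\omega(x)]$. A module $M$ is unitarizable (with respect to $\omega$) if it admits a positive definite Hermitian form with $\langle xv|v'\rangle=\langle v|\omega(x)v'\rangle$ for all $x$ and all $v,v'\in M$. Generalized partitions and $\Lambda(\lambda)$: a generalized partition of length $d\in\mathbb Z_+$ is a non-increasing sequence of integers $\lambda=(\lambda_1,\dots,\lambda_d)$; it is a partition of length $d$ if all $\lambda_i\ge0$ (zeros allowed). For a partition $\mu$, $\mu'$ is its transpose, $\mu'_j=\#\{i:\mu_i\ge j\}$, and $\mathrm{rank}(\mu)$ is the largest $i$ with $\mu_i\ge i$ ($0$ if $\mu=0$). Put $\lambda^+_i=\max\{\lambda_i,0\}$, $\lambda^-_i=\min\{\lambda_i,0\}$, and $\mu=(-\lambda^-_d,\dots,-\lambda^-_1)$, a partition. If $\lambda^+\ne0$ let $r=\mathrm{rank}(\lambda^+)$ and set $\xi_i=\lambda^+_{i+\frac12}-i+\frac12$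 for $i=\frac12,\frac32,\dots,r-\frac12$ and $\xi_j=(\lambda^+)'_j-j$ for $j=1,\dots,r$; if $\lambda^+=0$ put $r=1$, $\xi_{\frac12}=\xi_1=0$. If $\lambda^-\neq0$ let $s=-\mathrm{rank}(\mu)$ and set $\xi_i=-\mu'_{1-i}-i$ for $i=0,-1,\dots,s+1$ and $\xi_j=\lambda^-_{d+\frac12+j}-j+\frac12$ for $j=-\frac12,-\frac32,\dots,s+\frac12$; if $\lambda^-=0$ put $s=-1$, $\xi_{-\frac12}=\xi_0=0$. Then $\Lambda(\lambda):=\sum_{j\in\frac12\mathbb Z,\,s+\frac12\le j\le r}\xi_j\omega_j+d\Lambda_0$. *)

(* Defs.v *)
From HB Require Import structures.
From mathcomp Require Import all_boot all_order all_algebra.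
From mathcomp Require Import sesquilinear complex.
From mathcomp Require Import boolp classical_sets functions fsbigop reals.

Set Implicit Arguments.
Unset Strict Implicit.
Unset Printing Implicit Defensive.
Import Order.TTheory GRing.Theory Num.Theory.
Local Open Scope classical_set_scope.
Local Open Scope ring_scope.

(* Half-integers are stored doubled: n : halfZ stands for n/2. This applies to
   the indices of matrices and weights and to the degrees of the grading. *)
Notation halfZ := int (only parsing).

Definition oddz (n : int) : bool := odd `|n|%N.

Section GlInfty.
Variable R : realType.
Local Notation C := (R[i]).

Definition matrix_inf : Type := halfZ -> halfZ -> C^o.
HB.instance Definition _ := GRing.Lmodule.on matrix_inf.

Definition banded : {pred matrix_inf} := fun A =>
  `[< exists N : nat, forall i j : halfZ, (N < `|(i - j)%R|)%N -> A i j = 0 >].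

Lemma banded_submod_closed : GRing.submod_closed banded.
Proof.
split.
  by apply/asboolP; exists 0%N.
move=> a A B /asboolP[N hA] /asboolP[P hB]; apply/asboolP.
exists (maxn N P) => i j; rewrite gtn_max => /andP[hN hP].
rewrite -[LHS]/(a *: A i j + B i j).
by rewrite hA // hB // scaler0 addr0.
Qed.
HB.instance Definition _ :=
  GRing.isSubmodClosed.Build C matrix_inf banded banded_submod_closed.

Record gl : Type := Gl { gl_mx :> matrix_inf; _ : gl_mx \in banded }.
HB.instance Definition _ := [isSub for gl_mx].
HB.instance Definition _ := [Choice of gl by <:].
HB.instance Definition _ := [SubChoice_isSubLmodule of gl by <:].

Definition mulmx_inf (A B : matrix_inf) : matrix_inf :=
  fun i j => \sum_(k \in [set: halfZ]) A i k * B k j.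

Lemma mulmx_inf_banded (A B : gl) : mulmx_inf A B \in banded.
Proof.
case: A => A /= /asboolP[N hA]; case: B => B /= /asboolP[P hB].
apply/asboolP; exists (N + P)%N => i j hij.
rewrite /mulmx_inf; apply: fsbig1 => k _.
have [hN|hN] := ltnP N `|(i - k)%R|%N; first by rewrite hA // mul0r.
rewrite hB ?mulr0 // -(ltn_add2l N).
apply: (leq_trans hij); apply: leq_trans (leq_add hN (leqnn _)).
exact: leqD_dist.
Qed.

Definition mul_gl (A B : gl) : gl := Gl (mulmx_inf_banded A B).

Definition parmx (b : bool) (A : matrix_inf) : matrix_inf :=
  fun i j => if oddz (j - i) == b then A i j else 0.

Lemma parmx_banded b (A : gl) : parmx b A \in banded.
Proof.
case: A => A /= /asboolP[N hA]; apply/asboolP; exists N => i j /hA h.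
by rewrite /parmx h if_same.
Qed.

(* The even (b = false) and odd (b = true) components. *)
Definition par_gl (b : bool) (A : gl) : gl := Gl (parmx_banded b A).

Definition bracket_gl (A B : gl) : gl :=
  \sum_(s : bool) \sum_(t : bool)
    (mul_gl (par_gl s A) (par_gl t B)
     - (-1) ^+ (s && t) *: mul_gl (par_gl t B) (par_gl s A)).

Definition Jmx : matrix_inf := fun i j => ((i == j) && (i <= 0))%:R.

Lemma Jmx_banded : Jmx \in banded.
Proof.
apply/asboolP; exists 0%N => i j; rewrite absz_gt0 subr_eq0 /Jmx.
by move=> /negbTE->.
Qed.

Definition J : gl := Gl Jmx_banded.

Definition Str (D : matrix_inf) : C :=
  \sum_(r \in [set: halfZ]) (-1) ^+ oddz r * D r r.

Definition alpha (A B : gl) : C := Str (mul_gl (bracket_gl J A) B).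

(* (A, c) stands for A + c C. *)
Definition glhat : Type := (gl * C^o)%type.
HB.instance Definition _ := GRing.Lmodule.on glhat.

Definition bracket (x y : glhat) : glhat :=
  (bracket_gl x.1 y.1, alpha x.1 y.1).

Definition has_parity (b : bool) (x : glhat) : Prop :=
  (forall i j, gl_mx x.1 i j != 0 -> oddz (j - i) = b) /\ (b -> x.2 = 0).

(* e_{j-k,j} has degree k, and C has degree 0. *)
Definition has_degree (k : halfZ) (x : glhat) : Prop :=
  (forall i j, gl_mx x.1 i j != 0 -> j - i = k) /\ (k != 0 -> x.2 = 0).

(* (a, d) stands for the element sum_r a_r e_{rr} + d C of the degree-0
   subalgebra (a is an arbitrary sequence); cartan_incl is its inclusion. *)
Definition cartan : Type := ((halfZ -> C^o) * C^o)%type.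
HB.instance Definition _ := GRing.Lmodule.on cartan.

Definition diag_inf (a : halfZ -> C^o) : matrix_inf :=
  fun i j => if i == j then a i else 0.

Lemma diag_inf_banded a : diag_inf a \in banded.
Proof.
apply/asboolP; exists 0%N => i j; rewrite absz_gt0 subr_eq0 /diag_inf.
by move=> /negbTE->.
Qed.

Definition cartan_incl (h : cartan) : glhat := (Gl (diag_inf_banded h.1), h.2).

Definition omega_ (s : halfZ) (h : cartan) : C := h.1 s.
Definition Lambda0 (h : cartan) : C := h.2.

(* The bracket [r] appearing in the signs of the star-structure. *)
Definition negodd (r : halfZ) : bool := oddz r && (r < 0).

Definition starmx (A : matrix_inf) : matrix_inf :=
  fun p q => (-1) ^+ (negodd p + negodd q) * (A q p)^*%R.

Lemma starmx_banded (A : gl) : starmx A \in banded.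
Proof.
case: A => A /= /asboolP[N hA]; apply/asboolP; exists N => i j hij.
by rewrite /starmx hA ?conjC0 ?mulr0 // distnC.
Qed.

Definition star (x : glhat) : glhat := (Gl (starmx_banded x.1), (x.2)^*%R).

Record glhat_module : Type := GlhatModule {
  gm_sort :> lmodType C;
  gm_par : bool -> {pred gm_sort};
  gm_act : glhat -> gm_sort -> gm_sort;
  gm_par_submod : forall b, GRing.submod_closed (gm_par b);
  gm_par_sum : forall v, exists v0 v1,
    [/\ v0 \in gm_par false, v1 \in gm_par true & v = v0 + v1];
  gm_par_direct : forall v, v \in gm_par false -> v \in gm_par true -> v = 0;
  gm_act_linearl : forall v, linear (gm_act^~ v);
  gm_act_linearr : forall x, linear (gm_act x);
  gm_act_par : forall a b x v,
    has_parity a x -> v \in gm_par b -> gm_act x v \in gm_par (a (+) b);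
  gm_act_bracket : forall a b x y v, has_parity a x -> has_parity b y ->
    gm_act (bracket x y) v =
    gm_act x (gm_act y v) - (-1) ^+ (a && b) *: gm_act y (gm_act x v)
}.

Section Modules.
Variable M : glhat_module.
Local Notation act := (@gm_act M).

Definition lin_span (S : set M) : set M :=
  [set u | exists n (c : 'I_n -> C) (w : 'I_n -> M),
     (forall i, S (w i)) /\ u = \sum_(i < n) c i *: w i].

Definition finite_dimensional (V : set M) : Prop :=
  exists s : seq M, V = lin_span [set` s].

(* lowering v k u: u = x_1 ... x_n v with the x_i homogeneous of negative
   degrees adding up to k. The span of these u over all k is U(g_-) v, and for
   fixed k it is the degree-k component of U(g_-) v when v has degree 0. *)
Inductive lowering (v : M) : halfZ -> M -> Prop :=
| lowering_nil : lowering v 0 v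
| lowering_cons (k l : halfZ) x u : k < 0 -> has_degree k x -> lowering v l u ->
    lowering v (k + l) (act x u).

Definition hw_component (v : M) (k : halfZ) : set M :=
  lin_span (lowering v k).

Definition is_hw_vector (xi : cartan -> C) (v : M) : Prop :=
  [/\ v != 0,
      forall h, act (cartan_incl h) v = xi h *: v,
      forall (k : halfZ) x, 0 < k -> has_degree k x -> act x v = 0
    & lin_span [set u | exists k, lowering v k u] = setT].

Definition quasi_finite (v : M) : Prop :=
  forall k, finite_dimensional (hw_component v k).

Definition is_submodule (U : {pred M}) : Prop :=
  [/\ GRing.submod_closed U,
      forall u, u \in U -> exists u0 u1,
        [/\ u0 \in U, u0 \in @gm_par M false,
            u1 \in U, u1 \in @gm_par M true & u = u0 + u1]
    & forall x u, u \in U -> act x u \in U].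

Definition irreducible : Prop :=
  (exists v : M, v != 0) /\
  forall U : {pred M}, is_submodule U ->
    (forall u, u \in U -> u = 0) \/ (forall u, u \in U).

Definition unitarizable : Prop :=
  exists form : {dot M for (@Num.conj C)},
    forall x v w, form (act x v) w = form v (act (star x) w).

End Modules.

Definition weight (s r : int) (d : nat) (xi : halfZ -> int) (h : cartan) : C :=
  \sum_(j \in [set j : halfZ | s * 2 + 1 <= j <= r * 2])
     (xi j)%:~R * omega_ j h
  + d%:R * Lambda0 h.

End GlInfty.

Definition gen_partition d (lam : d.-tuple int) : bool := sorted >=%R lam.

(* Partitions are non-increasing sequences of naturals; mu_i is
   nth 0 mu i.-1. *)
Definition transpose_part (mu : seq nat) (j : nat) : nat := count (leq j) mu.

Definition rank_part (mu : seq nat) : nat :=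
  \max_(i < size mu | (i.+1 <= nth 0 mu i)%N) i.+1.

Definition nonzero_part (mu : seq nat) : bool := has (fun m => m != 0%N) mu.

Section Lambda.
Variables (d : nat) (lam : d.-tuple int).

Definition lam_plus : seq nat := [seq `|(Num.max x 0)%R|%N | x <- lam].
Definition lam_minus : seq int := [seq Num.min x 0 | x <- lam].
Definition lam_mu : seq nat := rev [seq `|x|%N | x <- lam_minus].

Definition lam_r : int :=
  if nonzero_part lam_plus then (rank_part lam_plus)%:Z else 1.
Definition lam_s : int :=
  if nonzero_part lam_mu then - (rank_part lam_mu)%:Z else -1.

(* With m = `|n|./2, the half-integer n/2 is m, m + 1/2, - m or - m - 1/2. *)
Definition lam_xi (n : halfZ) : int :=
  let m := `|n|./2%N in
  if 0 < n then
    if ~~ nonzero_part lam_plus then 0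
    else if oddz n then (nth 0%N lam_plus m)%:Z - m%:Z
    else (transpose_part lam_plus m)%:Z - m%:Z
  else
    if ~~ nonzero_part lam_mu then 0
    else if oddz n then nth 0 lam_minus (d - m.+1) + m%:Z + 1
    else - (transpose_part lam_mu m.+1)%:Z + m%:Z.

Definition Lambda (R : realType) : cartan R -> R[i] :=
  weight lam_s lam_r d lam_xi.

End Lambda.

Definition cond_i (r : int) (xi : halfZ -> int) : Prop :=
  [/\ forall i : int, 1 <= i < r -> xi (i * 2 + 1) < xi (i * 2 - 1),
      0 <= xi (r * 2 - 1),
      forall i : int, 1 <= i < r -> xi (i * 2 + 2) < xi (i * 2),
      0 <= xi (r * 2)
    & xi (r * 2 - 1) = 0 <-> [/\ r = 1, xi 1 = 0 & xi 2 = 0]].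

Definition cond_ii (s : int) (xi : halfZ -> int) : Prop :=
  [/\ forall i : int, s <= i < -1 -> xi (i * 2 + 3) < xi (i * 2 + 1),
      xi (s * 2 + 1) <= 0,
      forall i : int, s + 1 <= i < 0 -> xi (i * 2 + 2) < xi (i * 2),
      xi (s * 2 + 2) <= 0
    & xi (s * 2 + 2) = 0 <-> [/\ s = -1, xi (-1) = 0 & xi 0 = 0]].

Definition cond_iii (d : nat) (xi : halfZ -> int) : Prop :=
  Num.min (xi 1) 1 + xi 2 - xi 0 <= d%:Z.

(* Main.v *)
(* Put E_pq = e_pq + [p = q <= 0] (-1)^{2p} C. These operators satisfy the relations
   of the general linear superalgebra without central charge.

   Necessity. Quasi-finiteness of degree -1/2 yields a polynomial relation that
   forces the highest weight to be finitely supported. On each chain of consecutive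
   indices p, q, r with p, r of the same parity, the unitary gl(2) spanned by the
   even part makes the weights integral and dominant, both for the given ordering
   and for the ones obtained from it by odd reflections; this gives (i)-(iii), and
   the weights subject to (i)-(iii) are exactly the Lambda(lambda).

   Sufficiency. In the Fock space of d families of oscillators, with indices in a
   finite window, E_pq acts by sum_i psi+_(i,p) psi-_(i,q), unitarily. A vacuum-like
   state is of highest weight for the ordering that places all fermions between the
   negative and positive bosons, and odd reflections turn it into a highest weight
   vector of weight Lambda(lambda) for the natural ordering. The coefficient of v in
   E_{p1 q1} ... E_{pk qk} v is determined by the commutation relations and the
   highest weight, hence is the corresponding matrix coefficient in a large enough
   window. So the contravariant form of M is positive semidefinite, and irreducibility
   makes it definite. Elements supported far from the origin kill any given vector,
   which reduces arbitrary matrices to finite ones. *)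
Require Import Defs.
From HB Require Import structures.
From mathcomp Require Import all_boot all_order all_algebra.
From mathcomp Require Import sesquilinear complex.
From mathcomp Require Import boolp classical_sets functions fsbigop reals.
From mathcomp Require Import cardinality zify ring lra.
Set Implicit Arguments.
Unset Strict Implicit.
Unset Printing Implicit Defensive.
Import Order.TTheory GRing.Theory Num.Theory.
Local Open Scope ring_scope.

(* Finite windows are forced by the vacuum: the initial state fills every fermion of index at most
   lambda_i, which over all indices would be an infinite configuration. Passing from e_pq to E_pq is
   the renormalisation that this infinite filling would require. The price is that M is never
   realised inside a Fock space: only matrix coefficients are compared, one word at a time. The form
   on M is therefore defined through presentations of vectors by words, and its independence of the
   presentation is recovered from Hermitian symmetry.

   That words in the E_pq span M is itself a point, since gl contains infinite sums of matrix units.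
   By induction on the degree, a far supported element of negative degree sends v to a vector killed
   by all raising operators, and irreducibility leaves no non-zero such vector in negative degree.

   Condition (iii) comes from the chain 0, 1/2, 1 across the origin, where the central charge shifts
   the weight of E_00 by d. Combinatorially it says that lambda^+ and mu together have at most d
   non-zero rows. *)
Identity Coercion matrix_inf_fun : matrix_inf >-> Funclass.

Lemma conjCM (R : realType) (x y : R[i]) : (x * y)^* = x^* * y^*.
Proof. exact: rmorphM. Qed.

(** * Brackets and the cocycle on matrix units *)

Section Brackets.
Variable R : realType.
Local Notation C := (R[i]).
Local Notation glR := (gl R).
Implicit Types (A B : glR) (x y : glhat R) (b c : bool).

Lemma oddzE (m : int) : oddz m = (m %% 2 == 1)%Z.
Proof. by rewrite /oddz; lia. Qed.

Lemma oddzD (m n : int) : oddz (m + n) = oddz m (+) oddz n.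
Proof. by rewrite !oddzE; lia. Qed.

Lemma oddzN (m : int) : oddz (- m) = oddz m.
Proof. by rewrite !oddzE; lia. Qed.

Lemma oddzB (m n : int) : oddz (m - n) = oddz m (+) oddz n.
Proof. by rewrite oddzD oddzN. Qed.

Lemma fsum_delta (T : choiceType) (F : T -> C) (k0 : T) :
  (forall k, k != k0 -> F k = 0) -> \sum_(k \in [set: T]) F k = F k0.
Proof.
move=> F0; rewrite -(fsbig_set1 +%R k0 F); apply/esym/fsbig_widen => //.
by move=> k [_ /= /eqP/F0].
Qed.

Lemma glP A B : (forall i j, A i j = B i j) -> A = B.
Proof. by move=> AB; apply: val_inj; apply: funext => i; apply: funext => j; exact: AB. Qed.

Lemma scale_glE (a : C) A i j : (a *: A) i j = a * A i j.
Proof. by []. Qed.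
Lemma add_glE A B i j : (A + B) i j = A i j + B i j.
Proof. by []. Qed.
Lemma opp_glE A i j : (- A) i j = - A i j.
Proof. by []. Qed.
Lemma zero_glE i j : (0 : glR) i j = 0.
Proof. by []. Qed.
Lemma sum_glE (I : Type) (r : seq I) (P : pred I) (F : I -> glR) i j :
  (\sum_(k <- r | P k) F k) i j = \sum_(k <- r | P k) F k i j.
Proof. by elim/big_rec2: _ => // k a b _ <-. Qed.

Definition glE := (scale_glE, add_glE, opp_glE, zero_glE, sum_glE).

Definition parity_gl b A := forall i j, A i j != 0 -> oddz (j - i) = b.

Lemma par_glE b c A : parity_gl b A -> par_gl c A = if b == c then A else 0.
Proof.
move=> hA; apply: glP => i j; rewrite /par_gl /= /parmx.
have [A0|/hA ->] := eqVneq (A i j) 0; last by case: eqP.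
by rewrite A0 if_same; case: ifP => // _; rewrite A0.
Qed.

Lemma par_gl_sum A : A = par_gl false A + par_gl true A.
Proof.
apply: glP => i j; rewrite glE /= /parmx.
by case: (oddz _); rewrite /= ?add0r ?addr0.
Qed.

Lemma par_gl_parity b A : parity_gl b (par_gl b A).
Proof. by move=> i j /=; rewrite /parmx; case: (_ =P b) => //; rewrite eqxx. Qed.

Lemma mul_gl0l B : mul_gl 0 B = 0.
Proof. by apply: glP => i j; apply: fsbig1 => k _; rewrite mul0r. Qed.

Lemma mul_gl0r B : mul_gl B 0 = 0.
Proof. by apply: glP => i j; apply: fsbig1 => k _; rewrite mulr0. Qed.

Lemma bracket_glE b c A B : parity_gl b A -> parity_gl c B ->
  bracket_gl A B = mul_gl A B - (-1) ^+ (b && c) *: mul_gl B A.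
Proof.
move=> hA hB; rewrite /bracket_gl (bigD1 b) //= (bigD1 c) //=.
rewrite (par_glE b hA) (par_glE c hB) !eqxx !big1 ?addr0 // => [b' b'b|c' c'c].
  rewrite big1 // => c' _.
  by rewrite (par_glE _ hA) eq_sym (negbTE b'b) mul_gl0l mul_gl0r scaler0 subr0.
by rewrite (par_glE _ hB) eq_sym (negbTE c'c) mul_gl0l mul_gl0r scaler0 subr0.
Qed.

Lemma mul_gl_delta A B i j k0 :
  (forall k, k != k0 -> A i k = 0 \/ B k j = 0) ->
  mul_gl A B i j = A i k0 * B k0 j.
Proof.
move=> h; rewrite /= /mulmx_inf (@fsum_delta _ _ k0) // => k /h[] ->; first exact: mul0r.
exact: mulr0.
Qed.

Lemma mul_gl_neq0 A B i j : mul_gl A B i j != 0 ->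
  exists k, A i k != 0 /\ B k j != 0.
Proof.
move=> AB0; apply: contrapT => h; case/eqP: AB0; apply: fsbig1 => k _.
have [->|Ak] := eqVneq (A i k) 0; first exact: mul0r.
have [->|Bk] := eqVneq (B k j) 0; first exact: mulr0.
by case: h; exists k.
Qed.

(** Only entries joining a non-positive index to a positive one survive, so the cocycle is
    concentrated near the origin. *)
Lemma bracket_J A i j :
  bracket_gl (J R) A i j = ((i <= 0)%R%:R - (j <= 0)%R%:R) * A i j.
Proof.
have JP : parity_gl false (J R).
  by move=> p q /=; rewrite /Jmx; have [->|] := eqVneq p q; rewrite ?subrr ?eqxx.
have -> : bracket_gl (J R) A = \sum_(c : bool)
    bracket_gl (J R) (par_gl c A).
  rewrite /bracket_gl exchange_big /=; apply: eq_bigr => c _.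
  rewrite exchange_big /= [RHS](bigD1 c) //= [X in _ = _ + X]big1 => [|c' c'c].
    rewrite addr0; apply: eq_bigr => b _.
    by rewrite (par_glE _ (@par_gl_parity c A)) eqxx.
  rewrite big1 // => b _; rewrite (par_glE _ (@par_gl_parity c A)).
  by rewrite eq_sym (negbTE c'c) mul_gl0l mul_gl0r scaler0 subr0.
have E c : bracket_gl (J R) (par_gl c A) i j =
    ((i <= 0)%R%:R - (j <= 0)%R%:R) * par_gl c A i j.
  rewrite (bracket_glE JP (@par_gl_parity c A)) scale1r !glE.
  rewrite (@mul_gl_delta _ _ i j i) => [|k ki]; last first.
    by left; rewrite /= /Jmx eq_sym (negbTE ki).
  rewrite (@mul_gl_delta _ _ i j j) => [|k kj]; last first.
    by right; rewrite /= /Jmx (negbTE kj).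
  by rewrite /= /Jmx !eqxx /= [X in _ - X]mulrC mulrBl.
rewrite sum_glE; under eq_bigr do rewrite E.
rewrite -mulr_sumr; congr (_ * _).
by rewrite [in RHS](par_gl_sum A) big_bool /= addrC.
Qed.

Definition far (L : nat) A := forall i j, A i j != 0 -> (L < `|i|)%N /\ (L < `|j|)%N.
Definition band (N : nat) A := forall i j, A i j != 0 -> (`|(i - j)%R| <= N)%N.

Lemma band_ex A : exists N, band N A.
Proof.
have /asboolP[N hN] := valP A; exists N => i j; rewrite leqNgt; apply: contraNN => /hN.
by move=> A0; apply/eqP.
Qed.

(** A term of the supertrace needs an entry of [A] at (r, k) and one of [B] at (k, r) with r and k
    on different sides of the origin. If both indices exceed [L] in absolute value, such an entry is
    too far from the diagonal for the band. *)
Lemma alpha0 (L N : nat) A B : (N <= L)%N -> band N A \/ band N B ->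
  far L A \/ far L B -> alpha A B = 0.
Proof.
move=> NL hband hfar; rewrite /alpha /Str; apply: fsbig1 => r _.
apply/eqP; rewrite mulf_eq0; apply/orP; right.
apply: contrapT => /negP/mul_gl_neq0[k []].
rewrite bracket_J mulf_eq0 negb_or subr_eq0 => /andP[rk Ark Bkr].
have [hr hk] : (L < `|r|)%N /\ (L < `|k|)%N.
  by case: hfar => h; [have := h _ _ Ark | have := h _ _ Bkr; case].
have : (`|(r - k)%R| <= N)%N.
  by case: hband => h; [have := h _ _ Ark | have := h _ _ Bkr; rewrite distnC].
move: rk; case: (lerP r 0) => h1; case: (lerP k 0) => h2; rewrite ?eqxx //; lia.
Qed.

Lemma far_bracket (L N : nat) A B : far (L + N) A -> band N B ->
  far L (bracket_gl A B) /\ far L (bracket_gl B A).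
Proof.
move=> fA bB; have key (A' B' : glR) : (forall i j, A' i j != 0 -> A i j != 0) ->
    (forall i j, B' i j != 0 -> B i j != 0) ->
    far L (mul_gl A' B') /\ far L (mul_gl B' A').
  move=> hA hB; split=> i j /mul_gl_neq0[k []].
    by move=> /hA/fA[? ?] /hB/bB ?; split; lia.
  by move=> /hB/bB ? /hA/fA[? ?]; split; lia.
have hpar c (X : glR) i j : par_gl c X i j != 0 -> X i j != 0.
  by rewrite /= /parmx; case: ifP => // _; rewrite eqxx.
have fsub X Y (a : C) : far L X -> far L Y -> far L (X - a *: Y).
  move=> fX fY i j; rewrite !glE; have [X0|/fX //] := eqVneq (X i j) 0.
  have [Y0|/fY //] := eqVneq (Y i j) 0.
  by rewrite X0 Y0 mulr0 subr0 eqxx.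
have fadd X Y : far L X -> far L Y -> far L (X + Y).
  move=> fX fY i j; rewrite !glE; have [X0|/fX //] := eqVneq (X i j) 0.
  have [Y0|/fY //] := eqVneq (Y i j) 0.
  by rewrite X0 Y0 addr0 eqxx.
have f0 : far L 0 by move=> i j; rewrite glE eqxx.
have fsum (F : bool -> glR) : (forall b, far L (F b)) -> far L (\sum_b F b).
  by move=> hF; rewrite big_bool; apply: fadd.
split; apply: (fsum _) => b; apply: (fsum _) => c; apply: fsub.
- by have [] := key (par_gl b A) (par_gl c B) (hpar b A) (hpar c B).
- by have [] := key (par_gl b A) (par_gl c B) (hpar b A) (hpar c B).
- by have [] := key (par_gl c A) (par_gl b B) (hpar c A) (hpar b B).
by have [] := key (par_gl c A) (par_gl b B) (hpar c A) (hpar b B).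
Qed.

Lemma band_bracket (M N : nat) A B : band M A -> band N B -> band (M + N) (bracket_gl A B).
Proof.
move=> bA bB; have key (A' B' : glR) : (forall i j, A' i j != 0 -> A i j != 0) ->
    (forall i j, B' i j != 0 -> B i j != 0) ->
    band (M + N) (mul_gl A' B') /\ band (M + N) (mul_gl B' A').
  move=> hA hB; split=> i j /mul_gl_neq0[k []].
    by move=> /hA/bA ? /hB/bB ?; lia.
  by move=> /hB/bB ? /hA/bA ?; lia.
have hpar c (X : glR) i j : par_gl c X i j != 0 -> X i j != 0.
  by rewrite /= /parmx; case: ifP => // _; rewrite eqxx.
have fsub X Y (a : C) : band (M + N) X -> band (M + N) Y -> band (M + N) (X - a *: Y).
  move=> fX fY i j; rewrite !glE; have [X0|/fX //] := eqVneq (X i j) 0.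
  have [Y0|/fY //] := eqVneq (Y i j) 0.
  by rewrite X0 Y0 mulr0 subr0 eqxx.
have fadd X Y : band (M + N) X -> band (M + N) Y -> band (M + N) (X + Y).
  move=> fX fY i j; rewrite !glE; have [X0|/fX //] := eqVneq (X i j) 0.
  have [Y0|/fY //] := eqVneq (Y i j) 0.
  by rewrite X0 Y0 addr0 eqxx.
have f0 : band (M + N) 0 by move=> i j; rewrite glE eqxx.
have fsum (F : bool -> glR) :
    (forall b, band (M + N) (F b)) -> band (M + N) (\sum_b F b).
  by move=> hF; rewrite big_bool; apply: fadd.
apply: (fsum _) => b; apply: (fsum _) => c; apply: fsub.
all: by have [] := key (par_gl b A) (par_gl c B) (hpar b A) (hpar c B).
Qed.

Lemma unit_banded (p q : int) :
  ((fun i j => ((i == p) && (j == q))%:R) : matrix_inf R) \in @banded R.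
Proof.
apply/asboolP; exists `|p - q|%N => i j.
by have [->|] := eqVneq i p => //=; have [->|//] := eqVneq j q; rewrite ltnn.
Qed.

Definition unit_gl (p q : int) : glR := Gl (unit_banded p q).
Definition e_ (p q : int) : glhat R := (unit_gl p q, 0).

Lemma unit_glE p q i j : unit_gl p q i j = ((i == p) && (j == q))%:R.
Proof. by []. Qed.

Lemma unit_parity p q : parity_gl (oddz (q - p)) (unit_gl p q).
Proof. by move=> i j; rewrite unit_glE; case: (i =P p) => [->|_]; case: (j =P q) => [->|_]; rewrite ?eqxx. Qed.

Lemma e_degree p q : has_degree (q - p) (e_ p q).
Proof.
by split=> // i j; rewrite unit_glE; case: (i =P p) => [->|_]; case: (j =P q) => [->|_]; rewrite ?eqxx.
Qed.

Lemma mul_unit p q r s : mul_gl (unit_gl p q) (unit_gl r s) = (q == r)%:R *: unit_gl p s.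
Proof.
apply: glP => i j; rewrite glE (@mul_gl_delta _ _ i j q) => [|k kq]; last first.
  by left; rewrite unit_glE (negbTE kq) andbF.
by rewrite !unit_glE eqxx andbT; case: (i == p); case: (q == r); case: (j == s);
  rewrite /= ?mul0r ?mulr0 ?mulr1.
Qed.

Definition usgn (p q r s : int) : C := (-1) ^+ (oddz (q - p) && oddz (s - r)).

Lemma alpha_unit p q r s : alpha (unit_gl p q) (unit_gl r s) =
  (q == r)%:R * (p == s)%:R * ((-1) ^+ oddz p * ((p <= 0)%R%:R - (q <= 0)%R%:R)).
Proof.
rewrite /alpha /Str.
have -> : bracket_gl (J R) (unit_gl p q) = ((p <= 0)%R%:R - (q <= 0)%R%:R) *: unit_gl p q.
  apply: glP => i j; rewrite bracket_J glE unit_glE.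
  by case: (eqVneq i p) => [->|]; case: (eqVneq j q) => [->|]; rewrite /= ?mulr0.
set a := (_ - _ : C).
rewrite (@fsum_delta _ _ p) => [|k kp]; last first.
  rewrite (@mul_gl_delta _ _ k k q) => [|l lq]; last by left; rewrite glE unit_glE (negbTE lq) andbF mulr0.
  by rewrite glE !unit_glE (negbTE kp) /= mulr0 mul0r mulr0.
rewrite (@mul_gl_delta _ _ p p q) => [|l lq]; last by left; rewrite glE unit_glE (negbTE lq) andbF mulr0.
by rewrite glE !unit_glE !eqxx /=; case: (q == r); case: (p == s) => /=; ring.
Qed.

Lemma bracket_unit p q r s : bracket (e_ p q) (e_ r s) =
  ((q == r)%:R *: unit_gl p s - usgn p q r s *: ((p == s)%:R *: unit_gl r q),
   (q == r)%:R * (p == s)%:R * ((-1) ^+ oddz p * ((p <= 0)%R%:R - (q <= 0)%R%:R))).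
Proof.
rewrite /bracket alpha_unit; congr pair.
by rewrite (bracket_glE (@unit_parity p q) (@unit_parity r s)) !mul_unit [s == p]eq_sym.
Qed.

Definition ssgn (p : int) : C := (-1) ^+ negodd p.

Lemma star_unit p q : star (e_ p q) = (ssgn p * ssgn q) *: e_ q p.
Proof.
congr pair; last by rewrite /= conjC0 scaler0.
apply: glP => i j; rewrite [RHS](scale_glE _ (unit_gl q p)) unit_glE /= /starmx /= /ssgn -exprD.
by have [->|] := eqVneq i q; have [->|] := eqVneq j p;
   rewrite /= ?conjC0 ?conjC1 ?mulr0 ?andbF // addnC.
Qed.

End Brackets.

(** The order of [R[i]] is partial; a comparison with a natural number still bounds it by the real
    part. This stops the descent in [sl2_integral], where the eigenvalues are not yet known to be
    real. *)
Lemma nat_lt_complex_bound (R : realType) (c : R[i]) : exists n : nat, ~~ (n%:R < c).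
Proof.
exists (Num.truncn (complex.Re c)).+1; apply/negP; rewrite ltcE => /andP[_].
have -> : complex.Re ((Num.truncn (complex.Re c)).+1%:R : R[i]) = (Num.truncn (complex.Re c)).+1%:R :> R.
  by rewrite -(rmorph_nat (real_complex R)).
by rewrite ltNge; apply/negP; rewrite ltW // truncnS_gt.
Qed.

(** * Unitarity constraints from sl(2) and odd reflections *)

Section UnitaryGl.
Variable R : realType.
Local Notation C := (R[i]).
(** [W] is the range of indices in which the relations hold: all indices for the module [M], a
    finite window for the Fock space. *)
Variables (V : lmodType C) (E : int -> int -> {linear V -> V}) (W : {pred int}).
Variable form : V -> V -> C.
Hypothesis E_comm : forall p q r s u, p \in W -> q \in W -> r \in W -> s \in W ->
  E p q (E r s u) = usgn R p q r s *: E r s (E p q u) + (q == r)%:R *: E p s u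
                    - (usgn R p q r s * (p == s)%:R) *: E r q u.
Hypothesis form_linl : forall w, linear_for *%R (form^~ w).
Hypothesis form_pos : forall u, u != 0 -> 0 < form u u.
Hypothesis E_adj : forall p q u w, p \in W -> q \in W ->
  form (E p q u) w = ssgn R p * ssgn R q * form u (E q p w).

Lemma ssgn_sq p : ssgn R p * ssgn R p = 1.
Proof. by rewrite /ssgn -expr2 sqrr_sign. Qed.

Lemma formZl a u w : form (a *: u) w = a * form u w.
Proof.
have h := form_linl w a u 0; rewrite addr0 in h; rewrite h.
suff -> : form 0 w = 0 by rewrite addr0.
have := form_linl w 1 0 0; rewrite scale1r addr0 mul1r => /eqP.
by rewrite -subr_eq subrr => /eqP.
Qed.

Lemma form0l w : form 0 w = 0.
Proof. by rewrite -(scale0r (0 : V)) formZl mul0r. Qed.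

Lemma form_ge0 u : 0 <= form u u.
Proof. by have [->|/form_pos/ltW//] := eqVneq u 0; rewrite form0l. Qed.

Lemma E_adj' p q u w : p \in W -> q \in W ->
  form u (E p q w) = ssgn R p * ssgn R q * form (E q p u) w.
Proof.
move=> pW qW; rewrite (E_adj u w qW pW) mulrA [ssgn R q * _]mulrC mulrACA.
by rewrite !ssgn_sq !mul1r.
Qed.

Lemma usgn_even p q r s : ~~ oddz (q - p) || ~~ oddz (s - r) -> usgn R p q r s = 1.
Proof. by rewrite /usgn -negb_and => /negbTE ->. Qed.

Lemma E_weight p r s u : p \in W -> r \in W -> s \in W ->
  E p p (E r s u) = E r s (E p p u) + ((p == r)%:R - (p == s)%:R) *: E r s u.
Proof.
move=> pW rW sW; rewrite E_comm // usgn_even ?subrr // scale1r mul1r -addrA; congr (_ + _).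
by rewrite scalerBl; case: eqP => [->|_]; case: eqP => [->|_] //; rewrite ?scale0r.
Qed.

Lemma E_weight_eigen p r s u a : p \in W -> r \in W -> s \in W ->
  E p p u = a *: u ->
  E p p (E r s u) = (a + (p == r)%:R - (p == s)%:R) *: E r s u.
Proof.
by move=> pW rW sW pu; rewrite E_weight // pu linearZ -scalerDl addrA.
Qed.

Section OddReflection.
Variables (p q : int) (u : V) (a b : C).
Hypotheses (pW : p \in W) (qW : q \in W) (pq_odd : oddz (q - p)).
Hypotheses (pq_u : E p q u = 0) (pp_u : E p p u = a *: u) (qq_u : E q q u = b *: u).

Lemma oddz_subC (m n : int) : oddz (m - n) = oddz (n - m).
Proof. by rewrite -oddzN opprB. Qed.

Lemma odd_lower : E p q (E q p u) = (a + b) *: u.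
Proof.
rewrite E_comm // pq_u linear0 scaler0 add0r !eqxx scale1r /usgn pq_odd oddz_subC pq_odd.
by rewrite expr1 mulN1r scaleN1r opprK pp_u qq_u scalerDl.
Qed.

Lemma odd_norm : form (E q p u) (E q p u) = ssgn R p * ssgn R q * (a + b) * form u u.
Proof. by rewrite E_adj' // odd_lower formZl mulrA [ssgn R q * _]mulrC. Qed.

Lemma odd_lower_neq0 : u != 0 -> a + b != 0 -> E q p u != 0.
Proof.
move=> u0 ab0; apply: contra_neq (u0) => Eu.
have := odd_lower; rewrite Eu linear0 => /esym/eqP.
by rewrite scaler_eq0 (negbTE ab0) (negbTE u0).
Qed.

(** By [odd_norm] the norm of [E q p u] is a multiple of [a + b], so positivity of the form leaves
    only the zero vector. *)
Lemma odd_lower_eq0 : a + b = 0 -> E q p u = 0.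
Proof.
move=> ab0; apply/eqP; apply: contraT => /form_pos.
by rewrite odd_norm ab0 mulr0 mul0r ltxx.
Qed.

End OddReflection.

Section Sl2.
Variables (p q : int) (u : V) (a b : C).
Hypotheses (pW : p \in W) (qW : q \in W) (pq : p != q) (pq_even : ~~ oddz (q - p)).
Hypothesis pq_sgn : ssgn R p * ssgn R q = 1.
Hypotheses (pq_u : E p q u = 0) (pp_u : E p p u = a *: u) (qq_u : E q q u = b *: u).

Let f n := iter n (E q p) u.

Let f_pp n : E p p (f n) = (a - n%:R) *: f n.
Proof.
elim: n => [|n IH]; first by rewrite subr0.
rewrite /= (E_weight_eigen _ _ _ IH) // eqxx (negbTE pq) addr0; congr (_ *: _).
by rewrite -[in RHS]addn1 natrD opprD addrA.
Qed.

Let f_qq n : E q q (f n) = (b + n%:R) *: f n.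
Proof.
elim: n => [|n IH]; first by rewrite addr0.
rewrite /= (E_weight_eigen _ _ _ IH) // eqxx eq_sym (negbTE pq) subr0; congr (_ *: _).
by rewrite -[in RHS]addn1 natrD addrA.
Qed.

Let f_raise n : E p q (f n.+1) = (n.+1%:R * (a - b - n%:R)) *: f n.
Proof.
elim: n => [|n IH].
  rewrite /= E_comm // usgn_even ?pq_even // pq_u linear0 !eqxx !scale1r mul1r scale1r add0r.
  by rewrite pp_u qq_u -scalerBl mul1r subr0.
have -> : f n.+2 = E q p (f n.+1) by [].
rewrite E_comm // usgn_even ?pq_even // !eqxx mul1r !scale1r.
rewrite IH linearZ f_pp f_qq /= (_ : E q p (f n) = f n.+1) // -scalerDl -scalerBl; congr (_ *: _).
by rewrite -[n.+2]addn2 -[n.+1]addn1 !natrD; ring.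
Qed.

(** Successive norms along the string [f] differ by the factor (n+1)(a - b - n). If [a - b] is not a
    natural number the string never stops, so positivity makes every a - b - n positive, which is
    absurd for large n. *)
Lemma sl2_integral : u != 0 -> exists n : nat, a - b = n%:R.
Proof.
move=> u0; apply: contrapT => hn.
have N n : form (f n.+1) (f n.+1) = n.+1%:R * (a - b - n%:R) * form (f n) (f n).
  rewrite {2}/f iterS E_adj' // -/(f n) f_raise formZl [ssgn R q * _]mulrC pq_sgn mul1r.
  by [].
have hne n : a - b - n%:R != 0.
  by rewrite subr_eq0; apply/eqP => h; apply: hn; exists n.
have f0 n : 0 < form (f n) (f n).
  elim: n => [|n IH]; first exact: form_pos.
  rewrite lt_def form_ge0 andbT N !mulf_neq0 ?pnatr_eq0 //.
  by rewrite gt_eqF.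
have [n] := nat_lt_complex_bound (a - b); case/negP.
have := f0 n.+1; rewrite N pmulr_lgt0 ?f0 // pmulr_rgt0 ?ltr0n //.
by rewrite subr_gt0.
Qed.

End Sl2.

Definition reflect_wt (p q : int) (eta : int -> int) : int -> int :=
  if eta p + eta q == 0 then eta
  else fun t => eta t + (t == q)%:Z - (t == p)%:Z.

(* The list [l] is an ordering of the indices, i.e. a choice of Borel subalgebra:
   [E p q] is a raising operator when [p] precedes [q] in [l]. *)
Definition is_hw (l : seq int) (eta : int -> int) (u : V) : Prop :=
  [/\ u != 0, forall p, p \in l -> E p p u = (eta p)%:~R *: u
    & pairwise (fun p q => `[< E p q u = 0 >]) l].

(** Odd reflection for adjacent p, q. If eta p + eta q is non-zero the new vector is [E q p u], with
    one unit of weight moved from p to q; otherwise [E q p u] vanishes by unitarity and [u] itself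
    works for the new ordering. *)
Lemma reflect_hw s1 p q s2 eta u :
  uniq (s1 ++ p :: q :: s2) -> {subset s1 ++ p :: q :: s2 <= W} -> oddz (q - p) ->
  is_hw (s1 ++ p :: q :: s2) eta u ->
  exists u', is_hw (s1 ++ q :: p :: s2) (reflect_wt p q eta) u'.
Proof.
move=> ul lW pq [u0 wu]; set r := (X in pairwise X) => pu.
have [pl ql] : p \in s1 ++ p :: q :: s2 /\ q \in s1 ++ p :: q :: s2.
  by rewrite !mem_cat !inE !eqxx !orbT.
have pW := lW _ pl; have qW := lW _ ql.
have Epq : E p q u = 0.
  by move: pu; rewrite pairwise_cat /= => /and5P[_ _ /andP[/asboolP]].
have memE t : (t \in s1 ++ q :: p :: s2) = (t \in s1 ++ p :: q :: s2).
  by rewrite !mem_cat !inE; congr orb; rewrite orbCA.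
have ppu := wu _ pl; have qqu := wu _ ql.
rewrite /reflect_wt; case: eqP => [e0|/eqP e0].
  exists u; split=> // [t|]; first by rewrite memE => /wu.
  have Eqp : E q p u = 0.
    by apply: (odd_lower_eq0 pW qW pq Epq ppu qqu); rewrite -rmorphD e0.
  move: pu; rewrite !pairwise_cat /= !allrel_consr => /and5P[/and3P[h1 h2 h3] h4 /andP[h5 h6] h7 h8].
  by rewrite h1 h2 h3 h4 h6 h7 h8 !andbT /=; apply/asboolP.
exists (E q p u); split.
- by apply: (odd_lower_neq0 pW qW pq Epq ppu qqu u0); rewrite -rmorphD intr_eq0.
- move=> t; rewrite memE => tl; rewrite (E_weight_eigen _ _ _ (wu _ tl)) ?lW //.
  by rewrite rmorphB rmorphD.
(* Commuting [E c d] past [E q p] leaves [E c p u] when d = q and [E q d u] when c = p; both vanish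
   if they are raising for the old ordering. *)
have key c d : c \in s1 ++ p :: q :: s2 -> d \in s1 ++ p :: q :: s2 ->
    r c d -> (d == q -> r c p) -> (c == p -> r q d) -> `[< E c d (E q p u) = 0 >].
  move=> cl dl /asboolP cd dq cp; apply/asboolP.
  rewrite E_comm ?lW // cd linear0 scaler0 add0r.
  have -> : (d == q)%:R *: E c p u = 0.
    by case: eqP dq => [_ /(_ isT)/asboolP->|_ _]; rewrite ?scaler0 ?scale0r.
  have -> : (usgn R c d q p * (c == p)%:R) *: E q d u = 0.
    by case: eqP cp => [_ /(_ isT)/asboolP->|_ _]; rewrite ?scaler0 ?mulr0 ?scale0r.
  by rewrite subr0.
have s1l t : t \in s1 -> t \in s1 ++ p :: q :: s2 by rewrite mem_cat => ->.
have s2l t : t \in s2 -> t \in s1 ++ p :: q :: s2 by rewrite mem_cat !inE => ->; rewrite !orbT.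
have [ps1 qs1 [pq' ps2 qs2]] : [/\ p \notin s1, q \notin s1 & [/\ p != q, p \notin s2 & q \notin s2]].
  by move: ul; rewrite cat_uniq /= !inE !negb_or -!andbA => /andP[_ /and5P[-> -> _ -> /and3P[-> -> _]]].
move: pu; rewrite !pairwise_cat /= !allrel_consr.
move=> /and5P[/and3P[/allP h1 /allP h2 /allrelP h3] h4 /andP[_ /allP h6] /allP h7 h8].
apply/and5P; split.
- apply/and3P; split.
  + apply/allP => t ts; apply: key => [|||_|/eqP e]; rewrite ?(s1l _ ts) //.
    * exact: h2.
    * exact: h1.
    * by rewrite -e ts in ps1.
  + apply/allP => t ts; apply: key => [|||/eqP e|/eqP e]; rewrite ?(s1l _ ts) //.
    * exact: h1.
    * by rewrite e eqxx in pq'.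
    * by rewrite -e ts in ps1.
  + apply/allrelP => t t' ts ts'; apply: key => [|||/eqP e|/eqP e]; rewrite ?(s1l _ ts) ?(s2l _ ts') //.
    * exact: h3.
    * by rewrite -e ts' in qs2.
    * by rewrite -e ts in ps1.
- apply: (sub_in_pairwise (P := mem s1)) h4; last exact/allP.
  move=> c d cs ds cd; apply: key; rewrite ?(s1l _ cs) ?(s1l _ ds) // => /eqP e.
    by rewrite -e ds in qs1.
  by rewrite -e cs in ps1.
- apply/andP; split.
    (* An odd root vector squares to zero: its relation with itself reads X X u = - X X u. *)
    have := E_comm u qW pW qW pW; rewrite (negbTE pq') eq_sym (negbTE pq').
    rewrite mulr0 !scale0r subr0 addr0 /usgn oddz_subC pq expr1 scaleN1r => /eqP.
    by rewrite -addr_eq0 -mulr2n -scaler_nat scaler_eq0 pnatr_eq0 => /eqP Eqp; apply/asboolP.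
  apply/allP => t ts; apply: key => [|||/eqP e|/eqP e]; rewrite ?(s2l _ ts) //.
  * exact: h7.
  * by rewrite -e ts in qs2.
  * by rewrite e eqxx in pq'.
- apply/allP => t ts; apply: key => [|||/eqP e|_]; rewrite ?(s2l _ ts) //.
  * exact: h6.
  * by rewrite -e ts in qs2.
  * exact: h7.
- apply: (sub_in_pairwise (P := mem s2)) h8; last exact/allP.
  move=> c d cs ds cd; apply: key; rewrite ?(s2l _ cs) ?(s2l _ ds) // => /eqP e.
    by rewrite -e ds in qs2.
  by rewrite -e cs in ps2.
Qed.

End UnitaryGl.

(** * Normalised matrix units acting on a module *)

Section Operators.
Variable R : realType.
Local Notation C := (R[i]).

(* Adding [(-1)^{2p} C] to [e_pp] for [p <= 0] cancels the cocycle, so that the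
   [ehat p q] satisfy the relations of gl without central charge. *)
Definition shift (p : int) : C := (-1) ^+ oddz p * (p <= 0)%R%:R.

Definition ehat (p q : int) : glhat R := (unit_gl R p q, (p == q)%:R * shift p).

Lemma shift_conj p : (shift p)^* = shift p.
Proof. by rewrite /shift rmorphM rmorphXn rmorphN1 rmorph_nat. Qed.

Lemma ehat_parity p q : has_parity (oddz (q - p)) (ehat p q).
Proof.
split=> [|pq]; first exact: unit_parity.
by rewrite /ehat /=; case: (p =P q) pq => [->|]; rewrite ?subrr // mul0r.
Qed.

Lemma ehat_degree p q : has_degree (q - p) (ehat p q).
Proof.
split=> [|pq]; first by have [] := e_degree R p q.
by rewrite /ehat /=; case: (p =P q) pq => [->|]; rewrite ?subrr ?eqxx // mul0r.
Qed.

Lemma bracket_ehat p q r s : bracket (ehat p q) (ehat r s) =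
  (q == r)%:R *: ehat p s - (usgn R p q r s * (p == s)%:R) *: ehat r q.
Proof.
have -> : bracket (ehat p q) (ehat r s) = bracket (e_ R p q) (e_ R r s) by [].
rewrite bracket_unit; congr pair.
  by rewrite /= scalerA.
rewrite /= -[_ *: (_ : C^o)]/(_ * _) -[(_ * _) *: (_ : C^o)]/(_ * _) [r == q]eq_sym /shift /usgn.
case: (q =P r) => [<-|_]; last by rewrite !(mul0r,mulr0) subr0.
case: (p =P s) => [<-|_]; last by rewrite !(mulr0, mul0r) subr0.
rewrite /= !mul1r mulr1 mulrBr; congr (_ - _).
by rewrite oddz_subC andbb oddzB; case: (oddz p); case: (oddz q) => /=; ring.
Qed.

Lemma star_ehat p q : star (ehat p q) = (ssgn R p * ssgn R q) *: ehat q p.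
Proof.
have := star_unit R p q => /(congr1 fst) /= h; congr pair; first exact: h.
rewrite /= rmorphM rmorph_nat -[X in _ * X = _]/((shift p)^*) shift_conj [q == p]eq_sym.
case: (p =P q) => [->|_]; rewrite ?mul0r ?scaler0 // -[RHS]/(_ * _) -expr2.
by rewrite sqrr_sign !mul1r.
Qed.

Variable M : glhat_module R.

Definition act_fun (x : glhat R) (u : M) : M := gm_act x u.
HB.instance Definition _ x :=
  GRing.isLinear.Build C M M *:%R (act_fun x) (gm_act_linearr x).

Lemma actDl x y (u : M) : gm_act (x + y) u = gm_act x u + gm_act y u.
Proof. by have := gm_act_linearl u 1 x y; rewrite !scale1r. Qed.

Lemma act0l (u : M) : gm_act 0 u = 0.
Proof. by have /(congr1 (fun t => t - gm_act 0 u)) := actDl 0 0 u; rewrite addr0 subrr addrK. Qed.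

Lemma actZl a x (u : M) : gm_act (a *: x) u = a *: gm_act x u.
Proof. by have := gm_act_linearl u a x 0; rewrite !addr0 act0l addr0. Qed.

Lemma actBl x y (u : M) : gm_act (x - y) u = gm_act x u - gm_act y u.
Proof. by rewrite actDl -(scaleN1r y) actZl scaleN1r. Qed.

Lemma act_suml (I : Type) (r : seq I) (P : pred I) (F : I -> glhat R) (u : M) :
  gm_act (\sum_(i <- r | P i) F i) u = \sum_(i <- r | P i) gm_act (F i) u.
Proof. by elim/big_rec2: _ => [|i y x _ <-]; rewrite ?act0l ?actDl. Qed.

Lemma actDr x (u w : M) : gm_act x (u + w) = gm_act x u + gm_act x w.
Proof. exact: (raddfD (act_fun x)). Qed.
Lemma actZr x a (u : M) : gm_act x (a *: u) = a *: gm_act x u.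
Proof. exact: (linearZ_LR (act_fun x)). Qed.
Lemma act0r x : gm_act x (0 : M) = 0.
Proof. exact: (raddf0 (act_fun x)). Qed.
Lemma actBr x (u w : M) : gm_act x (u - w) = gm_act x u - gm_act x w.
Proof. exact: (raddfB (act_fun x)). Qed.
Definition EM (p q : int) : {linear M -> M} := act_fun (ehat p q).

Lemma EM_comm p q r s (u : M) : p \in predT -> q \in predT -> r \in predT -> s \in predT ->
  EM p q (EM r s u) = usgn R p q r s *: EM r s (EM p q u) + (q == r)%:R *: EM p s u
                    - (usgn R p q r s * (p == s)%:R) *: EM r q u.
Proof.
move=> _ _ _ _; rewrite /EM /= /act_fun.
have := gm_act_bracket u (ehat_parity p q) (ehat_parity r s).
rewrite bracket_ehat actBl !actZl => /esym/(canRL (subrK _)) ->.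
by rewrite [LHS]addrC addrA.
Qed.

Variables (xi : {scalar cartan R}) (v : M).
Hypothesis hwv : is_hw_vector xi v.

Lemma EM_hw p q : p < q -> EM p q v = 0.
Proof.
case: hwv => _ _ h _ pq; apply: (h (q - p)); last exact: ehat_degree.
by rewrite subr_gt0.
Qed.

Definition ind (p : int) : int -> C^o := fun i => (i == p)%:R.
Definition zwt (p : int) : C := xi (ind p, 0).
Definition dwt : C := xi (0, 1).

Lemma ehat_cartan p : ehat p p = cartan_incl (ind p, shift p).
Proof.
congr pair; last by rewrite eqxx mul1r.
apply: glP => i j; rewrite unit_glE /= /diag_inf /ind.
by have [->|] := eqVneq i j; [rewrite andbb|case: (i =P p) => [->|//]; rewrite eq_sym => /negbTE ->].
Qed.

Lemma EM_wt p : EM p p v = (zwt p + shift p * dwt) *: v.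
Proof.
case: hwv => _ h _ _; rewrite /EM /= /act_fun ehat_cartan h; congr (_ *: _).
rewrite /zwt /dwt -[shift p * _]/(shift p *: _) -linearZ /= -raddfD; congr (xi _).
by congr pair; rewrite /= ?scaler0 ?addr0 // add0r [RHS](mulr1 (shift p)).
Qed.

End Operators.

Definition win (L : nat) : seq int := [seq i%:Z - L%:Z | i <- iota 0 (L.*2.+1)].

Lemma mem_win L (j : int) : (j \in win L) = (`|j| <= L)%N.
Proof.
apply/mapP/idP => [[k]|jL]; first by rewrite mem_iota => /= ? ->; lia.
exists `|(j + L%:Z)%R|%N; last by lia.
by rewrite mem_iota; lia.
Qed.

Lemma win_uniq L : uniq (win L).
Proof. by rewrite map_inj_uniq ?iota_uniq // => i j; lia. Qed.

Lemma big_win1 (V : nmodType) L (j : int) (F : int -> V) :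
  (forall i, i != j -> F i = 0) -> \sum_(i <- win L) F i = if j \in win L then F j else 0.
Proof.
move=> F0; case: ifP => jL.
  by rewrite (bigD1_seq j jL (win_uniq L)) big1 /= ?addr0.
by rewrite big_seq big1 // => i iL; apply: F0; apply: contraFN jL => /eqP <-.
Qed.

(** * Quasi-finiteness makes the highest weight finitely supported *)

Section FiniteSupport.
Variable R : realType.
Local Notation C := (R[i]).
Variable M : glhat_module R.

Lemma lin_span_seq (s : seq M) (u : M) : lin_span [set` s] u ->
  exists a : 'I_(size s) -> C, u = \sum_j a j *: s`_j.
Proof.
move=> [n [c [w [ws ->]]]].
exists (fun j : 'I_(size s) => \sum_(k < n) (index (w k) s == j :> nat)%:R * c k).
under [RHS]eq_bigr do rewrite scaler_suml.
rewrite exchange_big; apply: eq_bigr => k _ /=.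
have wk : (index (w k) s < size s)%N by rewrite index_mem; exact: ws.
rewrite (bigD1 (Ordinal wk)) //= eqxx mul1r nth_index; last exact: ws.
rewrite big1 ?addr0 // => j; rewrite -val_eqE /= eq_sym => /negbTE ->.
by rewrite mul0r scale0r.
Qed.

Lemma span_dependent (s : seq M) (u : 'I_(size s).+1 -> M) :
  (forall i, lin_span [set` s] (u i)) ->
  exists2 c : 'rV[C]_(size s).+1, c != 0 & \sum_i c 0 i *: u i = 0.
Proof.
move=> hu; have [a ha] := choice (fun i => lin_span_seq (hu i)).
pose A := \matrix_(i, j) a i j.
have kA : kermx A != 0.
  by rewrite -mxrank_eq0 mxrank_ker subn_eq0 -ltnNge ltnS rank_leq_col.
exists (nz_row (kermx A)); first by rewrite nz_row_eq0.
have cA : nz_row (kermx A) *m A = 0.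
  by apply/sub_kermxP; exact: nz_row_sub.
under eq_bigr do rewrite ha scaler_sumr.
rewrite exchange_big big1 // => j _ /=.
under eq_bigr do rewrite scalerA.
rewrite -scaler_suml; move/matrixP/(_ 0 j): cA; rewrite !mxE => h.
rewrite (_ : \sum_i _ = 0) ?scale0r // -[RHS]h.
by apply: eq_bigr => i _; rewrite !mxE.
Qed.

Lemma root_bound (P : {poly C}) : P != 0 ->
  exists L : nat, forall j : int, (L < `|j|)%N -> P.[j%:~R] != 0.
Proof.
move=> P0; apply: contrapT => hL.
have roots n : exists s : seq int, [/\ size s = n, uniq s & all (fun j : int => root P j%:~R) s].
  elim: n => [|n [s [ss us rs]]]; first by exists [::].
  apply: contrapT => hs; apply: hL; exists (\max_(j <- s) `|j|)%N => j jL.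
  apply/negP => rj; apply: hs; exists (j :: s); rewrite /= ss us rs /root rj !andbT.
  split=> //; apply: contraL jL => js; rewrite -leqNgt.
  by rewrite (big_rem j) //= leq_maxl.
have [s [ss us rs]] := roots (size P).
suff : (size [seq (j%:~R : C) | j <- s] < size P)%N by rewrite size_map ss ltnn.
apply: max_poly_roots P0 _ _; first by rewrite all_map.
by rewrite map_inj_uniq // => a b /eqP; rewrite eqr_int => /eqP.
Qed.

Lemma lower_banded (a : int -> C^o) :
  ((fun i j => if i == j + 1 then a j else 0) : matrix_inf R) \in @banded R.
Proof.
by apply/asboolP; exists 1%N => i j; case: eqP => // ->; lia.
Qed.
Definition lower_gl a : gl R := Gl (lower_banded a).

Lemma raise_banded (a : int -> C^o) :
  ((fun i j => if j == i + 1 then a i else 0) : matrix_inf R) \in @banded R.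
Proof.
by apply/asboolP; exists 1%N => i j; case: eqP => // ->; lia.
Qed.
Definition raise_gl a : gl R := Gl (raise_banded a).

Lemma lower_degree a : has_degree (-1) ((lower_gl a, 0) : glhat R).
Proof. by split=> // i j /=; case: ((i =P _)) => [-> _|]; rewrite ?eqxx //; lia. Qed.

Lemma raise_degree a : has_degree 1 ((raise_gl a, 0) : glhat R).
Proof. by split=> // i j /=; case: ((j =P _)) => [-> _|]; rewrite ?eqxx //; lia. Qed.

Lemma degree_parity k (x : glhat R) : has_degree k x -> has_parity (oddz k) x.
Proof.
move=> [h1 h2]; split=> [i j /h1 -> //|k1]; apply: h2.
by apply: contraTneq k1 => ->.
Qed.

Lemma bracket_raise_lower a b :
  bracket_gl (raise_gl b) (lower_gl a) =
  Gl (diag_inf_banded (fun j => b j * a j + b (j - 1) * a (j - 1))).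
Proof.
have pr : parity_gl true (raise_gl b) by have [] := degree_parity (raise_degree b).
have pl : parity_gl true (lower_gl a) by have [] := degree_parity (lower_degree a).
apply: glP => i j; rewrite (bracket_glE pr pl) expr1 scaleN1r opprK glE.
rewrite (@mul_gl_delta _ _ _ i j (i + 1)) => [|k /negbTE kn]; last by left; rewrite /= kn.
rewrite (@mul_gl_delta _ _ _ i j (i - 1)) => [|k kn]; last first.
  by left; rewrite /=; case: (i =P k + 1) kn => // ->; rewrite addrK eqxx.
rewrite /= /diag_inf subrK !eqxx (inj_eq (addIr 1)) [j == i]eq_sym.
by case: eqP => [->|_]; rewrite ?mulr0 ?addr0 // [a _ * _]mulrC.
Qed.

Variables (xi : {scalar cartan R}) (v : M).
Hypothesis hwv : is_hw_vector xi v.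
Hypothesis qfv : quasi_finite v.

(** The degree -1/2 vectors with coefficients j^i, for i up to the size of a spanning family, are
    dependent; this yields a non-zero polynomial p with [lower_gl p] killing v. Bracketing with
    [raise_gl b] shows that xi kills every diagonal with entries b_j p_j + b_(j-1) p_(j-1). Since p
    has no integer root far out, every diagonal supported far out has this form. *)
Lemma weight_far : exists L : nat, forall g : int -> C^o,
  (forall j : int, (`|j| <= L)%N -> g j = 0) -> xi (g, 0) = 0.
Proof.
have [s hs] := qfv (-1).
pose t i : int -> C^o := fun j => (j%:~R : C) ^+ i.
have ut (i : 'I_(size s).+1) : lin_span [set` s] (gm_act (lower_gl (t i), 0) v).
  rewrite -hs; exists 1%N, (fun=> 1), (fun=> gm_act (lower_gl (t i), 0) v).
  split=> [_|]; last by rewrite big_ord1 scale1r.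
  rewrite -[-1]addr0; apply: lowering_cons (lower_degree _) (lowering_nil _) => //.
have [c c0 hc] := span_dependent ut.
pose P := \poly_(i < (size s).+1) c 0 (inord i).
pose p : int -> C^o := fun j => P.[j%:~R].
have P0 : P != 0.
  apply: contra_neq c0 => P0; apply/rowP => i; rewrite mxE.
  have := congr1 (fun q : {poly C} => q`_i) P0.
  by rewrite coef_poly ltn_ord inord_val coef0.
have xp : gm_act (lower_gl p, 0) v = 0.
  rewrite -hc; under eq_bigr do rewrite -actZl.
  rewrite -act_suml; congr (gm_act _ v); rewrite [RHS]surjective_pairing; congr pair; last first.
    by elim/big_rec: _ => //= i x _ <-; rewrite scaler0 add0r.
  have -> : (\sum_i c 0 i *: ((lower_gl (t i), 0) : glhat R)).1 =
      \sum_i c 0 i *: lower_gl (t i).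
    by elim/big_rec2: _ => //= i x y _ ->.
  have lE f i j : lower_gl f i j = if i == j + 1 then f j else 0 by [].
  apply: glP => i j; rewrite sum_glE lE.
  under [RHS]eq_bigr do rewrite scale_glE lE.
  case: ifP => ij; last by rewrite big1 // => k _; rewrite mulr0.
  by rewrite /p horner_poly; apply: eq_bigr => k _; rewrite inord_val.
have [L hL] := root_bound P0.
(* The margin of 3 makes [a] and [b] vanish up to [L.+2]: this covers the possible roots of the
   polynomial and makes [raise_gl b] far enough for its cocycle with the width-one [lower_gl p] to
   vanish. *)
exists L.+3 => g hg.
(* [a] solves a_j + a_(j-1) = g_j outwards from the origin in both directions; [G n] is the value at
   [Negz n]. *)
pose F := fix F n := if n is n'.+1 then g n - F n' else (0 : C).
pose G := fix G n := if n is n'.+1 then g (Negz n') - G n' else (0 : C).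
pose a (j : int) : C := match j with Posz n => F n | Negz n => G n end.
have ag j : g j = a j + a (j - 1).
  case: j => [[|n]|n].
  - by rewrite hg //= addr0.
  - by rewrite (_ : Posz n.+1 - 1 = Posz n) /= ?subrK //; lia.
  - by rewrite (_ : Negz n - 1 = Negz n.+1) /= 1?addrC ?subrK //; lia.
have Fs n : (n <= L.+2)%N -> F n = 0.
  by elim: n => //= n IH nL; rewrite IH ?hg ?subrr //=; lia.
have Gs n : (n <= L.+2)%N -> G n = 0.
  by elim: n => //= n IH nL; rewrite IH ?hg ?subrr //=; lia.
have afar j : (`|j| <= L.+2)%N -> a j = 0.
  by case: j => n jL /=; [apply: Fs|apply: Gs]; lia.
pose b : int -> C^o := fun j => a j / p j.
have hb j : b j * p j = a j.
  have [jL|jL] := leqP `|j| L; first by rewrite /b afar ?mul0r //; lia.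
  by rewrite /b divfK // hL.
have bfar j : (`|j| <= L.+2)%N -> b j = 0 by move=> /afar a0; rewrite /b a0 mul0r.
have := gm_act_bracket v (degree_parity (raise_degree b)) (degree_parity (lower_degree p)).
case: hwv => v0 hv hplus _.
rewrite xp act0r (hplus _ _ _ (raise_degree b)) // act0r scaler0 subr0.
rewrite /bracket /= bracket_raise_lower (@alpha0 _ L.+1 1) //; last first.
- left=> i j /=; case: (j =P i + 1) => [->|_]; rewrite ?eqxx // => bi.
  have : ~ (`|i| <= L.+2)%N by move=> /bfar b0; rewrite b0 eqxx in bi.
  lia.
- left=> i j /=; case: (j =P i + 1) => [->|_]; rewrite ?eqxx // => _; lia.
move=> /eqP; rewrite -[X in gm_act X]/(cartan_incl (_, 0)) hv scaler_eq0 (negbTE v0) orbF => /eqP h.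
by rewrite -[RHS]h; congr (xi (_, _)); apply: funext => j; rewrite ag -!hb.
Qed.

Lemma weight_expand : exists L : nat, forall h,
  xi h = \sum_(j <- win L) zwt xi j * h.1 j + dwt xi * h.2 /\
  forall j : int, (L < `|j|)%N -> zwt xi j = 0.
Proof.
have [L hL] := weight_far; exists L => h; split; last first.
  by move=> j jL; apply: hL => i iL; rewrite /ind; case: eqP iL => // ->; rewrite leqNgt jL.
pose g : int -> C^o := fun j => if j \in win L then 0 else h.1 j.
have e : h = (\sum_(j <- win L) h.1 j *: ((ind R j, 0) : cartan R)) +
    h.2 *: ((0, 1) : cartan R) + (g, 0).
  rewrite [LHS]surjective_pairing [RHS]surjective_pairing; congr pair.
    have fstE (r : seq int) (f : int -> C) j :
        (\sum_(i <- r) f i *: ((ind R i, 0) : cartan R)).1 j = \sum_(i <- r) f i * (j == i)%:R.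
      by elim/big_rec2: _ => // i x y _ <-.
    apply: funext => j; rewrite -[RHS]/((\sum_(i <- win L) h.1 i *: ((ind R i, 0) : cartan R)).1 j
        + h.2 * 0 + g j) fstE mulr0 addr0 /g.
    rewrite (@big_win1 _ L j) => [|i ij]; last by rewrite eq_sym (negbTE ij) mulr0.
    by case: ifP => _; rewrite ?add0r // eqxx mulr1 addr0.
  have sndE (r : seq int) (f : int -> C) :
      (\sum_(i <- r) f i *: ((ind R i, 0) : cartan R)).2 = 0.
    by elim/big_rec: _ => //= i x _ ->; rewrite scaler0 addr0.
  by rewrite /= sndE add0r addr0 [RHS](mulr1 h.2).
rewrite [in LHS]e !raddfD /= (hL g) => [|j jL]; last by rewrite /g mem_win jL.
rewrite addr0 raddf_sum linearZ; congr (_ + _); last exact: mulrC.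
by apply: eq_bigr => j _; exact: (etrans (linearZ_LR xi _ _) (mulrC _ _)).
Qed.

End FiniteSupport.

(* Conditions (i)-(iii) for finitely supported integral weights, freed from the
   bounds [r] and [s]: the vanishing clauses become local ones. *)
Record wcond (z : int -> int) (d : nat) : Prop := WCond {
  wc_pos : forall p : int, 0 < p -> 0 <= z p;
  wc_neg : forall p : int, p <= 0 -> z p <= 0;
  wc_up_le : forall p : int, 0 < p -> z (p + 2) <= z p;
  wc_up_lt : forall p : int, 0 < p -> z p + z (p + 1) != 0 -> z (p + 2) < z p;
  wc_dn_le : forall p : int, p <= 0 -> z p <= z (p - 2);
  wc_dn_lt : forall p : int, p <= 0 -> z p + z (p - 1) != 0 -> z p < z (p - 2);
  wc_level : cond_iii d z }.

Definition wsum (R : realType) (L : nat) (z : int -> int) (d : nat) (h : cartan R) : R[i] :=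
  \sum_(j <- win L) (z j)%:~R * h.1 j + d%:R * h.2.

(** * Dominance on a chain p, q, r with p and r of equal parity *)

Section Chains.
Variable R : realType.
Local Notation C := (R[i]).
Variables (V : lmodType C) (E : int -> int -> {linear V -> V}).
Variable form : V -> V -> C.
Hypothesis E_comm : forall p q r s u, p \in predT -> q \in predT -> r \in predT -> s \in predT ->
  E p q (E r s u) = usgn R p q r s *: E r s (E p q u) + (q == r)%:R *: E p s u
                    - (usgn R p q r s * (p == s)%:R) *: E r q u.
Hypothesis form_linl : forall w, linear_for *%R (form^~ w).
Hypothesis form_pos : forall u, u != 0 -> 0 < form u u.
Hypothesis E_adj : forall p q u w, p \in predT -> q \in predT ->
  form (E p q u) w = ssgn R p * ssgn R q * form u (E q p w).

Variables (p q r : int) (u : V) (a b c : int).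
Hypotheses (u0 : u != 0) (pr : p != r) (pq_odd : oddz (q - p)) (qr_odd : oddz (r - q)).
Hypothesis pr_sgn : ssgn R p * ssgn R r = 1.
Hypotheses (pq_u : E p q u = 0) (pr_u : E p r u = 0) (qr_u : E q r u = 0).
Hypotheses (pp_u : E p p u = a%:~R *: u) (qq_u : E q q u = b%:~R *: u)
  (rr_u : E r r u = c%:~R *: u).

Let pr_even : ~~ oddz (r - p).
Proof. by rewrite -(subrK q r) -addrA oddzD qr_odd pq_odd. Qed.

Let pq : p != q. Proof. by apply: contraTneq pq_odd => ->; rewrite subrr. Qed.
Let qr : q != r. Proof. by apply: contraTneq qr_odd => ->; rewrite subrr. Qed.

Lemma chain_le : c <= a.
Proof.
have [n] := sl2_integral E_comm form_linl form_pos E_adj isT isT pr pr_even pr_sgn pr_u pp_u rr_u u0.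
by rewrite -rmorphB /= pmulrn => /eqP; rewrite eqr_int => /eqP; lia.
Qed.

(** The odd reflection in p, q gives a non-zero vector [E q p u], still of highest weight for the
    sl(2) of p and r, with p-weight a - 1; integrality now gives c <= a - 1. On the right, [E r q u]
    raises the r-weight to c + 1 instead. *)
Lemma chain_lt_left : a + b != 0 -> c < a.
Proof.
move=> ab.
have w0 : E q p u != 0.
  by apply: (odd_lower_neq0 E_comm) pp_u qq_u u0 _ => //; rewrite -rmorphD intr_eq0.
have prw : E p r (E q p u) = 0.
  rewrite E_comm // pr_u linear0 scaler0 add0r [r == q]eq_sym (negbTE qr) scale0r add0r.
  by rewrite qr_u scaler0 oppr0.
have ppw := E_weight_eigen E_comm (isT : p \in predT) (isT : q \in predT) (isT : p \in predT) pp_u.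
have rrw := E_weight_eigen E_comm (isT : r \in predT) (isT : q \in predT) (isT : p \in predT) rr_u.
have [n] := sl2_integral E_comm form_linl form_pos E_adj isT isT pr pr_even pr_sgn prw ppw rrw w0.
rewrite (negbTE pq) eqxx [r == q]eq_sym (negbTE qr) [r == p]eq_sym (negbTE pr).
rewrite addr0 subr0 addr0 -[1]/(1%:~R) -!rmorphB /= pmulrn => /eqP; rewrite eqr_int => /eqP; lia.
Qed.

Lemma chain_lt_right : b + c != 0 -> c < a.
Proof.
move=> bc.
have w0 : E r q u != 0.
  by apply: (odd_lower_neq0 E_comm) qq_u rr_u u0 _ => //; rewrite -rmorphD intr_eq0.
have prw : E p r (E r q u) = 0.
  rewrite E_comm // pr_u linear0 scaler0 add0r eqxx scale1r pq_u add0r.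
  by rewrite (negbTE pq) mulr0 scale0r oppr0.
have ppw := E_weight_eigen E_comm (isT : p \in predT) (isT : r \in predT) (isT : q \in predT) pp_u.
have rrw := E_weight_eigen E_comm (isT : r \in predT) (isT : r \in predT) (isT : q \in predT) rr_u.
have [n] := sl2_integral E_comm form_linl form_pos E_adj isT isT pr pr_even pr_sgn prw ppw rrw w0.
rewrite (negbTE pr) (negbTE pq) eqxx [r == q]eq_sym (negbTE qr).
rewrite !subr0 addr0 -[1]/(1%:~R) -rmorphD -rmorphB /= pmulrn => /eqP; rewrite eqr_int => /eqP; lia.
Qed.

End Chains.

(** * Unitarity implies the inequalities on the weight *)

Section Necessity.
Variable R : realType.
Local Notation C := (R[i]).
Variables (M : glhat_module R) (xi : {scalar cartan R}) (v : M).
Hypotheses (hwv : is_hw_vector xi v) (qfv : quasi_finite v).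

Lemma unitarizable_wcond : unitarizable M ->
  exists z d L, [/\ forall j : int, (L < `|j|)%N -> z j = 0, wcond z d & xi =1 wsum L z d].
Proof.
move=> [form form_adj].
have linl w : linear_for *%R (form^~ w) by move=> a x y; exact: linearPl.
have pos u : u != 0 -> 0 < form u u by exact: neq0_dnorm_gt0.
have EMadj p q (u w : M) : p \in predT -> q \in predT ->
    form (EM M p q u) w = ssgn R p * ssgn R q * form u (EM M q p w).
  move=> _ _; rewrite /EM /= /act_fun form_adj star_ehat actZl linearZr_LR /=; congr (_ * _).
  by rewrite rmorphM /ssgn !rmorphXn rmorphN1.
have [v0 _ _ _] := hwv.
have [L hL] := weight_expand hwv qfv.
have zfar j : (L < `|j|)%N -> zwt xi j = 0 by have [_ h] := hL 0; exact: h.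
have EMwt := EM_wt hwv; have EMhw := EM_hw hwv.
have sl2 (p q : int) : p < q -> ~~ oddz (q - p) -> ssgn R p * ssgn R q = 1 ->
    exists n : nat, zwt xi p + shift R p * dwt xi - (zwt xi q + shift R q * dwt xi) = n%:R.
  move=> pq ev sg.
  by apply: (sl2_integral (@EM_comm R M) linl pos EMadj (p := p) (q := q)) (EMhw _ _ pq) (EMwt _) (EMwt _) v0 => //; rewrite lt_eqF.
have par2 p q : ~~ oddz (q - p) -> oddz p = oddz q.
  by rewrite oddzB; case: (oddz p); case: (oddz q).
have sg1 p q : ~~ oddz (q - p) -> (0 < p) = (0 < q) -> ssgn R p * ssgn R q = 1.
  move=> /par2 e pq; rewrite (_ : ssgn R p = ssgn R q) ?ssgn_sq //.
  have nE t : negodd t = oddz t && ~~ (0 < t) by rewrite /negodd oddzE; lia.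
  by rewrite /ssgn !nE e pq.
have sh p q : ~~ oddz (q - p) -> (0 < p) = (0 < q) -> shift R p = shift R q.
  by move=> /par2 e pq; rewrite /shift e !leNgt pq.
have ev2 (n : int) : ~~ oddz (n * 2) by rewrite oddzE; lia.
(* The comparison index lies beyond the support of the weight and has the same parity and side as p,
   so the central shifts cancel and the sl(2) difference is the weight at p itself. *)
have zpos (p : int) : 0 < p -> exists n : nat, zwt xi p = n%:R.
  move=> p0; have ev : ~~ oddz (p + (L.+1)%:Z * 2 - p) by rewrite oddzE; lia.
  have same : (0 < p) = (0 < p + (L.+1)%:Z * 2) by lia.
  have [|n] := sl2 p (p + (L.+1)%:Z * 2) _ ev (sg1 _ _ ev same); first by lia.
  rewrite -(sh _ _ ev same) [zwt xi (p + _)]zfar; last by lia.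
  by rewrite add0r addrK => ->; exists n.
have zneg (p : int) : p <= 0 -> exists n : nat, - zwt xi p = n%:R.
  move=> p0; have ev : ~~ oddz (p - (p - (L.+1)%:Z * 2)) by rewrite oddzE; lia.
  have same : (0 < p - (L.+1)%:Z * 2) = (0 < p) by lia.
  have [|n] := sl2 (p - (L.+1)%:Z * 2) p _ ev (sg1 _ _ ev same); first by lia.
  rewrite -(sh _ _ ev same) [zwt xi (p - _)]zfar; last by lia.
  by rewrite add0r opprD addrCA subrr addr0 => ->; exists n.
(* Both comparison indices are even, hence fermionic, so the pair is unitary across the origin; both
   weights vanish there and the difference is the central charge. *)
have [d hd] : exists d : nat, dwt xi = d%:R.
  have [] := sl2 (- (L.+1)%:Z * 2) ((L.+1)%:Z * 2); first by lia.
  - by rewrite -mulrBl ev2.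
  - by rewrite /ssgn /negodd !(negbTE (ev2 _)) mulr1.
  move=> n; rewrite !zfar; [|lia|lia]; rewrite !add0r /shift !(negbTE (ev2 _)) !mul1r.
  have -> : ((L.+1)%:Z * 2 <= 0) = false by lia.
  by rewrite mul0r subr0 => ->; exists n.
have hzj (j : int) : exists n : int, zwt xi j = n%:~R.
  case: (lerP j 0) => [/zneg[n hn]|/zpos[n hn]]; last by exists n%:Z.
  by exists (- n%:Z); rewrite rmorphN /= -pmulrn -hn opprK.
have [z hz] := choice hzj.
pose k (p : int) : int := if p <= 0 then (if oddz p then - d%:Z else d%:Z) else 0.
have EMwtz p : EM M p p v = (z p + k p)%:~R *: v.
  rewrite EMwt hz hd rmorphD; congr ((_ + _) *: _); rewrite /shift /k.
  case: ifP => _; rewrite ?mulr0 ?mul0r // mulr1.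
  by case: ifP => _; rewrite ?expr1 ?mulN1r ?rmorphN ?mul1r.
have ne (p q : int) : p < q -> p != q by move=> ?; rewrite lt_eqF.
have che (p q r : int) : p < q -> q < r -> oddz (q - p) -> oddz (r - q) ->
    ssgn R p * ssgn R r = 1 -> z r + k r <= z p + k p.
  move=> pq qr opq oqr sg.
  by apply: (chain_le (@EM_comm R M) linl pos EMadj (p := p) (q := q) v0) => //;
    rewrite ?EMhw ?ne //; apply: lt_trans pq qr.
have chl (p q r : int) : p < q -> q < r -> oddz (q - p) -> oddz (r - q) ->
    ssgn R p * ssgn R r = 1 -> z p + k p + (z q + k q) != 0 -> z r + k r < z p + k p.
  move=> pq qr opq oqr sg.
  by apply: (chain_lt_left (@EM_comm R M) linl pos EMadj (p := p) (q := q) v0) => //;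
    rewrite ?EMhw ?ne //; apply: lt_trans pq qr.
have chr (p q r : int) : p < q -> q < r -> oddz (q - p) -> oddz (r - q) ->
    ssgn R p * ssgn R r = 1 -> z q + k q + (z r + k r) != 0 -> z r + k r < z p + k p.
  move=> pq qr opq oqr sg.
  by apply: (chain_lt_right (@EM_comm R M) linl pos EMadj (p := p) (q := q) v0) => //;
    rewrite ?EMhw ?ne //; apply: lt_trans pq qr.
have k0 (p : int) : 0 < p -> k p = 0 by move=> p0; rewrite /k lt_geF.
have z_ge (p : int) : 0 < p -> 0 <= z p.
  by move=> /zpos[n]; rewrite hz pmulrn => /eqP; rewrite eqr_int => /eqP ->.
have od1 (p q : int) : p = q + 1 -> oddz (p - q) by move=> ->; rewrite oddzE; lia.
have od2 (p q : int) : p = q + 2 -> ~~ oddz (p - q) by move=> ->; rewrite oddzE; lia.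
have k2 (p : int) : p <= 0 -> k (p - 2) = k p /\ k p + k (p - 1) = 0.
  move=> p0; have h2 : p - 2 <= 0 by lia.
  have h1 : p - 1 <= 0 by lia.
  rewrite /k !oddzB p0 h2 h1 addbF addbT; split=> //.
  by case: (oddz p) => /=; rewrite ?addrN ?addNr.
exists z, d, L; split.
- by move=> j /zfar/eqP; rewrite hz intr_eq0 => /eqP.
- split.
  + exact: z_ge.
  + by move=> p /zneg[n]; rewrite hz -rmorphN pmulrn => /eqP; rewrite eqr_int => /eqP; lia.
  + move=> p p0; have := che p (p + 1) (p + 2); rewrite !k0 ?addr0; [|lia|lia].
    by apply; [lia|lia|exact: od1|apply: od1; lia|apply: sg1; [exact: od2|lia]].
  + move=> p p0; have := chl p (p + 1) (p + 2); rewrite !k0 ?addr0; [|lia|lia|lia].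
    by apply; [lia|lia|exact: od1|apply: od1; lia|apply: sg1; [exact: od2|lia]].
  + move=> p p0; have [k21 _] := k2 p p0; have := che (p - 2) (p - 1) p; rewrite k21 lerD2r.
    by apply; [lia|lia|apply: od1; lia|apply: od1; lia|apply: sg1; [apply: od2; lia|lia]].
  + move=> p p0; have [k21 k22] := k2 p p0; have := chr (p - 2) (p - 1) p.
    rewrite k21 ltrD2r [z (p - 1) + _ + _]addrACA [k (p - 1) + _]addrC k22 addr0 [z (p - 1) + _]addrC.
    by apply; [lia|lia|apply: od1; lia|apply: od1; lia|apply: sg1; [apply: od2; lia|lia]].
  (* The chain of doubled indices 0, 1, 2 crosses the origin and gives z2 <= z0 + d, strictly unless
     z0 + d + z1 = 0. In the exceptional case the signs force z1 = z2 = 0. *)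
  + have sg02 : ssgn R 0 * ssgn R 2 = 1 by rewrite /ssgn mulr1.
    have ko : k 0 = d%:Z by [].
    have := che 0 1 2 isT isT isT isT sg02; have := chl 0 1 2 isT isT isT isT sg02.
    rewrite ko !(k0 1, k0 2) // !addr0 /cond_iii.
    have := z_ge 1 isT; have := z_ge 2 isT.
    move: (z 0 : int) (z 1 : int) (z 2 : int) => z0 z1 z2 h1 h2 h3 h4.
    have [z01|z01] := eqVneq (z0 + d%:Z + z1) 0; last have {}h3 := h3 z01.
      by case: (lerP z1 1) => h5; lia.
    by case: (lerP z1 1) => h5; lia.
- move=> h; have [-> _] := hL h; rewrite /wsum hd; congr (_ + _).
  by apply: eq_bigr => j _; rewrite hz.
Qed.

End Necessity.

(** * Combinatorics of the weights *)

Section Frobenius.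
Variable x : nat -> nat.
Hypothesis x_le : forall p, (0 < p)%N -> (x p.+2 <= x p)%N.
Hypothesis x_lt : forall p, (0 < p)%N -> (x p + x p.+1 != 0)%N -> (x p.+2 < x p)%N.

Let A i := x i.*2.-1.
Let B j := x j.*2.
(** Column j of the Young diagram with modified Frobenius coordinates A i = lambda_i - i + 1 and B j
    = lambda'_j - j. The first term counts the cells in rows beyond j, the second those in rows i <=
    j, where j <= lambda_i reads j < A i + i. *)
Definition colen (j : nat) : nat := (x j.*2 + count (fun i => j < x i.*2.-1 + i)%N (iota 1 j))%N.

Let B_pos j : (0 < j)%N -> (0 < B j)%N -> (0 < A j)%N.
Proof.
case: j => // j _; rewrite /B /A doubleS /= => Bj.
by apply: leq_ltn_trans (x_lt (p := j.*2.+1) _ _) => //; lia.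
Qed.

Let A_dec k i : (0 < i)%N -> (0 < A (i + k))%N -> (A (i + k) + k <= A i)%N.
Proof.
elim: k i => [|k IH] i i0; first by rewrite !addn0.
rewrite -addSnnS => Ak; have := IH _ (ltn0Sn i) Ak.
have -> : A i.+1 = x (i.*2.-1).+2 by rewrite /A doubleS; congr x; lia.
have i1 : (0 < i.*2.-1)%N by lia.
move=> h; have := x_le i1 => h1; have := x_lt i1.
rewrite -/(A i) in h1 *; move=> h2; have := h2 ltac:(lia); lia.
Qed.

Let colen_full j : (0 < j)%N -> (0 < A j)%N -> colen j = (B j + j)%N.
Proof.
move=> j0 Aj; rewrite /colen; congr addn; rewrite -[RHS](size_iota 1) -count_predT.
apply: eq_in_count => i; rewrite mem_iota => ij; rewrite [RHS]/=.
have i0 : (0 < i)%N by lia.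
have := @A_dec (j - i) i i0; rewrite subnKC; last lia.
by move=> /(_ Aj); rewrite -/(A i); lia.
Qed.

Lemma colen_sub j : (0 < j)%N -> (colen j - j)%N = x j.*2.
Proof.
move=> j0; have [Bj|Bj] := posnP (B j).
  rewrite /colen -/(B j) Bj add0n; apply/eqP; rewrite subn_eq0.
  by apply: leq_trans (count_size _ _) _; rewrite size_iota.
by rewrite colen_full ?B_pos // addnK.
Qed.

(** Conjugation of diagrams above the diagonal: column j reaches row i exactly when row i reaches
    column j. *)
Lemma leq_colen i j : (0 < i)%N -> (i <= j)%N -> (i <= colen j)%N = (j < x i.*2.-1 + i)%N.
Proof.
move=> i0 ij; rewrite -/(A i); apply/idP/idP => [|jA].
  apply: contraTT; rewrite -leqNgt -ltnNge => Aj.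
  have B0 : B j = 0%N.
    apply/eqP; rewrite -leqn0 leqNgt; apply/negP => /(B_pos (leq_trans i0 ij)).
    by have := @A_dec (j - i) i i0; rewrite subnKC // => h /[dup] h1 /h; lia.
  have -> : colen j = (count (fun k => j < A k + k) (iota 1 i.-1) + count (fun k => j < A k + k) (iota i (j - i.-1)))%N.
    rewrite /colen -/(B j) B0 add0n -count_cat -{2}(prednK i0) -[i.-1.+1]/(1 + i.-1)%N -iotaD.
    by rewrite subnKC //; lia.
  have -> : count (fun k => j < A k + k)%N (iota i (j - i.-1)) = 0%N.
    apply/eqP; rewrite -leqn0 leqNgt -has_count; apply/hasPn => k; rewrite mem_iota => ki.
    have [Ak|Ak] := posnP (A k); first by rewrite Ak; lia.
    have := @A_dec (k - i) i i0; rewrite subnKC; last lia.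
    by move=> /(_ Ak); lia.
  by have := count_size (fun k => j < A k + k)%N (iota 1 i.-1); rewrite size_iota; lia.
have -> : colen j = (B j + (count (fun i => j < A i + i) (iota 1 i) + count (fun i => j < A i + i) (iota i.+1 (j - i))))%N.
  by rewrite /colen -count_cat -[i.+1]/(1 + i)%N -iotaD subnKC.
suff -> : count (fun i => j < A i + i)%N (iota 1 i) = i by lia.
rewrite -[RHS](size_iota 1) -count_predT; apply: eq_in_count => k; rewrite mem_iota => ki; rewrite [RHS]/=.
have k0 : (0 < k)%N by lia.
have := @A_dec (i - k) k k0; rewrite subnKC; last lia.
by move=> h; have := h ltac:(lia); lia.
Qed.

Lemma colen_eq0 j : (0 < j)%N -> (x 1 < j)%N -> colen j = 0%N.
Proof.
move=> j0 xj; apply/eqP; rewrite -leqn0 leqNgt; have := leq_colen (isT : (0 < 1)%N) j0.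
by move=> ->; rewrite -leqNgt -[1.*2.-1]/1%N; lia.
Qed.

Lemma colen_dec j : (0 < j)%N -> (colen j.+1 <= colen j)%N.
Proof.
move=> j0; have [hj|hj] := leqP (colen j.+1) j.
  have [->//|c0] := posnP (colen j.+1).
  have := leq_colen c0 (leqW hj); rewrite leqnn leq_colen // => /esym; lia.
have Aj : (0 < A j.+1)%N.
  by have := leq_colen (ltn0Sn j) (leqnn j.+1); rewrite hj -/(A _) => /esym; lia.
have Aj' : (0 < A j)%N.
  by have := @A_dec 1 j j0; rewrite addn1 => /(_ Aj); lia.
have Bj : (B j.+1 < B j)%N.
  have := @x_lt j.*2; rewrite -[x j.*2.+1]/(A j.+1) => h; rewrite /B doubleS.
  by apply: h; lia.
by rewrite !colen_full //; lia.
Qed.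

(** The first column is the number of non-zero rows; it accounts for the two positive-index terms of
    condition (iii). *)
Lemma colen1 : colen 1 = (x 2 + minn (x 1) 1)%N.
Proof.
have -> : colen 1 = (x 2 + ((1 < x 1 + 1)%N + 0))%N by [].
by case: (x 1) => [|k]; lia.
Qed.

(** Row i is recovered by counting the columns j >= i that reach it, of which there are lambda_i - i
    + 1. *)
Lemma count_colen m i : (0 < i)%N -> (x 1 <= m)%N ->
  count (fun j => i <= colen j)%N (iota i m) = x i.*2.-1.
Proof.
move=> i0 xm; have Am : (A i <= m)%N.
  apply: leq_trans xm; have [->//|Ai] := posnP (A i).
  by have := @A_dec i.-1 1 isT; rewrite add1n prednK // => /(_ Ai); rewrite -[A 1]/(x 1); lia.
rewrite -(subnKC Am) iotaD count_cat.
have -> : count (fun j => i <= colen j)%N (iota (i + A i) (m - A i)) = 0%N.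
  apply/eqP; rewrite -leqn0 leqNgt -has_count; apply/hasPn => k; rewrite mem_iota => ki.
  have ik : (i <= k)%N by lia.
  by rewrite leq_colen // -/(A i); lia.
rewrite addn0 -[RHS](size_iota i) -count_predT.
apply: eq_in_count => k; rewrite mem_iota => ki; rewrite [RHS]/=.
have ik : (i <= k)%N by lia.
by rewrite leq_colen // -/(A i); lia.
Qed.
End Frobenius.

Definition half_cond (x : int -> int) : Prop := forall p : int, 0 < p ->
  [/\ 0 <= x p, x (p + 2) <= x p & x p + x (p + 1) != 0 -> x (p + 2) < x p].

(* The symmetry [p -> 1 - p] of the doubled indices exchanges (i) and (ii). *)
Definition mirror (x : int -> int) : int -> int := fun p => - x (1 - p).

Lemma wcondE z d : wcond z d <-> [/\ half_cond z, half_cond (mirror z) & cond_iii d z].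
Proof.
split=> [[h1 h2 h3 h4 h5 h6 h7]|[h1 h2 h3]].
  split=> // p p0; first by split; [exact: h1|exact: h3|exact: h4].
  have q0 : 1 - p <= 0 by lia.
  have e1 : 1 - (p + 2) = 1 - p - 2 by lia.
  have e2 : 1 - (p + 1) = 1 - p - 1 by lia.
  rewrite /mirror e1 e2; have := h2 _ q0; have := h5 _ q0; have := h6 _ q0.
  move=> a1 a2 a3; split; [by rewrite oppr_ge0|by rewrite lerN2|move=> a4; rewrite ltrN2].
  by apply: a1; rewrite -oppr_eq0 opprD.
have hm (p : int) : p <= 0 -> [/\ z p <= 0, z p <= z (p - 2) & z p + z (p - 1) != 0 -> z p < z (p - 2)].
  move=> p0; have q0 : 0 < 1 - p by lia.
  have [] := h2 _ q0; rewrite /mirror.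
  have -> : 1 - (1 - p) = p by lia.
  have -> : 1 - (1 - p + 2) = p - 2 by lia.
  have -> : 1 - (1 - p + 1) = p - 1 by lia.
  rewrite oppr_ge0 lerN2 ltrN2 -opprD oppr_eq0 => a1 a2 a3; split=> //.
by split=> // p p0; [have [] := h1 p p0|have [] := hm p p0|have [] := h1 p p0
  |have [] := h1 p p0|have [] := hm p p0|have [] := hm p p0].
Qed.

Lemma cond_ii_mirror (s : int) xi : cond_i (- s) (mirror xi) <-> cond_ii s xi.
Proof.
have E (i j : int) : j = 1 - i -> mirror xi i = - xi j by move=> ->.
have e1 : mirror xi (- s * 2) = - xi (s * 2 + 1) by apply: E; lia.
have e2 : mirror xi (- s * 2 - 1) = - xi (s * 2 + 2) by apply: E; lia.
have a1 (i : int) : mirror xi (i * 2 + 1) = - xi (- i * 2) by apply: E; lia.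
have a2 (i : int) : mirror xi (i * 2 - 1) = - xi (- i * 2 + 2) by apply: E; lia.
have a3 (i : int) : mirror xi (i * 2 + 2) = - xi ((- 1 - i) * 2 + 1) by apply: E; lia.
have a4 (i : int) : mirror xi (i * 2) = - xi ((- 1 - i) * 2 + 3) by apply: E; lia.
have N1 (i : int) : - 1 - (- 1 - i) = i by lia.
have m1 : (mirror xi 1 = 0) <-> (xi 0 = 0) by rewrite (E 1 0) //; split; lia.
have m2 : (mirror xi 2 = 0) <-> (xi (-1) = 0) by rewrite (E 2 (-1)) //; split; lia.
have ms : (mirror xi (- s * 2 - 1) = 0) <-> (xi (s * 2 + 2) = 0) by rewrite e2; split; lia.
split=> [[h1 h2 h3 h4 [h5 h6]]|[h1 h2 h3 h4 [h5 h6]]].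
  split.
  - by move=> i hi; have := h3 (- 1 - i) ltac:(lia); rewrite a3 a4 ltrN2 N1.
  - by rewrite -oppr_ge0 -e1.
  - by move=> i hi; have := h1 (- i) ltac:(lia); rewrite a1 a2 ltrN2 opprK.
  - by rewrite -oppr_ge0 -e2.
  - split=> [/ms/h5[se /m1 ? /m2 ?]|[se ? ?]]; first by split=> //; lia.
    by apply/ms/h6; split; [lia|apply/m1|apply/m2].
split.
- by move=> i hi; rewrite a1 a2 ltrN2; apply: h3; lia.
- by rewrite e2 oppr_ge0.
- by move=> i hi; rewrite a3 a4 ltrN2; apply: h1; lia.
- by rewrite e1 oppr_ge0.
- split=> [/ms/h5[se ? ?]|[se /m1 ? /m2 ?]]; first by split; [lia|apply/m1|apply/m2].
  by apply/ms/h6; split=> //; lia.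
Qed.

(** Everything hinges on the first n with x n = x (n + 1) = 0: from there on all entries vanish, and
    before it the hypothesis of the strict inequality holds. *)
Lemma half_cond_rank x : half_cond x -> (exists L : nat, forall j : int, (L < `|j|)%N -> x j = 0) ->
  exists r : int, [/\ 1 <= r, cond_i r x & forall p : int, r * 2 < p -> x p = 0].
Proof.
move=> hx [L hL].
pose Q n := (0 < n)%N && (x n%:Z == 0) && (x (n%:Z + 1) == 0).
have exQ : exists n, Q n by exists L.+1; rewrite /Q !hL ?eqxx //; lia.
have [n /andP[/andP[n0 /eqP xn] /eqP xn1] nmin] := ex_minnP exQ.
have zero (k : nat) : x (n%:Z + k%:Z) = 0 /\ x (n%:Z + k%:Z + 1) = 0.
  elim: k => [|k [IH1 IH2]]; first by rewrite addr0.
  rewrite (_ : n%:Z + k.+1%:Z = n%:Z + k%:Z + 1); last lia.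
  split=> //; have [|_ + _] := hx (n%:Z + k%:Z); first by lia.
  have [|+ _ _] := hx (n%:Z + k%:Z + 2); first by lia.
  rewrite IH1 (_ : n%:Z + k%:Z + 1 + 1 = n%:Z + k%:Z + 2); last lia.
  by move=> ge0 le0; apply: le_anti; rewrite ge0 le0.
have ne (p : int) : 0 < p -> p < n%:Z -> x p + x (p + 1) != 0.
  move=> p0 pn; apply/negP => /eqP e; have [xp _ _] := hx p p0; have [xp1 _ _] := hx (p + 1) ltac:(lia).
  suff /nmin : Q `|p|%N by lia.
  by rewrite /Q gtz0_abs // -andbA; apply/and3P; split; lia.
(* For a non-zero sequence n is 2r or 2r + 1, according to whether x (2r) vanishes; the zero
   sequence has n = 1 and the conventional bound 1. *)
exists (Num.max 1 (n./2)%:Z); set r := Num.max _ _.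
have r1 : 1 <= r by rewrite /r; lia.
have rn : n%:Z <= r * 2 + 1 by rewrite /r; lia.
have nr : r = 1 \/ r * 2 <= n%:Z by rewrite /r; lia.
split=> //; last first.
  move=> p pr; have [+ _] := zero `|(p - n%:Z)%R|%N.
  by rewrite (_ : n%:Z + _ = p) //; lia.
split.
- move=> i hi; have [|_ _] := hx (i * 2 - 1); first by lia.
  by rewrite (_ : i * 2 - 1 + 2 = i * 2 + 1); last lia; apply; apply: ne; lia.
- by have [] := hx (r * 2 - 1) ltac:(lia).
- by move=> i hi; have [|_ _] := hx (i * 2); [lia|apply; apply: ne; lia].
- by have [] := hx (r * 2) ltac:(lia).
- split=> [e|[-> //]].
  have [n1|n2] := leqP n 1.
    have n1' : n = 1%N by lia.
    by rewrite n1' in xn xn1; split=> //; rewrite /r n1'.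
  have nr' : r * 2 <= n%:Z by rewrite /r; lia.
  have := ne (r * 2 - 1) ltac:(lia) ltac:(lia) => h.
  have [_ _ /(_ h)] := hx (r * 2 - 1) ltac:(lia).
  rewrite e => h2; have [h3 _ _] := hx (r * 2 - 1 + 2) ltac:(lia).
  by rewrite ltNge h3 in h2.
Qed.

Lemma weight_wsum (R : realType) (s r : int) d (xi_ z : int -> int) L (h : cartan R) :
  (forall j, z j = if s * 2 + 1 <= j <= r * 2 then xi_ j else 0) ->
  (forall j : int, (L < `|j|)%N -> z j = 0) ->
  weight s r d xi_ h = wsum L z d h.
Proof.
move=> hz zL; rewrite /weight /wsum; congr (_ + _).
have memE j : (j \in [set j : int | s * 2 + 1 <= j <= r * 2]%classic) = (s * 2 + 1 <= j <= r * 2).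
  by apply/idP/idP => [/set_mem|/mem_set].
rewrite fsbig_mkcond (fsbigE (win L)) ?win_uniq //=; last first.
  move=> j _ jL; rewrite /patch memE; case: ifP => // jsr.
  rewrite mem_win -ltnNge in jL; have := zL j jL; rewrite hz jsr => ->.
  by rewrite mulr0z mul0r.
apply: eq_big => [j|j _]; first by rewrite in_setT.
by rewrite hz /patch memE; case: ifP => // _; rewrite mul0r.
Qed.

Lemma wcond_conds z d L : wcond z d -> (forall j : int, (L < `|j|)%N -> z j = 0) ->
  exists s r : int, [/\ s <= -1 /\ 1 <= r, cond_i r z, cond_ii s z, cond_iii d z &
    forall j, z j = if s * 2 + 1 <= j <= r * 2 then z j else 0].
Proof.
move=> /wcondE[hp hn h3] zL.
have [|r [r1 cr zr]] := half_cond_rank hp; first by exists L.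
have [|s [s1 cs zs]] := half_cond_rank hn.
  by exists L.+1 => j jL; rewrite /mirror zL ?oppr0 //; lia.
exists (- s), r; split=> //; first by split=> //; lia.
  by apply/cond_ii_mirror; rewrite opprK.
move=> j; case: ifP => // /negbT; rewrite negb_and -!ltNge => /orP[jl|/zr //].
have := zs (1 - j) ltac:(lia); rewrite /mirror (_ : 1 - (1 - j) = j); last lia.
by move/eqP; rewrite oppr_eq0 => /eqP.
Qed.

Lemma cond_i_half (r : int) x : 1 <= r -> cond_i r x ->
  half_cond (fun p => if p <= r * 2 then x p else 0).
Proof.
move=> r1 [h1 h2 h3 h4 [h5 _]].
have step (p : int) : 0 < p -> p + 2 <= r * 2 -> x (p + 2) < x p.
  move=> p0 pr; have [[q e]|[q e]] : (exists q, p = q * 2) \/ (exists q, p = q * 2 - 1).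
    by have := divz_eq p 2; case: (boolP (oddz p)); rewrite oddzE => hp e;
      [right; exists ((p %/ 2)%Z + 1)|left; exists (p %/ 2)%Z]; lia.
  - by rewrite e; apply: h3; lia.
  - by rewrite e (_ : q * 2 - 1 + 2 = q * 2 + 1); [apply: h1|]; lia.
have pos (k : nat) (p : int) : 0 < p -> p <= r * 2 -> r * 2 - p <= k%:Z -> 0 <= x p.
  elim: k p => [|k IH] p p0 pr pk; first by rewrite (_ : p = r * 2) //; lia.
  have [pr2|pr2] := lerP (p + 2) (r * 2).
    by apply: le_trans (ltW (step p p0 pr2)); apply: IH; lia.
  have [->//|->//] : p = r * 2 \/ p = r * 2 - 1 by lia.
have {}pos (p : int) : 0 < p -> p <= r * 2 -> 0 <= x p.
  by move=> p0 pr; exact: (pos `|(r * 2 - p)%R|%N p p0 pr ltac:(lia)).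
have lt (p : int) : 0 < p ->
    (if p <= r * 2 then x p else 0) + (if p + 1 <= r * 2 then x (p + 1) else 0) != 0 ->
    (if p + 2 <= r * 2 then x (p + 2) else 0) < (if p <= r * 2 then x p else 0).
  move=> p0; case: (lerP (p + 2) (r * 2)) => pr2.
    have pr : p <= r * 2 by lia.
    by rewrite pr => _; apply: step.
  case: (lerP p (r * 2)) => pr; last first.
    have -> : (p + 1 <= r * 2) = false by lia.
    by rewrite addr0 eqxx.
  case: (lerP (p + 1) (r * 2)) => pr1; last by rewrite addr0 lt_neqAle eq_sym pos // andbT.
  have pe : p = r * 2 - 1 by lia.
  (* At the last odd index strictness rests on the vanishing clause: x (2r - 1) = 0 would force x
     (2r) = 0 too, contradicting [ne0]. *)
  rewrite pe subrK => ne0; rewrite lt_neqAle eq_sym h2 andbT.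
  apply: contra_neq ne0 => e; have [re e1 e2] := h5 e.
  by rewrite re /= e1 e2.
move=> p p0; split.
- by case: ifP => // pr; apply: pos.
- have [e|/(lt p p0)/ltW //] :=
    eqVneq ((if p <= r * 2 then x p else 0) + (if p + 1 <= r * 2 then x (p + 1) else 0)) 0.
  case: (lerP (p + 2) (r * 2)) => pr2; last by case: ifP => // pr; apply: pos.
  have pr : p <= r * 2 by lia.
  by rewrite pr ltW // step.
- exact: lt.
Qed.

Lemma conds_wcond (s r : int) d xi_ : s <= -1 -> 1 <= r ->
  cond_i r xi_ -> cond_ii s xi_ -> cond_iii d xi_ ->
  wcond (fun j => if s * 2 + 1 <= j <= r * 2 then xi_ j else 0) d.
Proof.
move=> s1 r1 ci cii ciii; apply/wcondE; split.
- move=> p p0; have := cond_i_half r1 ci p0.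
  have E (q : int) : 0 < q -> (s * 2 + 1 <= q <= r * 2) = (q <= r * 2) by lia.
  by rewrite !E //; lia.
- have s1' : 1 <= - s by lia.
  move=> p p0; have := cond_i_half s1' ((cond_ii_mirror s xi_).2 cii) p0.
  have E (q : int) : 0 < q ->
      - (if s * 2 + 1 <= 1 - q <= r * 2 then xi_ (1 - q) else 0) = if q <= - s * 2 then mirror xi_ q else 0.
    move=> q0; rewrite /mirror (_ : (s * 2 + 1 <= 1 - q <= r * 2) = (q <= - s * 2)); last lia.
    by case: ifP => _ //; rewrite oppr0.
  by rewrite /mirror !E //; lia.
- move: ciii; rewrite /cond_iii.
  have -> : s * 2 + 1 <= 1 <= r * 2 by lia.
  have -> : s * 2 + 1 <= 2 <= r * 2 by lia.
  by have -> : s * 2 + 1 <= 0 <= r * 2 by lia.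
Qed.

(** * Generalized partitions from their column lengths *)

Lemma count_antitone (P : pred nat) T t : (forall k, P k.+1 -> P k) -> (t < T)%N ->
  (t < count P (iota 0 T))%N = P t.
Proof.
move=> antiP; have anti k l : (k <= l)%N -> P l -> P k.
  by move=> kl; rewrite -(subnKC kl); elim: (l - k)%N => [|n IH]; rewrite ?addn0 // addnS => /antiP.
move=> tT; apply/idP/idP => [|Pt].
  apply: contraTT => nPt; rewrite -leqNgt -(subnKC (ltnW tT)) iotaD count_cat add0n.
  rewrite [X in (_ + X)%N](_ : _ = 0%N) ?addn0.
    by apply: leq_trans (count_size _ _) _; rewrite size_iota.
  apply/eqP; rewrite -leqn0 leqNgt -has_count; apply/hasPn => k; rewrite mem_iota => kt.
  by apply: contra nPt; apply: anti; lia.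
rewrite -(subnKC tT) iotaD count_cat ltn_addr //.
have : all P (iota 0 t.+1).
  by apply/allP => k; rewrite mem_iota => kt; apply: anti Pt; lia.
by rewrite all_count size_iota => /eqP ->.
Qed.

Lemma count_ltn n d : count (fun i => i < n)%N (iota 0 d) = minn n d.
Proof.
elim: d n => [|d IH] n; first by rewrite minn0.
by rewrite -addn1 iotaD count_cat IH /= add0n; case: (ltnP d n); lia.
Qed.

(** Part i is the largest j with i < N j. [f] finds it by counting the j in ]-K, K] with this
    property, an initial segment by monotonicity, since N is constant outside that range. *)
Lemma tuple_of_counts d (N : int -> nat) K :
  (forall j : int, (N (j + 1)%R <= N j)%N) -> (forall j : int, j <= - K%:Z -> N j = d) ->
  (forall j : int, K%:Z < j -> N j = 0%N) ->
  exists2 lam : d.-tuple int, gen_partition lam &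
    forall j : int, count (fun x => j <= x) lam = N j.
Proof.
move=> N_dec Nd N0.
pose P i (t : nat) := (i < N (t%:Z + 1 - K%:Z)%R)%N.
pose f (i : nat) : int := (count (P i) (iota 0 K.*2))%:Z - K%:Z.
have fP (i : nat) (j : int) : (i < d)%N -> (j <= f i) = (i < N j)%N.
  move=> id; case: (lerP j (- K%:Z)) => jK; first by rewrite Nd // id /f; lia.
  case: (lerP j K%:Z) => jK'; last first.
    rewrite N0 // ltn0 /f; have := count_size (P i) (iota 0 K.*2); rewrite size_iota; lia.
  have ej : j = `|(j - 1 + K%:Z)%R|%N%:Z + 1 - K%:Z by lia.
  have tT : (`|(j - 1 + K%:Z)%R|%N < K.*2)%N by lia.
  have := @count_antitone (P i) _ _ _ tT; rewrite /P -ej => <-; last first.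
    by move=> k Pk; apply: (leq_trans Pk); rewrite (_ : k.+1%:Z + 1 - K%:Z = (k%:Z + 1 - K%:Z) + 1) //; lia.
  by rewrite /f -/(P i); move: tT ej; set c := count _ _; lia.
have Nle (j : int) : (N j <= d)%N.
  case: (lerP j (- K%:Z)) => jK; first by rewrite Nd.
  rewrite (_ : j = - K%:Z + `|(j + K%:Z)%R|%N%:Z); last lia.
  elim: `|_|%N => [|n IH]; first by rewrite Nd // addr0.
  by apply: leq_trans IH; rewrite (_ : _ + n.+1%:Z = (- K%:Z + n%:Z) + 1) //; lia.
exists [tuple of mkseq f d].
  rewrite /gen_partition /= /mkseq; apply: (homo_sorted_in (P := [pred i | (i < d)%N]) (e := leq)).
  - move=> i j id jd ij; rewrite /= fP //; apply: leq_ltn_trans ij _.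
    by rewrite -fP //=.
  - by apply/allP => i; rewrite mem_iota.
  - exact: iota_sorted.
move=> j; rewrite /= count_map -[RHS](minn_idPl (Nle j)) -count_ltn.
by apply: eq_in_count => i; rewrite mem_iota => id /=; rewrite fP.
Qed.

(* [G j] and [H j] are the column lengths of lambda^+ and mu, the latter shifted by
   one; the odd entries are row lengths, counted from the columns, and [m] only has
   to exceed all rows and columns. *)
Definition zz (m : nat) (G H : nat -> nat) (p : int) : int :=
  let k := `|p|./2 in
  if 0 < p then
    if oddz p then (count (fun j => k < G j)%N (iota k.+1 m))%:Z else (G k - k)%N%:Z
  else - (if oddz p then (count (fun j => k < H j)%N (iota k.+1 m))%:Z else (H k - k)%N%:Z).

Definition Ncnt (lam : seq int) (j : nat) : nat := count (fun x => j%:Z <= x) lam.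
Definition Hcnt (lam : seq int) (j : nat) : nat := count (fun x => x < - j%:Z) lam.

Lemma wcond_lambda z d : wcond z d ->
  exists lam : d.-tuple int, gen_partition lam /\
    exists m1, forall m, (m1 <= m)%N -> z =1 zz m (Ncnt lam) (Hcnt lam).
Proof.
move=> /wcondE[hp hn h3].
pose xp p := `|z p%:Z|%N; pose xn p := `|z (- p%:Z)|%N.
have xpE (p : nat) : (0 < p)%N -> z p%:Z = (xp p)%:Z.
  by move=> p0; have [] := hp p%:Z p0 => ge _ _; rewrite /xp gez0_abs.
have hn' (p : nat) : [/\ z (- p%:Z) <= 0, z (- p%:Z) <= z (- p.+2%:Z)
    & z (- p%:Z) + z (- p.+1%:Z) != 0 -> z (- p%:Z) < z (- p.+2%:Z)].
  have [] := hn p.+1%:Z isT; rewrite /mirror.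
  have -> : 1 - p.+1%:Z = - p%:Z by lia.
  have -> : 1 - (p.+1%:Z + 2) = - p.+2%:Z by lia.
  have -> : 1 - (p.+1%:Z + 1) = - p.+1%:Z by lia.
  rewrite oppr_ge0 lerN2 ltrN2 -opprD oppr_eq0; split=> //.
have xnE (p : nat) : z (- p%:Z) = - (xn p)%:Z.
  by have [le _ _] := hn' p; rewrite /xn ; lia.
have xp_le p : (0 < p)%N -> (xp p.+2 <= xp p)%N.
  move=> p0; have [_ + _] := hp p%:Z p0.
  by rewrite (_ : p%:Z + 2 = p.+2%:Z) ?xpE //; lia.
have xp_lt p : (0 < p)%N -> (xp p + xp p.+1 != 0)%N -> (xp p.+2 < xp p)%N.
  move=> p0; have [_ _] := hp p%:Z p0.
  have -> : p%:Z + 2 = p.+2%:Z by lia.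
  have -> : p%:Z + 1 = p.+1%:Z by lia.
  by rewrite !xpE.
have xn_le p : (xn p.+2 <= xn p)%N.
  by have [_ + _] := hn' p; rewrite !xnE; lia.
have xn_lt p : (xn p + xn p.+1 != 0)%N -> (xn p.+2 < xn p)%N.
  by have [_ _] := hn' p; rewrite !xnE; lia.
(* The coordinates at non-positive indices are those of mu with its first column removed, because xn
   (2k - 1) = mu_k - k. The removed column has length [xn 0] and becomes [H 0]; the later columns of
   mu are the values of [colen xn]. *)
pose G := colen xp; pose H j := if j is 0 then xn 0 else colen xn j.
have GH : (G 1 + H 0 <= d)%N.
  have e1 : z 1 = (xp 1)%:Z by exact: (xpE 1).
  have e2 : z 2 = (xp 2)%:Z by exact: (xpE 2).
  have e0 : z 0 = - (xn 0)%:Z by exact: (xnE 0).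
  by move: h3; rewrite /cond_iii /G colen1 e1 e2 e0 /H; move: (xp 1) (xp 2) (xn 0); lia.
have Hdec j : (H j.+1 <= H j)%N.
  case: j => [|j]; last exact: (colen_dec (fun p _ => xn_le p) (fun p _ => @xn_lt p) (ltn0Sn j)).
  rewrite /H colen1; have := xn_le 0%N.
  by have [+|/xn_lt] := eqVneq (xn 0 + xn 1)%N 0%N; move: (xn 2) (xn 1) (xn 0) => a b c; lia.
have Gdec j : (G j.+2 <= G j.+1)%N by apply: colen_dec.
(* The number of parts at least j: a column of lambda^+ for positive j, and d minus a column of mu
   otherwise. Condition (iii), in the form [GH], makes it non-increasing across the origin. *)
pose N (j : int) : nat := match j with
  | Posz 0 => (d - H 0)%N | Posz (S k) => G k.+1 | Negz k => (d - H k.+1)%N end.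
have Hd j : (H j <= d)%N.
  by elim: j => [|j IH]; [exact: leq_trans (leq_addl _ _) GH|exact: leq_trans (Hdec j) IH].
have [K [Kp Kn]] : exists K, (xp 1 < K)%N /\ (xn 1 < K)%N.
  by exists (maxn (xp 1).+1 (xn 1).+1); rewrite leq_maxl leq_maxr.
have G0 j : (K < j)%N -> G j = 0%N by move=> Kj; exact: (colen_eq0 xp_le xp_lt (leq_ltn_trans (leq0n _) Kj) (ltn_trans Kp Kj)).
have H0 j : (K <= j)%N -> H j = 0%N.
  case: j => [|j] Kj; first by move: (leq_trans Kn Kj).
  by apply: (colen_eq0 (fun p _ => xn_le p) (fun p _ => @xn_lt p) (ltn0Sn j)); exact: leq_trans Kn Kj.
have [lam lams lamN] : exists2 lam : d.-tuple int, gen_partition lam &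
    forall j : int, count (fun x => j <= x) lam = N j.
  apply: (@tuple_of_counts _ _ K).
  - case=> [[|k]|[|k]].
    + by change (G 1 <= d - H 0)%N; rewrite leq_subRL ?(Hd 0%N) // addnC.
    + have -> : Posz k.+1 + 1 = Posz k.+2 by lia.
      exact: Gdec.
    + by change (d - H 0 <= d - H 1)%N; apply: leq_sub2l.
    + have -> : Negz k.+1 + 1 = Negz k by lia.
      exact: leq_sub2l.
  - case=> [[|k]|k] jK; try by exfalso; clear -jK Kp; lia.
    change (d - H k.+1 = d)%N; rewrite H0 ?subn0 //; clear -jK; lia.
  - case=> [[|k]|k] jK; try by exfalso; clear -jK; lia.
    change (G k.+1 = 0%N); rewrite G0 //; clear -jK; lia.
exists lam; split=> //.
have NG j : Ncnt lam j.+1 = G j.+1 by rewrite /Ncnt lamN.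
have HH j : Hcnt lam j = H j.
  have -> : Hcnt lam j = (d - N (- j%:Z))%N.
    rewrite -lamN -[X in (X - _)%N](size_tuple lam) -(count_predC (fun x => - j%:Z <= x) lam) addKn.
    by apply: eq_count => x /=; rewrite ltNge.
  case: j => [|j]; first by change (d - (d - H 0) = H 0)%N; rewrite subKn.
  by change (d - (d - H j.+1) = H j.+1)%N; rewrite subKn.
exists (maxn (xp 1) (xn 1)) => m mm p; rewrite /zz.
have Godd k : count (fun j => k < Ncnt lam j)%N (iota k.+1 m) = xp k.*2.+1.
  rewrite -[k.*2.+1]/(k.+1.*2.-1) -(count_colen xp_le xp_lt (m := m)) //; last exact: leq_trans (leq_maxl _ _) mm.
  by apply: eq_in_count => -[|j]; rewrite mem_iota //= => _; rewrite NG.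
have Hodd k : count (fun j => k < Hcnt lam j)%N (iota k.+1 m) = xn k.*2.+1.
  rewrite -[k.*2.+1]/(k.+1.*2.-1) -(count_colen (fun p _ => xn_le p) (fun p _ => @xn_lt p) (m := m)) //; last exact: leq_trans (leq_maxr _ _) mm.
  by apply: eq_in_count => -[|j]; rewrite mem_iota //= => _; rewrite HH.
have pE : p = (if 0 < p then 1 else -1) * (if oddz p then (`|p|./2.*2.+1)%:Z else (`|p|./2.*2)%:Z).
  by rewrite /oddz; case: ifP => p0; case: ifP => po; lia.
case: ifP pE => p0; case: ifP => po; rewrite ?mul1r ?mulN1r => pE.
- by rewrite Godd {1}pE xpE.
- have [k ke] : exists k, `|p|./2 = k.+1 by exists (`|p|./2).-1; lia.
  by rewrite ke NG /G colen_sub // {1}pE ke xpE.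
- by rewrite Hodd {1}pE xnE.
- rewrite HH {1}pE xnE; case: `|p|./2 => [|k]; first by rewrite /= subn0.
  by rewrite /H (colen_sub (fun p _ => xn_le p) (fun p _ => @xn_lt p) (ltn0Sn k)).
Qed.

(** * The weight Lambda(lambda) in terms of column lengths *)

Lemma nth_transpose (mu : seq nat) i j : sorted geq mu -> (0 < j)%N ->
  (j <= nth 0 mu i)%N = (i < transpose_part mu j)%N.
Proof.
rewrite /transpose_part => + j0; elim: mu i => [|x mu IH] i smu.
  by rewrite nth_nil /=; lia.
have geq_trans : transitive geq by move=> a b c h1 h2; exact: leq_trans h2 h1.
have le_x : all (fun y => y <= x)%N mu := order_path_min geq_trans smu.
have smu' : sorted geq mu := path_sorted smu.
case: (leqP j x) => jx.
  by case: i => [|i] /=; rewrite jx // add1n ltnS IH.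
have -> : count (leq j) (x :: mu) = 0%N.
  apply/eqP; rewrite -leqn0 leqNgt -has_count; apply/hasPn => y; rewrite inE -ltnNge.
  by case/predU1P => [->//|/(allP le_x) yx]; apply: leq_ltn_trans jx.
rewrite ltn0; apply/negbTE; rewrite -ltnNge.
have [im|im] := ltnP i (size (x :: mu)); last by rewrite nth_default.
have := mem_nth 0%N im; rewrite inE => /predU1P[->//|/(allP le_x) yx].
exact: leq_ltn_trans jx.
Qed.

Lemma leq_rank (mu : seq nat) k : sorted geq mu ->
  (k < rank_part mu)%N = (k < nth 0 mu k)%N.
Proof.
move=> smu; rewrite /rank_part; apply/idP/idP => [|kmu].
  apply: contraTT; rewrite -!leqNgt => muk; apply/bigmax_leqP => i /= imu.
  rewrite leqNgt; apply/negP => ki.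
  have := imu; rewrite nth_transpose // => i1.
  have : (i.+1 <= nth 0 mu k)%N by rewrite nth_transpose //; apply: leq_ltn_trans i1.
  by lia.
have ks : (k < size mu)%N.
  by rewrite ltnNge; apply: contraL kmu => /(nth_default 0%N) ->.
exact: (@leq_bigmax_cond _ (fun i : 'I_(size mu) => i.+1 <= nth 0 mu i)%N
  (fun i : 'I_(size mu) => i.+1) (Ordinal ks)).
Qed.

Lemma nonzero_rank (mu : seq nat) : sorted geq mu -> nonzero_part mu = (0 < rank_part mu)%N.
Proof.
move=> smu; rewrite leq_rank // nth_transpose // /transpose_part -has_count.
by apply: eq_has => m; rewrite lt0n.
Qed.

Lemma count_lt_iota n a m : count (fun j => j < n)%N (iota a m) = (minn n (a + m) - a)%N.
Proof.
elim: m => [|m IH]; first by rewrite addn0 /=; lia.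
by rewrite -addn1 iotaD count_cat IH /=; case: (ltnP (a + m) n); lia.
Qed.

Section LambdaWeights.
Variables (d : nat) (lam : d.-tuple int).
Hypothesis lam_sorted : gen_partition lam.

Lemma lam_plus_sorted : sorted geq (lam_plus lam).
Proof.
apply: homo_sorted lam_sorted => x y /= xy; lia.
Qed.

Lemma lam_mu_sorted : sorted geq (lam_mu lam).
Proof.
rewrite /lam_mu /lam_minus -map_comp rev_sorted.
apply: homo_sorted lam_sorted => x y /= xy; lia.
Qed.

Lemma transpose_plus j : (0 < j)%N -> transpose_part (lam_plus lam) j = Ncnt lam j.
Proof.
by move=> j0; rewrite /transpose_part /lam_plus count_map; apply: eq_count => x /=; lia.
Qed.

Lemma transpose_mu j : transpose_part (lam_mu lam) j.+1 = Hcnt lam j.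
Proof.
rewrite /transpose_part /lam_mu /lam_minus count_rev !count_map.
by apply: eq_count => x /=; lia.
Qed.

Lemma nth_lam_minus k : (k < d)%N ->
  nth 0 (lam_minus lam) (d - k.+1) = - (nth 0%N (lam_mu lam) k)%:Z.
Proof.
move=> kd; have sm : size (lam_minus lam) = d by rewrite size_map size_tuple.
rewrite /lam_mu nth_rev size_map sm //.
have hk : (d - k.+1 < size (lam_minus lam))%N by rewrite sm; lia.
rewrite (nth_map 0 0%N _ hk).
have : nth 0 (lam_minus lam) (d - k.+1) <= 0.
  by rewrite (nth_map 0) ?ge_min ?lexx ?orbT //; rewrite sm size_tuple in hk *.
by move=> h; rewrite lez0_abs // opprK.
Qed.

(** [zz] can do without the rank because its truncated subtractions vanish beyond it, by [leq_rank].
    The bound [m1] is the longest row, so that the counts defining the odd entries see every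
    column. *)
Lemma Lambda_zz : exists m1, forall m, (m1 <= m)%N -> forall p,
  zz m (Ncnt lam) (Hcnt lam) p = if lam_s lam * 2 + 1 <= p <= lam_r lam * 2 then lam_xi lam p else 0.
Proof.
have sp := lam_plus_sorted; have sm := lam_mu_sorted.
set P := lam_plus lam in sp *; set Q := lam_mu lam in sm *.
have le0 (mu : seq nat) k : sorted geq mu -> (nth 0 mu k <= nth 0 mu 0)%N.
  move=> smu; have [->//|n0] := posnP (nth 0 mu k).
  by rewrite nth_transpose //; apply: leq_ltn_trans (leq0n k) _; rewrite -nth_transpose.
exists (maxn (nth 0 P 0) (nth 0 Q 0)) => m mm p.
have Godd k : count (fun j => k < Ncnt lam j)%N (iota k.+1 m) = (nth 0 P k - k)%N.
  rewrite (@eq_in_count _ _ (fun j => j < (nth 0 P k).+1)%N) => [|j]; last first.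
    by rewrite mem_iota => kj; rewrite -transpose_plus ?ltnS ?nth_transpose //; lia.
  have := leq_trans (leq_trans (le0 P k sp) (leq_maxl _ _)) mm.
  by rewrite count_lt_iota; move: (nth 0 P k) => n; lia.
have Hodd k : count (fun j => k < Hcnt lam j)%N (iota k.+1 m) = (nth 0 Q k - k.+1)%N.
  rewrite (@eq_in_count _ _ (fun j => j < nth 0 Q k)%N) => [|j]; last first.
    by rewrite -transpose_mu nth_transpose.
  have := leq_trans (leq_trans (le0 Q k sm) (leq_maxr _ _)) mm.
  by rewrite count_lt_iota; move: (nth 0 Q k) => n; lia.
have rE : lam_r lam = if (0 < rank_part P)%N then (rank_part P)%:Z else 1.
  by rewrite /lam_r nonzero_rank.
have sE : lam_s lam = if (0 < rank_part Q)%N then - (rank_part Q)%:Z else -1.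
  by rewrite /lam_s nonzero_rank.
rewrite /zz /lam_xi /= -/P -/Q !nonzero_rank //; set k := `|p|./2.
case: (ltrP 0 p) => p0.
- have -> : (lam_s lam * 2 + 1 <= p) by rewrite sE; case: ifP; lia.
  rewrite rE -eqn0Ngt /=.
  case: (boolP (oddz p)) => po.
  + have pE : p = (k.*2.+1)%:Z by rewrite /k; move: po; rewrite /oddz; lia.
    rewrite Godd; have := leq_rank k sp; rewrite {}pE.
    move: (rank_part P) (nth 0 P k) => [|r] n; rewrite /= => h.
      by case: ifP => _; lia.
    by case: ifP => hp; lia.
  + have pE : p = (k.*2)%:Z by rewrite /k; move: po; rewrite /oddz; lia.
    have k0 : (0 < k)%N by lia.
    have h : (k <= rank_part P)%N = (k <= transpose_part P k)%N.
      by have := leq_rank k.-1 sp; rewrite prednK // => ->; rewrite nth_transpose // prednK.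
    rewrite -transpose_plus // -/P pE.
    move: (rank_part P) (transpose_part P k) h => [|r] n h /=.
      by case: ifP => _; lia.
    by case: ifP => hp; lia.
- have -> : (p <= lam_r lam * 2) by rewrite rE; case: ifP; lia.
  rewrite sE andbT -eqn0Ngt /=.
  case: (boolP (oddz p)) => po.
  + have pE : p = - (k.*2.+1)%:Z by rewrite /k; move: po; rewrite /oddz; lia.
    have kd : (k < nth 0 Q k)%N -> (k < d)%N.
      move=> hk; rewrite ltnNge; apply: contraL hk => dk.
      by rewrite nth_default // /Q /lam_mu size_rev !size_map size_tuple.
    rewrite Hodd; have := leq_rank k sm; rewrite {}pE.
    case: (posnP (rank_part Q)) => [->|r0] h.
      by case: ifP => _; move: (nth 0 Q k) h => n; lia.
    case: ifP => hp; last by move: (nth 0 Q k) h => n; lia.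
    by rewrite nth_lam_minus -/Q; [move: (nth 0 Q k) h => n; lia|apply: kd; lia].
  + have pE : p = - (k.*2)%:Z by rewrite /k; move: po; rewrite /oddz; lia.
    have h : (k < rank_part Q)%N = (k < transpose_part Q k.+1)%N.
      by rewrite leq_rank // nth_transpose.
    rewrite -transpose_mu -/Q {}pE.
    move: (rank_part Q) (transpose_part Q k.+1) h => [|r] n h /=.
      by case: ifP => _; lia.
    by case: ifP => hp; lia.
Qed.

Lemma Lambda_wsum : exists m1, forall m, (m1 <= m)%N -> exists L,
  (forall j : int, (L < `|j|)%N -> zz m (Ncnt lam) (Hcnt lam) j = 0) /\
  forall (R : realType) (h : cartan R), Lambda lam h = wsum L (zz m (Ncnt lam) (Hcnt lam)) d h.
Proof.
have [m1 hm1] := Lambda_zz; exists m1 => m /hm1 hm.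
pose L := (`|(lam_s lam * 2 + 1)%R| + `|(lam_r lam * 2)%R|)%N.
have hL j : (L < `|j|)%N -> zz m (Ncnt lam) (Hcnt lam) j = 0.
  by rewrite hm /L => jL; case: ifP => //; lia.
by exists L; split=> // R h; exact: weight_wsum.
Qed.

End LambdaWeights.

(** * Fock space of finitely many oscillators *)

Section FockSpace.
Local Open Scope classical_set_scope.
Variables (R : realType) (K : finType) (fer : {pred K}).
Local Notation C := (R[i]).

Definition conf := {ffun K -> nat}.
Implicit Types (n : conf) (k l : K).

Definition preFock : Type := conf -> C^o.
HB.instance Definition _ := GRing.Lmodule.on preFock.

Definition fsupp : {pred preFock} := fun f => `[< finite_set [set n | f n != 0] >].

Lemma fsupp_submod_closed : GRing.submod_closed fsupp.
Proof.
split.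
  apply/asboolP; apply: (sub_finite_set _ (finite_set0 conf)) => n /=.
  by rewrite -[(0 : preFock) n]/(0 : C) eqxx.
move=> a f g /asboolP hf /asboolP hg; apply/asboolP.
apply: sub_finite_set (_ : _ `<=` [set n | f n != 0] `|` [set n | g n != 0]) _; last by rewrite finite_setU.
move=> n /=; have -> : (a *: f + g) n = a * f n + g n by [].
have [->|] := eqVneq (f n) 0; last by left.
by rewrite mulr0 add0r; right.
Qed.
HB.instance Definition _ := GRing.isSubmodClosed.Build C preFock fsupp fsupp_submod_closed.

Record fock : Type := Fock { fk :> preFock; _ : fk \in fsupp }.
HB.instance Definition _ := [isSub for fk].
HB.instance Definition _ := [Choice of fock by <:].
HB.instance Definition _ := [SubChoice_isSubLmodule of fock by <:].
Identity Coercion preFock_fun : preFock >-> Funclass.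

Implicit Types f g h : fock.

Lemma fockP f g : (forall n, f n = g n) -> f = g.
Proof. by move=> fg; apply: val_inj; apply: funext => n; exact: fg. Qed.

Lemma fockZ (a : C) f n : (a *: f) n = a * f n. Proof. by []. Qed.
Lemma fockD f g n : (f + g) n = f n + g n. Proof. by []. Qed.
Lemma fock0 n : (0 : fock) n = 0. Proof. by []. Qed.

Definition inc k n : conf := [ffun j => (n j + (j == k))%N].
Definition dec k n : conf := [ffun j => (n j - (j == k))%N].

Lemma incK k : cancel (inc k) (dec k).
Proof. by move=> n; apply/ffunP => j; rewrite !ffunE addnK. Qed.

Lemma decK k n : (0 < n k)%N -> inc k (dec k n) = n.
Proof.
move=> nk; apply/ffunP => j; rewrite !ffunE subnK //.
by case: eqP => [->|_].
Qed.

Lemma inc_incC k l n : inc k (inc l n) = inc l (inc k n).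
Proof. by apply/ffunP => j; rewrite !ffunE addnAC. Qed.
Lemma dec_decC k l n : dec k (dec l n) = dec l (dec k n).
Proof. by apply/ffunP => j; rewrite !ffunE subnAC. Qed.
Lemma inc_decC k l n : k != l -> inc k (dec l n) = dec l (inc k n).
Proof.
move=> kl; apply/ffunP => j; rewrite !ffunE.
by have [->|_] := eqVneq j k; rewrite ?(negbTE kl) ?subn0 // !addn0.
Qed.

Definition before l k := (enum_rank l < enum_rank k)%N.

Lemma before_total k l : k != l -> before l k = ~~ before k l.
Proof.
move=> kl; have : (enum_rank k : nat) != enum_rank l.
  by apply: contra_neq kl => /ord_inj/enum_rank_inj.
by rewrite /before; lia.
Qed.

Lemma before_irr k : before k k = false. Proof. exact: ltnn. Qed.

(* Jordan-Wigner sign: it makes distinct fermionic modes anticommute. *)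
Definition jw k n : C := (-1) ^+ (\sum_(j | fer j && before j k) n j).

Lemma jw_inc k l n : jw k (inc l n) = (-1) ^+ (fer l && before l k) * jw k n.
Proof.
rewrite /jw -exprD; congr (_ ^+ _).
under eq_bigr do rewrite ffunE; rewrite big_split addnC; congr addn.
rewrite big_mkcond (bigD1 l) //= eqxx big1 ?addn0 => [|j /negbTE ->]; last by case: ifP.
by case: ifP.
Qed.

Lemma jw_dec k l n : (0 < n l)%N -> jw k (dec l n) = (-1) ^+ (fer l && before l k) * jw k n.
Proof.
move=> nl; rewrite -[in RHS](decK nl) jw_inc mulrA -expr2 sqrr_sign mul1r //.
Qed.

Lemma jw_sq k n : jw k n * jw k n = 1.
Proof. by rewrite /jw -expr2 sqrr_sign. Qed.

(** Bosons follow the polynomial model: annihilation is a derivative, creation a multiplication. A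
    fermionic occupation number is also an arbitrary natural number; each pair 2m, 2m + 1 is a copy
    of the usual two-level system, so the anticommutation relations hold while [inc] and [dec] serve
    both kinds. *)
Definition ca k n : C := if fer k then (~~ odd (n k))%:R * jw k n else (n k).+1%:R.
Definition cc k n : C := if fer k then (odd (n k))%:R * jw k n else (0 < n k)%N%:R.

Lemma ann_fsupp k f : (fun n => ca k n * f (inc k n) : C^o) \in fsupp.
Proof.
have /asboolP hf := valP f; apply/asboolP.
apply: (sub_finite_set _ (finite_image (dec k) hf)) => n /= h.
exists (inc k n); last exact: incK.
by apply: contra_neq h => ->; rewrite mulr0.
Qed.
Lemma cre_fsupp k f : (fun n => cc k n * f (dec k n) : C^o) \in fsupp.
Proof.
have /asboolP hf := valP f; apply/asboolP.
apply: (sub_finite_set _ (finite_image (inc k) hf)) => n /= h.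
have nk : (0 < n k)%N.
  rewrite lt0n; apply: contra_neq h => n0.
  by rewrite /cc n0 /=; case: ifP; rewrite !mul0r.
exists (dec k n); last exact: decK.
by apply: contra_neq h => ->; rewrite mulr0.
Qed.

Definition ann k f : fock := Fock (ann_fsupp k f).
Definition cre k f : fock := Fock (cre_fsupp k f).

Lemma annE k f n : ann k f n = ca k n * f (inc k n). Proof. by []. Qed.
Lemma creE k f n : cre k f n = cc k n * f (dec k n). Proof. by []. Qed.

Lemma ann_linear k : linear (ann k).
Proof. by move=> a f g; apply: fockP => n; rewrite annE !fockD !fockZ !annE mulrDr mulrCA. Qed.
Lemma cre_linear k : linear (cre k).
Proof. by move=> a f g; apply: fockP => n; rewrite creE !fockD !fockZ !creE mulrDr mulrCA. Qed.
HB.instance Definition _ k := GRing.isLinear.Build C fock fock *:%R (ann k) (ann_linear k).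
HB.instance Definition _ k := GRing.isLinear.Build C fock fock *:%R (cre k) (cre_linear k).

Definition eps k l : C := (-1) ^+ (fer k && fer l).

Lemma inc_at k l n : inc k n l = (n l + (l == k))%N. Proof. by rewrite ffunE. Qed.
Lemma dec_at k l n : dec k n l = (n l - (l == k))%N. Proof. by rewrite ffunE. Qed.

Lemma jw_swap k l : k != l -> fer k -> fer l ->
  (-1) ^+ (fer k && before k l) = - (-1) ^+ (fer l && before l k) :> C.
Proof. by move=> kl -> ->; rewrite (before_total kl); case: before; rewrite /= ?expr1 ?expr0 ?opprK. Qed.

Lemma ann_ann k l f : ann k (ann l f) = eps k l *: ann l (ann k f).
Proof.
apply: fockP => n; rewrite fockZ !annE inc_incC !mulrA; congr (_ * _).
rewrite /eps /ca !inc_at.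
have [->|kl] := eqVneq k l.
  case: (fer l); last by rewrite expr0 mul1r.
  by rewrite addn1 /= negbK; case: odd; rewrite /= !(mul0r, mulr0).
rewrite !addn0 !jw_inc.
case: (boolP (fer k)) => fk; case: (boolP (fer l)) => fl; rewrite /= ?expr0 ?mul1r //; try by rewrite mulrC.
have := jw_swap kl fk fl; rewrite fk fl /= expr1 => ->; ring.
Qed.

Lemma cre_cre k l f : cre k (cre l f) = eps k l *: cre l (cre k f).
Proof.
apply: fockP => n; rewrite fockZ !creE dec_decC !mulrA; congr (_ * _).
have [nk|nk] := posnP (n k).
  rewrite /cc !dec_at nk sub0n /=; case: (fer k); rewrite /= !(mul0r, mulr0) //.
have [nl|nl] := posnP (n l).
  rewrite /cc !dec_at nl sub0n /=; case: (fer l); rewrite /= !(mul0r, mulr0) //.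
rewrite /eps /cc !dec_at.
have [->|kl] := eqVneq k l.
  case: (fer l); last by rewrite expr0 mul1r.
  by rewrite oddB // addbT; case: odd; rewrite /= !(mul0r, mulr0).
rewrite !subn0 !jw_dec //.
case: (boolP (fer k)) => fk; case: (boolP (fer l)) => fl; rewrite /= ?expr0 ?mul1r //; try by rewrite mulrC.
have := jw_swap kl fk fl; rewrite fk fl /= expr1 => ->; ring.
Qed.

Lemma ann_cre k l f : ann k (cre l f) = eps k l *: cre l (ann k f) + (k == l)%:R *: f.
Proof.
apply: fockP => n; rewrite fockD !fockZ !(annE, creE) !mulrA.
have [->|kl] := eqVneq k l; last first.
  rewrite mul0r addr0 inc_decC //; congr (_ * _).
  have [nl|nl] := posnP (n l).
    rewrite /cc inc_at nl eq_sym (negbTE kl) /=; case: (fer l); rewrite /= !(mul0r, mulr0) //.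
  rewrite /ca /cc /eps inc_at dec_at [l == k]eq_sym (negbTE kl) addn0 subn0 jw_inc jw_dec //.
  case: (boolP (fer k)) => fk; case: (boolP (fer l)) => fl; rewrite /= ?expr0 ?mul1r //; try by rewrite mulrC.
  have := jw_swap kl fk fl; rewrite fk fl /= expr1 => ->; ring.
rewrite mul1r incK /ca /cc /eps inc_at dec_at eqxx addn1 andbb.
have [nl|nl] := posnP (n l).
  rewrite nl; case: (boolP (fer l)) => fl; rewrite /= ?mul1r !(mul0r, mulr0) ?add0r ?mul1r //.
  by rewrite jw_inc before_irr andbF expr0 !mul1r jw_sq mul1r.
rewrite decK //; case: (boolP (fer l)) => fl /=.
  rewrite jw_inc jw_dec // before_irr andbF expr0 !mul1r oddB // addbT negbK.
  case: odd; rewrite /= !(mul0r, mulr0, mul1r) ?add0r ?addr0 ?jw_sq ?mul1r ?expr1 //.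
  by rewrite -[_ * jw l n * jw l n]mulrA jw_sq mulr1 mulN1r addNr.
rewrite expr0 mul1r mulr1 subn1 prednK // mul1r -[in LHS]addn1 natrD mulrDl mul1r //.
Qed.

(** The squared norm n! of the monomials in the polynomial model, for which derivative and
    multiplication are adjoint. *)
Definition wgt n : C := \prod_(j | ~~ fer j) (n j)`!%:R.

Lemma wgt_gt0 n : 0 < wgt n.
Proof. by apply: prodr_gt0 => j _; rewrite ltr0n fact_gt0. Qed.

Lemma wgt_inc k n : wgt (inc k n) * cc k (inc k n) = wgt n * ca k n.
Proof.
rewrite /cc /ca inc_at eqxx addn1 jw_inc before_irr andbF expr0 mul1r.
case: (boolP (fer k)) => fk.
  congr (_ * _); apply: eq_bigr => j fj; rewrite inc_at.
  by have [jk|_] := eqVneq j k; rewrite ?addn0 //; rewrite jk fk in fj.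
rewrite mulr1 /wgt (bigD1 k) //= [in RHS](bigD1 k) //= inc_at eqxx addn1 factS natrM.
rewrite (eq_bigr (fun j => (n j)`!%:R : C)) => [|j /andP[_ /negbTE jk]]; last first.
  by rewrite inc_at jk addn0.
by rewrite -mulrA mulrC.
Qed.

Definition fform f g : C := \sum_(n \in [set: conf]) wgt n * f n * (g n)^*.

Lemma fform_seq (r : seq conf) f g : uniq r -> (forall n, f n != 0 -> n \in r) ->
  fform f g = \sum_(n <- r) wgt n * f n * (g n)^*.
Proof.
move=> ur hr; rewrite /fform (fsbigE r) //; first by apply: eq_bigl => n; rewrite in_setT.
move=> n _ nr; have [->|/hr] := eqVneq (f n) 0; first by rewrite mulr0 mul0r.
by rewrite (negbTE nr).
Qed.

Lemma fock_support f : exists2 r : seq conf, uniq r & forall n, f n != 0 -> n \in r.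
Proof.
have /asboolP/finite_seqP[r hr] := valP f.
exists (undup r); first exact: undup_uniq.
move=> n fn; rewrite mem_undup.
have : [set n | (f : preFock) n != 0] n by [].
by rewrite hr.
Qed.

Lemma fform_linl g : linear_for *%R (fform^~ g).
Proof.
move=> a f f'; have [r ur hr] := fock_support f; have [r' ur' hr'] := fock_support f'.
have h n : f n != 0 \/ f' n != 0 -> n \in undup (r ++ r').
  by rewrite mem_undup mem_cat => -[/hr ->|/hr' ->]; rewrite ?orbT.
have us := undup_uniq (r ++ r').
have h1 n : f n != 0 -> n \in undup (r ++ r') by move=> fn; apply: h; left.
have h2 n : f' n != 0 -> n \in undup (r ++ r') by move=> fn; apply: h; right.
have h3 n : (a *: f + f') n != 0 -> n \in undup (r ++ r').
  rewrite fockD fockZ => fn; apply: h; have [f0|] := eqVneq (f n) 0; last by left.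
  by right; apply: contra_neq fn => f'0; rewrite f0 f'0 mulr0 addr0.
rewrite (fform_seq _ us h1) (fform_seq _ us h2) (fform_seq _ us h3).
under [LHS]eq_bigr do rewrite fockD fockZ.
by rewrite mulr_sumr -big_split; apply: eq_bigr => n _ /=; ring.
Qed.

Lemma fform_herm f g : fform f g = (fform g f)^*.
Proof.
have [r ur hr] := fock_support f; have [r' ur' hr'] := fock_support g.
have us := undup_uniq (r ++ r').
have h1 n : f n != 0 -> n \in undup (r ++ r') by rewrite mem_undup mem_cat => /hr ->.
have h2 n : g n != 0 -> n \in undup (r ++ r').
  by rewrite mem_undup mem_cat => /hr' ->; rewrite orbT.
have e (a b c : C) : 0 < a -> a * b * c^* = (a * c * b^*)^*.
  by move=> a0; rewrite !conjCM conjCK (conj_Creal (gtr0_real a0)) mulrAC.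
rewrite (fform_seq _ us h1) (fform_seq _ us h2) rmorph_sum; apply: eq_bigr => n _.
exact: e (wgt_gt0 n).
Qed.

Lemma fform_pos f : f != 0 -> 0 < fform f f.
Proof.
have [r ur hr] := fock_support f; rewrite (fform_seq _ ur hr) => f0.
have t0 n : 0 <= wgt n * f n * (f n)^*.
  by rewrite -mulrA -normCK mulr_ge0 ?exprn_ge0 // ltW ?wgt_gt0.
rewrite lt_def sumr_ge0 ?andbT //; apply: contra_neq f0 => /eqP.
rewrite psumr_eq0 // => /allP h; apply: fockP => n; rewrite fock0; apply/eqP.
apply: contraT => fn; have := h n (hr n fn); rewrite -mulrA -normCK mulf_eq0 /=.
by rewrite gt_eqF ?wgt_gt0 //= expf_eq0 normr_eq0 (negbTE fn).
Qed.

Lemma jw_conj k n : (jw k n)^* = jw k n.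
Proof. by rewrite /jw rmorphXn rmorphN1. Qed.

Lemma cc_conj k n : (cc k n)^* = cc k n.
Proof.
rewrite /cc; case: ifP => _; last by rewrite conjC_nat.
by rewrite conjCM conjC_nat jw_conj.
Qed.

Lemma ann_adj k f g : fform (ann k f) g = fform f (cre k g).
Proof.
rewrite /fform; pose F n : C := wgt n * f n * (cc k n * g (dec k n))^*.
have F0 n : n k = 0%N -> F n = 0.
  by move=> nk; rewrite /F /cc nk /=; case: ifP => _; rewrite !mul0r rmorph0 mulr0.
(* Configurations outside the image of [inc k] have no particle in mode k, and there the creation
   coefficient vanishes. *)
transitivity (\sum_(m \in inc k @` [set: conf]) F m); last first.
  apply: fsbig_widen => // n [_ /= hn]; apply: F0; apply: contrapT => /eqP; rewrite -lt0n => nk.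
  by apply: hn; exists (dec k n); rewrite ?decK.
rewrite fsbig_image; last by move=> m n _ _ /(can_inj (incK k)).
apply: eq_fsbigr => n _; rewrite /F incK annE.
by rewrite conjCM cc_conj mulrA -wgt_inc; ring.
Qed.

Lemma cre_adj k f g : fform (cre k f) g = fform f (ann k g).
Proof. by rewrite fform_herm -ann_adj -fform_herm. Qed.

End FockSpace.

(** * The unitary oscillator representation of gl in a window *)

Section OscillatorGl.
Variables (R : realType) (d L : nat).
Local Notation C := (R[i]).

Definition modes : finType := ('I_d * 'I_L.*2.+1)%type.
Definition midx (k : modes) : int := k.2%:Z - L%:Z.
Definition mode (i : 'I_d) (p : int) : modes := (i, inord `|(p + L%:Z)%R|).
Definition mfer : {pred modes} := fun k => ~~ oddz (midx k).
Local Notation F := (fock R modes).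
Local Notation ann := (@ann R modes mfer).
Local Notation cre := (@cre R modes mfer).
Local Notation fform := (@fform R modes mfer).
Implicit Types (f g : F) (i j : 'I_d) (p q r s : int).

Lemma midx_mode i p : p \in win L -> midx (mode i p) = p.
Proof. by rewrite mem_win /midx /= => pL; rewrite inordK; lia. Qed.

Lemma mode_eq i j p q : p \in win L -> q \in win L ->
  (mode i p == mode j q) = (i == j) && (p == q).
Proof.
move=> pL qL; apply/eqP/andP => [h|[/eqP-> /eqP->]//].
have := congr1 midx h; rewrite !midx_mode // => ->.
by have := congr1 fst h => /= ->; rewrite !eqxx.
Qed.

(* For the negative odd indices (negative bosonic modes) creation and annihilation
   are exchanged, the sign keeping the canonical commutation relations; this is
   where the signs of the star-structure come from. *)
Definition pop i p f : F := if negodd p then ann (mode i p) f else cre (mode i p) f.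
Definition qop i p f : F := if negodd p then - cre (mode i p) f else ann (mode i p) f.

Lemma pop_linear i p : linear (pop i p).
Proof. by move=> a f g; rewrite /pop; case: ifP => _; rewrite linearP. Qed.
Lemma qop_linear i p : linear (qop i p).
Proof. by move=> a f g; rewrite /qop; case: ifP => _; rewrite linearP // opprD scalerN. Qed.
HB.instance Definition _ i p := GRing.isLinear.Build C F F *:%R (pop i p) (pop_linear i p).
HB.instance Definition _ i p := GRing.isLinear.Build C F F *:%R (qop i p) (qop_linear i p).

Definition epq p q : C := (-1) ^+ (~~ oddz p && ~~ oddz q).

Lemma eps_mode i j p q : p \in win L -> q \in win L ->
  eps R mfer (mode i p) (mode j q) = epq p q.
Proof. by move=> pL qL; rewrite /eps /epq /mfer !midx_mode. Qed.

Lemma epq_sq p q : epq p q * epq p q = 1.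
Proof. by rewrite /epq -expr2 sqrr_sign. Qed.

Lemma epqC p q : epq p q = epq q p.
Proof. by rewrite /epq andbC. Qed.

Lemma cre_ann_mode i j p q f : p \in win L -> q \in win L ->
  cre (mode i p) (ann (mode j q) f) =
  epq p q *: (ann (mode j q) (cre (mode i p) f) - ((i == j) && (p == q))%:R *: f).
Proof.
move=> pL qL; rewrite ann_cre eps_mode // mode_eq // [j == i]eq_sym [q == p]eq_sym addrK.
by rewrite scalerA epqC epq_sq scale1r.
Qed.

Lemma negodd_epq p q : negodd p -> epq p q = 1.
Proof. by rewrite /epq => /andP[-> _]. Qed.

Lemma negodd_neq i j p q : negodd p != negodd q -> (i == j) && (p == q) = false.
Proof. by apply: contraNF => /andP[_ /eqP->]. Qed.

Lemma pop_pop i j p q f : p \in win L -> q \in win L ->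
  pop i p (pop j q f) = epq p q *: pop j q (pop i p f).
Proof.
move=> pL qL; rewrite /pop; case: (boolP (negodd p)) => hp; case: (boolP (negodd q)) => hq.
- by rewrite ann_ann eps_mode.
- by rewrite ann_cre eps_mode // mode_eq // negodd_neq ?hp ?(negbTE hq) // scale0r addr0.
- by rewrite cre_ann_mode // negodd_neq ?hq ?(negbTE hp) // scale0r subr0.
- by rewrite cre_cre eps_mode.
Qed.

Lemma qop_qop i j p q f : p \in win L -> q \in win L ->
  qop i p (qop j q f) = epq p q *: qop j q (qop i p f).
Proof.
move=> pL qL; rewrite /qop; case: (boolP (negodd p)) => hp; case: (boolP (negodd q)) => hq.
- by rewrite !raddfN /= !opprK cre_cre eps_mode.
- by rewrite raddfN /= cre_ann_mode // negodd_neq ?hp ?(negbTE hq) // scale0r subr0 scalerN.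
- by rewrite raddfN /= ann_cre eps_mode // mode_eq // negodd_neq ?hq ?(negbTE hp) // scale0r addr0 scalerN.
- by rewrite ann_ann eps_mode.
Qed.

Lemma qop_pop i j p q f : p \in win L -> q \in win L ->
  qop i p (pop j q f) = epq p q *: pop j q (qop i p f) + ((i == j) && (p == q))%:R *: f.
Proof.
move=> pL qL; rewrite /qop /pop; case: (boolP (negodd p)) => hp; case: (boolP (negodd q)) => hq.
- rewrite cre_ann_mode // raddfN /= scalerN scalerBr opprB addrC; congr (_ + _).
  by rewrite negodd_epq // scale1r.
- by rewrite raddfN /= cre_cre eps_mode // negodd_neq ?hp ?(negbTE hq) // scale0r addr0 scalerN.
- by rewrite ann_ann eps_mode // negodd_neq ?hq ?(negbTE hp) // scale0r addr0.
- by rewrite ann_cre eps_mode // mode_eq.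
Qed.

Definition EF p q f : F := \sum_i pop i p (qop i q f).

Lemma EF_linear p q : linear (EF p q).
Proof.
move=> a f g; rewrite /EF scaler_sumr -big_split; apply: eq_bigr => i _ /=.
by rewrite !linearP.
Qed.
HB.instance Definition _ p q := GRing.isLinear.Build C F F *:%R (EF p q) (EF_linear p q).

Lemma EF_comm p q r s f : p \in win L -> q \in win L -> r \in win L -> s \in win L ->
  EF p q (EF r s f) = usgn R p q r s *: EF r s (EF p q f) + (q == r)%:R *: EF p s f
                    - (usgn R p q r s * (p == s)%:R) *: EF r q f.
Proof.
move=> pL qL rL sL.
have key i j : pop i p (qop i q (pop j r (qop j s f))) =
    usgn R p q r s *: pop j r (qop j s (pop i p (qop i q f)))
    + ((i == j) && (q == r))%:R *: pop i p (qop j s f)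
    - (usgn R p q r s * ((i == j) && (p == s))%:R) *: pop j r (qop i q f).
  rewrite qop_pop // linearD !linearZ /= addrAC; congr (_ + _).
  rewrite pop_pop // qop_qop // !linearZ /= !scalerA.
  rewrite [qop j s (pop i p _)]qop_pop // linearD !linearZ /= [s == p]eq_sym [j == i]eq_sym.
  rewrite scalerDr !scalerA -addrA.
  (* The exchange signs of the four factors multiply to the sign of the superbracket, up to the sign
     for s and p that the contraction of [qop j s] with [pop i p] carries. *)
  have -> : usgn R p q r s * epq s p = epq q r * (epq p r * epq q s).
    rewrite /usgn /epq !oddzB.
    by case: (oddz p); case: (oddz q); case: (oddz r); case: (oddz s); rewrite /= ?expr0 ?expr1; ring.
  by rewrite scalerN subrr addr0 [epq q r * _]mulrC.
have delta (P : bool) (G : 'I_d -> 'I_d -> F) (a : C) :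
    \sum_i \sum_j (a * ((i == j) && P)%:R) *: G i j = (a * P%:R) *: \sum_i G i i.
  rewrite scaler_sumr; apply: eq_bigr => i _; rewrite (bigD1 i) //= eqxx big1 ?addr0 // => j.
  by rewrite eq_sym => /negbTE ->; rewrite mulr0 scale0r.
transitivity (\sum_i \sum_j pop i p (qop i q (pop j r (qop j s f)))).
  by apply: eq_bigr => i _; rewrite /EF !linear_sum.
under eq_bigr do under eq_bigr do rewrite key.
under eq_bigr do rewrite big_split big_split /= sumrN.
rewrite big_split big_split /= sumrN; congr (_ + _ - _).
- rewrite exchange_big {1}/EF /= scaler_sumr; apply: eq_bigr => j _; rewrite /EF.
  by rewrite !linear_sum.
- have := delta (q == r) (fun i j => pop i p (qop j s f)) 1; rewrite mul1r => <-.
  by apply: eq_bigr => i _; apply: eq_bigr => j _; rewrite mul1r.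
- exact: delta.
Qed.

Lemma ssgn_negodd p : ssgn R p = if negodd p then -1 else 1.
Proof. by rewrite /ssgn; case: negodd. Qed.

Let fZl a f g : fform (a *: f) g = a * fform f g.
Proof.
apply: (formZl (form := fform)); exact: fform_linl.
Qed.

Lemma fform_sumr (I : Type) (t : seq I) (G : I -> F) f :
  fform f (\sum_(i <- t) G i) = \sum_(i <- t) fform f (G i).
Proof.
rewrite fform_herm; elim: t => [|i t IH].
  rewrite !big_nil; have := fZl 0 0 f; rewrite scale0r mul0r => ->; exact: rmorph0.
rewrite !big_cons; have := fform_linl mfer f 1 (G i) (\sum_(j <- t) G j).
rewrite scale1r mul1r => ->; rewrite rmorphD /=; congr (_ + _); last exact: IH.
by rewrite -fform_herm.
Qed.

Lemma fform_suml (I : Type) (t : seq I) (G : I -> F) f :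
  fform (\sum_(i <- t) G i) f = \sum_(i <- t) fform (G i) f.
Proof.
rewrite fform_herm fform_sumr rmorph_sum; apply: eq_bigr => i _.
by rewrite /= -fform_herm.
Qed.

Lemma fformNl f g : fform (- f) g = - fform f g.
Proof. by rewrite -scaleN1r fZl mulN1r. Qed.

Lemma fformNr f g : fform f (- g) = - fform f g.
Proof. by rewrite fform_herm fformNl rmorphN /= -fform_herm. Qed.

Lemma pop_adj i p f g : fform (pop i p f) g = ssgn R p * fform f (qop i p g).
Proof.
rewrite ssgn_negodd /pop /qop; case: ifP => _; rewrite ?mul1r ?mulN1r.
  by rewrite fformNr opprK ann_adj.
by rewrite cre_adj.
Qed.

Lemma qop_adj i p f g : fform (qop i p f) g = ssgn R p * fform f (pop i p g).
Proof.
rewrite ssgn_negodd /pop /qop; case: ifP => _; rewrite ?mul1r ?mulN1r.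
  by rewrite fformNl cre_adj.
by rewrite ann_adj.
Qed.

Lemma EF_adj p q f g : fform (EF p q f) g = ssgn R p * ssgn R q * fform f (EF q p g).
Proof.
rewrite /EF fform_suml fform_sumr mulr_sumr; apply: eq_bigr => i _.
by rewrite pop_adj qop_adj mulrA.
Qed.

End OscillatorGl.

(** * Moving one boson across several fermions by odd reflections *)

Section Passing.
Variables (R : realType) (d L : nat).
Local Notation C := (R[i]).
Local Notation F := (fock R (modes d L)).

Definition EFl (p q : int) : {linear F -> F} := @EF R d L p q.

Definition HW (l : seq int) (eta : int -> int) (u : F) : Prop := is_hw EFl l eta u.

Lemma HW_ext l eta eta' u : {in l, eta =1 eta'} -> HW l eta u -> HW l eta' u.
Proof. by move=> e [u0 wu pu]; split=> // p pl; rewrite wu // e. Qed.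

Lemma HW_reflect s1 p q s2 eta u :
  uniq (s1 ++ p :: q :: s2) -> {subset s1 ++ p :: q :: s2 <= win L} -> oddz (q - p) ->
  HW (s1 ++ p :: q :: s2) eta u ->
  exists u', HW (s1 ++ q :: p :: s2) (reflect_wt p q eta) u'.
Proof.
apply: (@reflect_hw R F EFl (mem (win L)) (@fform R (modes d L) (@mfer d L))).
- by move=> *; exact: EF_comm.
- exact: fform_linl.
- exact: fform_pos.
- by move=> *; exact: EF_adj.
Qed.

(* [base] is the contribution of the central charge; it equals [shift p * d]. *)
Definition base (t : int) : int := if t <= 0 then (if oddz t then - d%:Z else d%:Z) else 0.
Definition etaY (y : int -> nat) (t : int) : int := base t + (if 0 < t then (y t)%:Z else - (y t)%:Z).

Definition stepY (f b : int) (y : int -> nat) (t : int) : nat :=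
  if y f == 0%N then y t else if t == b then (y b).+1 else if t == f then (y f).-1 else y t.

(** The reflection is trivial exactly when y f + y b = 0; the hypothesis relating [y f] and [y b]
    turns this into y f = 0, the test that [stepY] makes. *)
Lemma step_pos s1 f b s2 y u :
  uniq (s1 ++ f :: b :: s2) -> {subset s1 ++ f :: b :: s2 <= win L} -> oddz (b - f) ->
  0 < f -> 0 < b -> (y f = 0 -> y b = 0)%N ->
  HW (s1 ++ f :: b :: s2) (etaY y) u ->
  exists u', HW (s1 ++ b :: f :: s2) (etaY (stepY f b y)) u'.
Proof.
move=> ul lW fb f0 b0 yfb hw; have [u' hw'] := HW_reflect ul lW fb hw.
exists u'; apply: HW_ext hw' => t _; rewrite /reflect_wt /etaY /base /stepY.
rewrite !(lt_geF f0) !(lt_geF b0) f0 b0 !add0r -PoszD eqz_nat addn_eq0.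
have [yf0|yf0] /= := eqVneq (y f) 0%N; first by rewrite (yfb yf0) eqxx.
have ne : f != b by apply: contraTneq fb => ->; rewrite subrr.
have [->|tb] := eqVneq t b; first by rewrite b0 (lt_geF b0) eq_sym (negbTE ne); lia.
have [->|tf] := eqVneq t f; first by rewrite f0 (lt_geF f0); lia.
by rewrite oppr0 !addr0.
Qed.

Lemma step_neg s1 f b s2 y u :
  uniq (s1 ++ b :: f :: s2) -> {subset s1 ++ b :: f :: s2 <= win L} -> oddz (f - b) ->
  f <= 0 -> b <= 0 -> (y f = 0 -> y b = 0)%N ->
  HW (s1 ++ b :: f :: s2) (etaY y) u ->
  exists u', HW (s1 ++ f :: b :: s2) (etaY (stepY f b y)) u'.
Proof.
move=> ul lW fb f0 b0 yfb hw; have [u' hw'] := HW_reflect ul lW fb hw.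
exists u'; apply: HW_ext hw' => t _; rewrite /reflect_wt /etaY /stepY.
(* Opposite parities give opposite central contributions, so the test for a trivial reflection again
   involves only [y]. *)
have bb : base b + base f = 0.
  rewrite /base f0 b0; move: fb; rewrite oddzB.
  by case: (oddz f); case: (oddz b) => // _; rewrite ?addNr ?subrr.
rewrite addrACA bb add0r !ltNge f0 b0 /= -opprD oppr_eq0 -PoszD eqz_nat addn_eq0 andbC.
have [yf0|yf0] /= := eqVneq (y f) 0%N; first by rewrite (yfb yf0) eqxx ltNge.
rewrite -ltNge.
have ne : b != f by apply: contraTneq fb => ->; rewrite subrr.
have [->|tb] := eqVneq t b; first by rewrite (negbTE ne) ltNge b0 /=; lia.
have [->|tf] := eqVneq t f; first by rewrite ltNge f0 /=; lia.
by rewrite oppr0 !addr0.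
Qed.

Definition passY (b : int) (gs : seq int) (y : int -> nat) (t : int) : nat :=
  if t == b then (y b + count (fun f => 0 < y f)%N gs)%N
  else if t \in gs then (y t).-1 else y t.

Lemma passY_cons f b gs y t : f != b -> f \notin gs -> b \notin gs ->
  ((y f = 0)%N -> (y b = 0)%N) ->
  passY b gs (stepY f b y) t = passY b (f :: gs) y t.
Proof.
move=> fb fgs bgs yfb; rewrite /passY /stepY !inE.
have [yf0|yf0] := eqVneq (y f) 0%N.
  rewrite /= yf0 /= add0n; case: (eqVneq t b) => // tb.
  by case: (eqVneq t f) => [->|//]; rewrite (negbTE fgs) yf0.
rewrite eqxx /= lt0n yf0.
have -> : count (fun x => 0 < (if x == b then (y b).+1 else if x == f then (y f).-1 else y x))%N gs
    = count (fun x => 0 < y x)%N gs.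
  apply: eq_in_count => x xgs.
  have [xb|_] := eqVneq x b; first by rewrite -xb xgs in bgs.
  by have [xf|//] := eqVneq x f; first by rewrite -xf xgs in fgs.
have [_|tb] := eqVneq t b; first by rewrite addSnnS.
by have [->|//] := eqVneq t f; rewrite (negbTE fgs).
Qed.

(** [gs] lists the fermions in the order in which the boson meets them, with non-decreasing
    occupation. Once the boson has gained a unit, all fermions still ahead are therefore occupied,
    which keeps the hypothesis of [step_pos] alive. *)
Lemma pass_pos b gs : forall s1 s2 y u,
  uniq (s1 ++ rev gs ++ b :: s2) -> {subset s1 ++ rev gs ++ b :: s2 <= win L} ->
  0 < b -> {in gs, forall f, 0 < f /\ oddz (b - f)} ->
  pairwise (fun f f' => y f <= y f')%N gs -> ((0 < y b)%N -> {in gs, forall f, (0 < y f)%N}) ->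
  HW (s1 ++ rev gs ++ b :: s2) (etaY y) u ->
  exists u', HW (s1 ++ b :: rev gs ++ s2) (etaY (passY b gs y)) u'.
Proof.
elim: gs => [|f gs IH] s1 s2 y u ul lW b0 hgs ygs yb hw.
  exists u; apply: HW_ext hw => t _; rewrite /etaY /passY /= addn0.
  by case: eqP => [->|].
rewrite rev_cons -cats1 -catA /= in ul lW hw.
have [f0 fb] := hgs f (mem_head _ _).
have yfb : (y f = 0 -> y b = 0)%N.
  by move=> yf; apply/eqP; rewrite -leqn0 leqNgt; apply/negP => /yb/(_ f (mem_head _ _)); rewrite yf.
rewrite catA in ul lW hw; have [u1 hw1] := step_pos ul lW fb f0 b0 yfb hw.
have pe : perm_eq ((s1 ++ rev gs) ++ [:: b, f & s2]) ((s1 ++ rev gs) ++ [:: f, b & s2]).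
  by rewrite perm_cat2l -[b :: f :: s2]/([:: b] ++ [:: f] ++ s2) perm_catCA.
have ne : f != b by apply: contraTneq fb => ->; rewrite subrr.
have [fgs bgs] : f \notin gs /\ b \notin gs.
  move: ul; rewrite cat_uniq => /and3P[_ /hasPn h _]; split.
    by have := h f; rewrite !inE eqxx mem_cat mem_rev negb_or => /(_ isT)/andP[].
  by have := h b; rewrite !inE eqxx orbT mem_cat mem_rev negb_or => /(_ isT)/andP[].
have y1 x : x \in gs -> stepY f b y x = y x.
  move=> xgs; rewrite /stepY; case: ifP => // _.
  have [xb|_] := eqVneq x b; first by rewrite -xb xgs in bgs.
  by have [xf|//] := eqVneq x f; first by rewrite -xf xgs in fgs.
move: ygs => /= /andP[/allP yf ygs].
rewrite -catA in hw1 pe.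
have [|||||u2 hw2] := IH s1 (f :: s2) _ u1 _ _ b0 _ _ _ hw1.
- by rewrite (perm_uniq pe).
- by move=> t; rewrite (perm_mem pe) => /lW.
- by move=> x xgs; apply: hgs; rewrite inE xgs orbT.
- apply: (sub_in_pairwise (P := mem gs)) ygs; last exact/allP.
  by move=> x x' xg xg'; rewrite !y1.
- move=> ybs x xgs; rewrite y1 //; move: ybs; rewrite /stepY eqxx.
  case: (posnP (y f)) => [yf0|yf0 _]; last exact: leq_trans yf0 (yf x xgs).
  by rewrite (yfb yf0).
- exists u2; rewrite rev_cons -cats1 -catA /=.
  by apply: HW_ext hw2 => t _; rewrite /etaY passY_cons.
Qed.

Lemma pass_neg b gs : forall s1 s2 y u,
  uniq (s1 ++ b :: gs ++ s2) -> {subset s1 ++ b :: gs ++ s2 <= win L} ->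
  b <= 0 -> {in gs, forall f, f <= 0 /\ oddz (b - f)} ->
  pairwise (fun f f' => y f <= y f')%N gs -> ((0 < y b)%N -> {in gs, forall f, (0 < y f)%N}) ->
  HW (s1 ++ b :: gs ++ s2) (etaY y) u ->
  exists u', HW (s1 ++ gs ++ b :: s2) (etaY (passY b gs y)) u'.
Proof.
elim: gs => [|f gs IH] s1 s2 y u ul lW b0 hgs ygs yb hw.
  exists u; apply: HW_ext hw => t _; rewrite /etaY /passY /= addn0.
  by case: eqP => [->|].
have [f0 fb] := hgs f (mem_head _ _).
have yfb : (y f = 0 -> y b = 0)%N.
  by move=> yf; apply/eqP; rewrite -leqn0 leqNgt; apply/negP => /yb/(_ f (mem_head _ _)); rewrite yf.
have [u1 hw1] := step_neg ul lW (etrans (oddz_subC _ _) fb) f0 b0 yfb hw.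
have pe : perm_eq (s1 ++ [:: f, b & gs ++ s2]) (s1 ++ [:: b, f & gs ++ s2]).
  by rewrite perm_cat2l -[f :: b :: _]/([:: f] ++ [:: b] ++ (gs ++ s2)) perm_catCA.
have ne : f != b by apply: contraTneq fb => ->; rewrite subrr.
have [fgs bgs] : f \notin gs /\ b \notin gs.
  move: ul; rewrite cat_uniq /= inE !mem_cat !negb_or => /and3P[_ _].
  by case/and3P => /and3P[_ -> _] /andP[-> _].
have y1 x : x \in gs -> stepY f b y x = y x.
  move=> xgs; rewrite /stepY; case: ifP => // _.
  have [xb|_] := eqVneq x b; first by rewrite -xb xgs in bgs.
  by have [xf|//] := eqVneq x f; first by rewrite -xf xgs in fgs.
move: ygs => /= /andP[/allP yf ygs].
have ec s : s1 ++ f :: s = rcons s1 f ++ s by rewrite cat_rcons.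
rewrite ec in hw1 pe.
have [|||||u2 hw2] := IH (rcons s1 f) s2 _ u1 _ _ b0 _ _ _ hw1.
- by rewrite (perm_uniq pe).
- by move=> t; rewrite (perm_mem pe) => /lW.
- by move=> x xgs; apply: hgs; rewrite inE xgs orbT.
- apply: (sub_in_pairwise (P := mem gs)) ygs; last exact/allP.
  by move=> x x' xg xg'; rewrite !y1.
- move=> ybs x xgs; rewrite y1 //; move: ybs; rewrite /stepY eqxx.
  case: (posnP (y f)) => [yf0|yf0 _]; last exact: leq_trans yf0 (yf x xgs).
  by rewrite (yfb yf0).
- exists u2; rewrite /= ec.
  by apply: HW_ext hw2 => t _; rewrite /etaY passY_cons.
Qed.

End Passing.

(** * The highest weight state for the ordering with all fermions in the middle *)

Section InitialState.
Local Open Scope classical_set_scope.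
Variables (R : realType) (d L : nat) (lam : d.-tuple int).
Local Notation C := (R[i]).
Local Notation F := (fock R (modes d L)).
Local Notation ann := (@ann R (modes d L) (@mfer d L)).
Local Notation cre := (@cre R (modes d L) (@mfer d L)).

(* All fermionic modes [j <= lam_i] of the [i]-th oscillator family are filled and no
   bosonic mode is excited. *)
Definition conf0 : conf (modes d L) :=
  [ffun k => (~~ oddz (midx k) && (midx k <= tnth lam k.1 * 2) : nat)].

Lemma w0_fsupp : (fun n => (n == conf0)%:R : C^o) \in @fsupp R (modes d L).
Proof.
apply/asboolP; apply: (sub_finite_set _ (finite_set1 conf0)) => n /=.
by case: (n =P conf0) => [->//|_]; rewrite eqxx.
Qed.
Definition w0 : F := Fock w0_fsupp.

Lemma w0_neq0 : w0 != 0.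
Proof.
apply: contra_neq (oner_neq0 C) => w00.
have := congr1 (fun f : F => f conf0) w00; rewrite fock0 => <-.
by rewrite /= eqxx.
Qed.

Lemma ann_w0 k : conf0 k = 0%N -> ann k w0 = 0.
Proof.
move=> k0; apply: fockP => n; rewrite annE fock0 /=.
case: eqP => [e|_]; rewrite ?mulr0 //.
by have := congr1 (fun c : conf _ => c k) e; rewrite inc_at eqxx k0 addn1.
Qed.

Lemma cre_w0 k : mfer k -> conf0 k = 1%N -> cre k w0 = 0.
Proof.
move=> fk k1; apply: fockP => n; rewrite creE fock0 /=.
case: eqP => [e|_]; rewrite ?mulr0 //.
have := congr1 (fun c : conf _ => c k) e; rewrite dec_at eqxx k1 => nk.
by rewrite /cc fk (_ : n k = 2%N) ?mul0r //; lia.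
Qed.

Lemma conf0_mode i p : p \in win L ->
  conf0 (mode L i p) = (~~ oddz p && (p <= tnth lam i * 2) : nat).
Proof. by move=> pL; rewrite ffunE midx_mode. Qed.

Lemma EF_w0_up p q : p \in win L -> q \in win L -> p != q ->
  [|| oddz q && (0 < q), negodd p | [&& ~~ oddz p, ~~ oddz q & p < q]] ->
  EF p q w0 = 0.
Proof.
move=> pL qL pq h; rewrite /EF big1 // => i _.
have [hp|hp] := boolP (negodd p).
  have := qop_pop i i w0 qL pL; rewrite [q == p]eq_sym (negbTE pq) andbF scale0r addr0.
  rewrite {1}/pop hp ann_w0 ?linear0; last by rewrite conf0_mode //; case/andP: hp => ->.
  rewrite epqC negodd_epq // scale1r => /esym //.
have [hq|hq] := boolP (negodd q).
  by move: h; rewrite (negbTE hp) /=; move: hq; rewrite /negodd; lia.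
rewrite /qop (negbTE hq); case: (boolP (oddz q && (0 < q))) h => [/andP[oq q0] _|_ /=].
  by rewrite ann_w0 ?linear0 // conf0_mode // oq.
rewrite (negbTE hp) /= => /and3P[ep eq pltq].
have [occ|occ] := boolP (q <= tnth lam i * 2); last first.
  by rewrite ann_w0 ?linear0 // conf0_mode // eq (negbTE occ).
rewrite /pop (negbTE hp) cre_ann_mode // (negbTE pq) andbF scale0r subr0.
rewrite cre_w0 ?linear0 ?scaler0 //.
  by rewrite /mfer midx_mode.
by rewrite conf0_mode // ep (le_trans (ltW pltq) occ).
Qed.

(** On a negative bosonic index each of the d families contributes -1, from reordering - a a^+ = -
    a^+ a - 1. *)
Lemma EF_w0_wt p : p \in win L -> EF p p w0 =
  (if oddz p then (if 0 < p then 0 else - d%:Z) else (count (fun x => p <= x * 2) lam)%:Z)%:~R *: w0.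
Proof.
move=> pL; rewrite /EF; case: (boolP (oddz p)) => po.
  have n0 : conf0 (mode L _ p) = 0%N by move=> i; rewrite conf0_mode // po.
  have pn : negodd p = ~~ (0 < p) by rewrite /negodd po /=; move: po; rewrite oddzE; lia.
  case: ifP => p0.
    by rewrite scale0r big1 // => i _; rewrite /qop pn p0 ann_w0 ?linear0.
  under eq_bigr => i _.
    rewrite /pop /qop pn p0 /= raddfN /= ann_cre eps_mode // ann_w0 // linear0 scaler0 add0r.
    rewrite eqxx scale1r; over.
  by rewrite sumr_const card_ord rmorphN /= scaleNr -pmulrn scaler_nat mulNrn.
have pn : negodd p = false by rewrite /negodd (negbTE po).
have -> : count (fun x => p <= x * 2) lam = (\sum_(i < d) (p <= tnth lam i * 2)%R)%N.
  by rewrite -sum1_count big_tuple big_mkcond /=; apply: eq_bigr => i _; case: ifP.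
rewrite -pmulrn natr_sum scaler_suml; apply: eq_bigr => i _.
rewrite /pop /qop pn; case: (boolP (p <= tnth lam i * 2)) => occ; last first.
  by rewrite ann_w0 ?linear0 ?scale0r // conf0_mode // po (negbTE occ).
rewrite cre_ann_mode // !eqxx cre_w0 ?linear0 ?sub0r ?scale1r.
- by rewrite /epq po expr1 scaleN1r opprK.
- by rewrite /mfer midx_mode.
- by rewrite conf0_mode // po occ.
Qed.

End InitialState.

(** * From the initial ordering to the natural one *)

Definition negs (s : seq int) : seq int := rev [seq - x | x <- s].

Lemma negs_cat s t : negs (s ++ t) = negs t ++ negs s.
Proof. by rewrite /negs map_cat rev_cat. Qed.

Lemma negs_cons x s : negs (x :: s) = rcons (negs s) (- x).
Proof. by rewrite /negs /= rev_cons. Qed.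

Lemma mem_negs x s : (x \in negs s) = (- x \in s).
Proof. by rewrite /negs mem_rev -{1}[x]opprK mem_map //; exact: oppr_inj. Qed.

Lemma pairwise_negs (r r' : rel int) s : (forall x y, r x y -> r' (- y) (- x)) ->
  pairwise r s -> pairwise r' (negs s).
Proof.
move=> rr'; elim: s => // x s IH /= /andP[/allP xs /IH ps].
rewrite negs_cons pairwise_rcons ps andbT; apply/allP => y; rewrite mem_negs => /xs/rr'.
by rewrite opprK.
Qed.

Section Chain.
Variables (R : realType) (d m : nat) (lam : d.-tuple int).
Local Notation L := m.*2.
Local Notation C := (R[i]).
Hypothesis lam_small : forall j, (m < j)%N -> Ncnt lam j = 0%N /\ Hcnt lam j = 0%N.

Definition fidx (j : nat) : int := (j.*2)%:Z.
Definition bidx (j : nat) : int := (j.*2.-1)%:Z.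
(* [full_order k1 k2] interpolates between the ordering (negative bosons, fermions,
   positive bosons), for which the state [w0] is of highest weight, at
   [k1 = k2 = 0], and the natural order at [k1 = k2 = m]: step [k] moves one boson
   across the remaining fermions by odd reflections. *)
Definition interleaved k : seq int := flatten [seq [:: bidx i; fidx i] | i <- iota 1 k].
Definition fer_tail k : seq int := [seq fidx j | j <- iota k.+1 (m - k)].
Definition bos_tail k : seq int := [seq bidx j | j <- iota k.+1 (m - k)].
Definition half_order k : seq int := interleaved k ++ fer_tail k ++ bos_tail k.
Definition full_order k1 k2 : seq int := negs (half_order k2) ++ 0 :: half_order k1.

(** Absolute value of the weight, without the central part, after k bosons have passed. Fermion j
    has been crossed by min(k, j) bosons, each taking a unit while one remained. Boson i = n./2 + 1,
    if it has passed, took one unit from each fermion j >= i with G j >= i. At k = m these are the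
    entries of [zz]. *)
Definition pass_count (G : nat -> nat) k n : nat :=
  if odd n then (if n./2 < k then count (fun j => n./2 < G j) (iota n./2.+1 m) else 0)%N
  else (G n./2 - minn k n./2)%N.
Definition pass_state k1 k2 (t : int) : nat := if 0 < t then pass_count (Ncnt lam) k1 `|t| else pass_count (Hcnt lam) k2 `|t|.

Lemma iota_split k : (k < m)%N -> iota k.+1 (m - k) = k.+1 :: iota k.+2 (m - k.+1).
Proof. by move=> km; rewrite -[(m - k)%N]prednK ?subn_gt0 //= subnS. Qed.

Lemma fer_tail_split k : (k < m)%N -> fer_tail k = fidx k.+1 :: fer_tail k.+1.
Proof. by move=> km; rewrite /fer_tail iota_split. Qed.
Lemma bos_tail_split k : (k < m)%N -> bos_tail k = bidx k.+1 :: bos_tail k.+1.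
Proof. by move=> km; rewrite /bos_tail iota_split. Qed.

Lemma inter_rec k : interleaved k.+1 = interleaved k ++ [:: bidx k.+1; fidx k.+1].
Proof. by rewrite /interleaved -[in LHS](addn1 k) iotaD map_cat flatten_cat /= add1n. Qed.

Lemma half_before k : (k < m)%N -> half_order k = interleaved k ++ fer_tail k ++ bidx k.+1 :: bos_tail k.+1.
Proof. by move=> km; rewrite /half_order (bos_tail_split km). Qed.
Lemma half_after k : (k < m)%N -> half_order k.+1 = interleaved k ++ bidx k.+1 :: fer_tail k ++ bos_tail k.+1.
Proof. by move=> km; rewrite /half_order inter_rec (fer_tail_split km) -catA. Qed.

Lemma half_perm k : (k <= m)%N -> perm_eq (half_order k) (half_order 0).
Proof.
elim: k => // k IH km; apply: perm_trans (IH (ltnW km)).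
rewrite (half_before km) (half_after km) perm_cat2l.
by rewrite -[bidx _ :: fer_tail k ++ _]/([:: bidx k.+1] ++ fer_tail k ++ bos_tail k.+1) perm_catCA.
Qed.

Lemma full_perm k1 k2 : (k1 <= m)%N -> (k2 <= m)%N -> perm_eq (full_order k1 k2) (full_order 0 0).
Proof.
move=> k1m k2m; apply: perm_cat; last by rewrite perm_cons half_perm.
by rewrite /negs perm_rev perm_sym perm_rev perm_sym perm_map // half_perm.
Qed.

Lemma fer_tail_facts k t : t \in fer_tail k -> exists2 j, (k < j <= m)%N & t = fidx j.
Proof. by move=> /mapP[j]; rewrite mem_iota => hj ->; exists j => //; lia. Qed.
Lemma bos_tail_facts k t : t \in bos_tail k -> exists2 j, (k < j <= m)%N & t = bidx j.
Proof. by move=> /mapP[j]; rewrite mem_iota => hj ->; exists j => //; lia. Qed.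

Definition hrel (p q : int) : bool :=
  (p != q) && [|| oddz q && (0 < q), negodd p | [&& ~~ oddz p, ~~ oddz q & p < q]].

Lemma fer_tail_sorted k : pairwise <%R (fer_tail k).
Proof.
rewrite /fer_tail pairwise_map; apply: sub_pairwise (_ : pairwise ltn _) => [i j /= ij|].
  by rewrite /fidx; lia.
by rewrite -sorted_pairwise ?iota_ltn_sorted //; exact: ltn_trans.
Qed.
Lemma bos_tail_sorted k : pairwise <%R (bos_tail k).
Proof.
rewrite /bos_tail pairwise_map; apply: (sub_in_pairwise (P := [pred i | 0 < i]%N)) (_ : pairwise ltn _) => [i j /= i0 j0 ij||].
- by rewrite /bidx; rewrite !inE in i0 j0; lia.
- by apply/allP => i; rewrite mem_iota inE; lia.
by rewrite -sorted_pairwise ?iota_ltn_sorted //; exact: ltn_trans.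
Qed.

Lemma fer_tail0_par t : t \in fer_tail 0 -> 0 < t <= (m.*2)%:Z /\ oddz t = false.
Proof. by move=> /fer_tail_facts[j jm ->]; rewrite /fidx oddzE; lia. Qed.
Lemma bos_tail0_par t : t \in bos_tail 0 -> 0 < t <= (m.*2)%:Z /\ oddz t = true.
Proof. by move=> /bos_tail_facts[j jm ->]; rewrite /bidx oddzE; lia. Qed.

Lemma half0_pos t : t \in half_order 0 -> 0 < t <= (m.*2)%:Z.
Proof. by rewrite -[half_order 0]/(fer_tail 0 ++ bos_tail 0) mem_cat => /orP[/fer_tail0_par|/bos_tail0_par] -[]. Qed.

Lemma full0_hrel : pairwise hrel (full_order 0 0).
Proof.
rewrite /full_order pairwise_cat; apply/and3P; split.
- apply/allrelP => p q; rewrite mem_negs inE => /half0_pos p0 q0.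
  have {}q0 : 0 <= q by case/predU1P: q0 => [->//|/half0_pos/andP[/ltW]].
  rewrite /hrel /negodd; case: (boolP (oddz p)) => po; case: (boolP (oddz q)) => qo /=; try lia.
  by move: qo; rewrite oddzE; lia.
- rewrite -[half_order 0]/(fer_tail 0 ++ bos_tail 0) negs_cat pairwise_cat; apply/and3P; split.
  + apply/allrelP => p q; rewrite !mem_negs => /bos_tail0_par[p0 po] /fer_tail0_par[q0 qo].
    by rewrite !oddzN in po qo; rewrite /hrel /negodd po (_ : p != q) /=; [lia|apply: contraTneq po => ->; rewrite qo].
  + apply: pairwise_negs (_ : pairwise (fun x y => (x < y) && (x \in bos_tail 0) && (y \in bos_tail 0)) _).
      move=> x y /andP[/andP[xy /bos_tail0_par[x0 xo]] /bos_tail0_par[y0 yo]].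
      by rewrite /hrel /negodd !oddzN yo; lia.
    apply: (sub_in_pairwise (P := mem (bos_tail 0))) (bos_tail_sorted 0); last exact/allP.
    by move=> x y /= -> -> /= ->.
  + apply: pairwise_negs (_ : pairwise (fun x y => (x < y) && (x \in fer_tail 0) && (y \in fer_tail 0)) _).
      move=> x y /andP[/andP[xy /fer_tail0_par[x0 xo]] /fer_tail0_par[y0 yo]].
      by rewrite /hrel !oddzN yo xo; lia.
    apply: (sub_in_pairwise (P := mem (fer_tail 0))) (fer_tail_sorted 0); last exact/allP.
    by move=> x y /= -> -> /= ->.
- rewrite pairwise_cons; apply/andP; split.
    apply/allP => q /half0_pos q0; rewrite /hrel.
    by case: (boolP (oddz q)) => qo /=; lia.
  rewrite -[half_order 0]/(fer_tail 0 ++ bos_tail 0) pairwise_cat; apply/and3P; split.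
  + apply/allrelP => p q /fer_tail0_par[p0 po] /bos_tail0_par[q0 qo].
    by rewrite /hrel qo (_ : p != q) /=; [lia|apply: contraTneq qo => <-; rewrite po].
  + apply: (sub_in_pairwise (P := mem (fer_tail 0))) (fer_tail_sorted 0); last exact/allP.
    by move=> p q /fer_tail0_par[p0 po] /fer_tail0_par[q0 qo] pq; rewrite /hrel po qo; lia.
  + apply: (sub_in_pairwise (P := mem (bos_tail 0))) (bos_tail_sorted 0); last exact/allP.
    by move=> p q /bos_tail0_par[p0 po] /bos_tail0_par[q0 qo] pq; rewrite /hrel qo; lia.
Qed.

Lemma full0_uniq : uniq (full_order 0 0).
Proof. by apply: pairwise_uniq full0_hrel => x; rewrite /hrel eqxx. Qed.

Lemma full0_win : {subset full_order 0 0 <= win L}.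
Proof.
move=> t; rewrite mem_win /full_order mem_cat mem_negs inE => /or3P[/half0_pos|/eqP->|/half0_pos]; lia.
Qed.

Lemma full_uniq k1 k2 : (k1 <= m)%N -> (k2 <= m)%N -> uniq (full_order k1 k2).
Proof. by move=> h1 h2; rewrite (perm_uniq (full_perm h1 h2)) full0_uniq. Qed.

Lemma full_win k1 k2 : (k1 <= m)%N -> (k2 <= m)%N -> {subset full_order k1 k2 <= win L}.
Proof. by move=> h1 h2 t; rewrite (perm_mem (full_perm h1 h2)) => /full0_win. Qed.

Lemma half_sum_Hcnt j : (Hcnt lam j)%:Z = d%:Z - (count (fun x => - j%:Z <= x) lam)%:Z.
Proof.
rewrite /Hcnt -[X in X%:Z - _](size_tuple lam) -(count_predC (fun x => - j%:Z <= x) lam) PoszD addrAC subrr add0r.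
by congr Posz; apply: eq_count => x /=; rewrite ltNge.
Qed.

Lemma full0_HW : HW (full_order 0 0) (etaY d (pass_state 0 0)) (w0 R L lam).
Proof.
split; first exact: w0_neq0.
- move=> p /full0_win pL; rewrite /EFl /= EF_w0_wt //; congr (_%:~R *: _).
  rewrite /etaY /base /pass_state /pass_count /=; case: (boolP (oddz p)) => po.
    have -> : odd `|p| = true by move: po.
    by case: (ltrP 0 p) => p0; rewrite /= ?addr0 ?oppr0.
  have -> : odd `|p| = false by apply/negbTE.
  rewrite !min0n !subn0; case: (ltrP 0 p) => p0; rewrite ?add0r.
    by congr Posz; apply: eq_count => x /=; move: po; rewrite oddzE; lia.
  rewrite half_sum_Hcnt opprB addrCA subrr addr0.
  by congr Posz; apply: eq_count => x /=; move: po; rewrite oddzE; lia.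
- apply: (sub_in_pairwise (P := mem (full_order 0 0))) full0_hrel; last exact/allP.
  move=> p q /full0_win pL /full0_win qL /andP[pq h]; apply/asboolP.
  exact: EF_w0_up.
Qed.

Lemma Ncnt_dec i j : (i <= j)%N -> (Ncnt lam j <= Ncnt lam i)%N.
Proof. by move=> ij; apply: sub_count => x /=; lia. Qed.
Lemma Hcnt_dec i j : (i <= j)%N -> (Hcnt lam j <= Hcnt lam i)%N.
Proof. by move=> ij; apply: sub_count => x /=; lia. Qed.

Section OneSide.
Variable G : nat -> nat.
Hypothesis G0 : forall j, (m < j)%N -> G j = 0%N.
Variable k : nat.
Hypothesis km : (k < m)%N.

Lemma Yc_even j : pass_count G k j.*2 = (G j - minn k j)%N.
Proof. by rewrite /pass_count odd_double doubleK. Qed.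

Lemma Yc_b : pass_count G k k.*2.+1 = 0%N.
Proof. by rewrite /pass_count /= odd_double /= uphalf_double ltnn. Qed.

Lemma Yc_b_next : pass_count G k.+1 k.*2.+1 = count (fun j => 0 < pass_count G k j.*2)%N (iota k.+1 (m - k)).
Proof.
rewrite /pass_count /= odd_double /= uphalf_double ltnSn -{1}(subnK (ltnW km)).
rewrite iotaD count_cat [X in (_ + X)%N](_ : _ = 0%N) ?addn0; last first.
  apply/eqP; rewrite -leqn0 leqNgt -has_count; apply/hasPn => j; rewrite mem_iota => jm.
  by rewrite G0 //; lia.
apply: eq_in_count => j; rewrite mem_iota => kj.
by rewrite odd_double doubleK; move: (G j) => g; lia.
Qed.

Lemma Yc_f j : (k < j)%N -> (pass_count G k j.*2).-1 = pass_count G k.+1 j.*2.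
Proof. by move=> kj; rewrite /pass_count odd_double doubleK; move: (G j) => g; lia. Qed.

Lemma Yc_other n : n != k.*2.+1 -> (forall j, (k < j <= m)%N -> n != j.*2) -> pass_count G k n = pass_count G k.+1 n.
Proof.
move=> nb nf; rewrite /pass_count; case: (boolP (odd n)) => on.
  by have -> : (n./2 < k.+1)%N = (n./2 < k)%N by lia.
have [kn|nk] := ltnP k n./2; last by rewrite !(minn_idPr _) // leqW.
have nm : (m < n./2)%N.
  by rewrite ltnNge; apply/negP => nm; have := nf n./2; rewrite kn nm => /(_ isT); lia.
by rewrite (G0 nm).
Qed.

End OneSide.

Lemma Y_neg k1 k2 (n : nat) : pass_state k1 k2 (- n%:Z) = pass_count (Hcnt lam) k2 n.
Proof. by rewrite /pass_state oppr_gt0 ltz_nat ltn0 abszN. Qed.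

Lemma Y_pos k1 k2 (n : nat) : (0 < n)%N -> pass_state k1 k2 n%:Z = pass_count (Ncnt lam) k1 n.
Proof. by move=> n0; rewrite /pass_state ltz_nat n0. Qed.

Lemma bidx_succ k : bidx k.+1 = (k.*2.+1)%:Z.
Proof. by []. Qed.

Lemma passY_pos k k2 t : (k < m)%N ->
  passY (bidx k.+1) (rev (fer_tail k)) (pass_state k k2) t = pass_state k.+1 k2 t.
Proof.
move=> km; have G0 j : (m < j)%N -> Ncnt lam j = 0%N by move=> /lam_small[].
rewrite /passY mem_rev; have [->|tb] := eqVneq t (bidx k.+1).
  rewrite count_rev /fer_tail count_map bidx_succ !Y_pos // Yc_b add0n (Yc_b_next G0 km).
  apply: eq_in_count => j; rewrite mem_iota => kj.
  by rewrite /preim /= -[fidx j]/((j.*2)%:Z) Y_pos //; lia.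
case: ifP => [/fer_tail_facts[j jm ->]|tev].
  by rewrite !Y_pos; [apply: Yc_f; lia|lia|lia].
rewrite /pass_state; case: ifP => // t0; apply: Yc_other => //.
  by apply: contra_neq tb => tk; rewrite bidx_succ -tk gtz0_abs.
move=> j jm; apply: contraFneq tev => tj; apply/mapP; exists j; first by rewrite mem_iota; lia.
by rewrite /fidx -tj gtz0_abs.
Qed.

Lemma passY_neg k t : (k < m)%N ->
  passY (- bidx k.+1) (negs (fer_tail k)) (pass_state m k) t = pass_state m k.+1 t.
Proof.
move=> km; have G0 j : (m < j)%N -> Hcnt lam j = 0%N by move=> /lam_small[].
rewrite /passY mem_negs; have [->|tb] := eqVneq t (- bidx k.+1).
  rewrite /negs count_rev !count_map bidx_succ !Y_neg Yc_b add0n (Yc_b_next G0 km).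
  by apply: eq_in_count => j _; rewrite /preim /= -[fidx j]/((j.*2)%:Z) Y_neg.
case: ifP => [/fer_tail_facts[j jm tj]|tev].
  have -> : t = - fidx j by rewrite -tj opprK.
  by rewrite !Y_neg; apply: Yc_f; lia.
rewrite /pass_state; case: (ltrP 0 t) => // t0; apply: Yc_other => //.
  by apply: contra_neq tb => tk; rewrite bidx_succ -tk; lia.
move=> j jm; apply: contraFneq tev => tj; apply/mapP; exists j; first by rewrite mem_iota; lia.
by rewrite /fidx -tj; lia.
Qed.

Lemma pairwise_rev (T : Type) (r : rel T) s : pairwise r s -> pairwise (fun x y => r y x) (rev s).
Proof.
elim: s => // x s IH /= /andP[xs /IH ps].
by rewrite rev_cons pairwise_rcons ps all_rev xs.
Qed.

Lemma bidx_odd k : oddz (bidx k.+1).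
Proof. by rewrite bidx_succ oddzE; lia. Qed.
Lemma fidx_even j : oddz (fidx j) = false.
Proof. by rewrite /fidx oddzE; lia. Qed.

(** Boson k + 1 comes from the right and meets the fermions in decreasing order of index, hence in
    increasing order of occupation, because [Ncnt lam] is non-increasing. This is the monotonicity
    that [pass_pos] requires. *)
Lemma chain_pos k : (k <= m)%N -> exists u, HW (full_order k 0) (etaY d (pass_state k 0)) (u : fock R (modes d L)).
Proof.
elim: k => [_|k IH km]; first by exists (w0 R L lam); exact: full0_HW.
have [u hw] := IH (ltnW km).
have e1 : full_order k 0 = (negs (half_order 0) ++ 0 :: interleaved k) ++ rev (rev (fer_tail k)) ++ bidx k.+1 :: bos_tail k.+1.
  by rewrite revK /full_order (half_before km) -catA.
have e2 : full_order k.+1 0 = (negs (half_order 0) ++ 0 :: interleaved k) ++ bidx k.+1 :: rev (rev (fer_tail k)) ++ bos_tail k.+1.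
  by rewrite revK /full_order (half_after km) -catA.
have ul := full_uniq (ltnW km) (leq0n m); have lW := full_win (ltnW km) (leq0n m).
rewrite e1 in ul lW hw.
have [||||u' hw'] := pass_pos ul lW _ _ _ _ hw.
- by rewrite bidx_succ.
- move=> f; rewrite mem_rev => /fer_tail_facts[j jm ->]; split; first by rewrite /fidx; lia.
  by rewrite oddzB fidx_even bidx_odd.
- apply: pairwise_rev; rewrite /fer_tail pairwise_map.
  apply: (sub_in_pairwise (P := [pred i | k < i]%N)) (_ : pairwise ltn _) => [i j /= ki kj ij||].
  + rewrite !inE in ki kj; rewrite !Y_pos; [|lia|lia].
    rewrite !Yc_even; have := Ncnt_dec (ltnW ij); move: (Ncnt lam i) (Ncnt lam j) => a b; lia.
  + by apply/allP => i; rewrite mem_iota inE; lia.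
  + by rewrite -sorted_pairwise ?iota_ltn_sorted //; exact: ltn_trans.
- by rewrite bidx_succ Y_pos // Yc_b.
exists u'; rewrite e2; apply: HW_ext hw' => t _; rewrite /etaY passY_pos //.
Qed.

Lemma chain_neg k : (k <= m)%N -> exists u, HW (full_order m k) (etaY d (pass_state m k)) (u : fock R (modes d L)).
Proof.
elim: k => [_|k IH km]; first exact: chain_pos.
have [u hw] := IH (ltnW km).
have e1 : full_order m k = negs (bos_tail k.+1) ++ (- bidx k.+1) :: negs (fer_tail k) ++ (negs (interleaved k) ++ 0 :: half_order m).
  by rewrite /full_order (half_before km) !negs_cat negs_cons -cats1 -!catA.
have e2 : full_order m k.+1 = negs (bos_tail k.+1) ++ negs (fer_tail k) ++ (- bidx k.+1) :: (negs (interleaved k) ++ 0 :: half_order m).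
  by rewrite /full_order (half_after km) !negs_cat negs_cons negs_cat -cats1 -!catA.
have ul := full_uniq (leqnn m) (ltnW km); have lW := full_win (leqnn m) (ltnW km).
rewrite e1 in ul lW hw.
have [||||u' hw'] := pass_neg ul lW _ _ _ _ hw.
- by rewrite bidx_succ; lia.
- move=> f; rewrite mem_negs => /fer_tail_facts[j jm fj].
  have -> : f = - fidx j by rewrite -fj opprK.
  by split; [rewrite /fidx; lia|rewrite oddzB !oddzN fidx_even bidx_odd].
- apply: (@pairwise_negs (fun x y => pass_state m k (- y) <= pass_state m k (- x))%N) => [x y //|].
  rewrite /fer_tail pairwise_map.
  apply: (sub_in_pairwise (P := [pred i | k < i]%N)) (_ : pairwise ltn _) => [i j /= ki kj ij||].
  + rewrite !Y_neg.
    rewrite !Yc_even; have := Hcnt_dec (ltnW ij); move: (Hcnt lam i) (Hcnt lam j) => a b; lia.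
  + by apply/allP => i; rewrite mem_iota inE; lia.
  + by rewrite -sorted_pairwise ?iota_ltn_sorted //; exact: ltn_trans.
- by rewrite bidx_succ Y_neg Yc_b.
exists u'; rewrite e2; apply: HW_ext hw' => t _; rewrite /etaY passY_neg //.
Qed.

Lemma inter_facts k : pairwise <%R (interleaved k) /\ {in interleaved k, forall t, 0 < t <= (k.*2)%:Z}.
Proof.
elim: k => [|k [IH1 IH2]]; first by split.
rewrite inter_rec; split.
  rewrite pairwise_cat IH1 /= !andbT bidx_succ /fidx; apply/andP; split; last by lia.
  apply/allrelP => x y /IH2 xk; rewrite !inE => /orP[]/eqP->; lia.
move=> t; rewrite mem_cat => /orP[/IH2|]; first by lia.
by rewrite bidx_succ /fidx !inE => /orP[]/eqP->; lia.
Qed.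

Lemma half_m : half_order m = interleaved m.
Proof. by rewrite /half_order /fer_tail /bos_tail subnn /= cats0. Qed.

Lemma full_sorted : pairwise <%R (full_order m m).
Proof.
have [s1 s2] := inter_facts m.
rewrite /full_order half_m pairwise_cat pairwise_cons s1 andbT; apply/and3P; split.
- apply/allrelP => x y; rewrite mem_negs inE => /s2 x0 /predU1P[->|/s2]; lia.
- by apply: pairwise_negs s1 => x y; rewrite ltrN2.
- by apply/allP => x /s2 /andP[].
Qed.

Lemma mem_full t : t \in win L -> t \in full_order m m.
Proof.
rewrite mem_win (perm_mem (full_perm (leqnn m) (leqnn m))) => tL.
have pos (s : int) : 0 < s -> (`|s| <= L)%N -> s \in half_order 0.
  move=> s0 sL; rewrite -[half_order 0]/(fer_tail 0 ++ bos_tail 0) mem_cat.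
  apply/orP; case: (boolP (oddz s)) => so; [right|left]; apply/mapP.
    by exists (`|s|./2.+1); rewrite ?mem_iota /bidx; move: so; rewrite /oddz; lia.
  by exists (`|s|./2); rewrite ?mem_iota /fidx; move: so; rewrite /oddz; lia.
rewrite /full_order mem_cat mem_negs inE; case: (ltrgtP t 0) => t0; last by rewrite orbT.
  by rewrite pos ?oppr_gt0 ?abszN.
by rewrite (pos t t0 tL) !orbT.
Qed.

Lemma pairwise_lt_rel (r : rel int) l p q : pairwise r l -> pairwise <%R l ->
  p \in l -> q \in l -> p < q -> r p q.
Proof.
elim: l => // x l IH /= /andP[/allP rx rl] /andP[/allP xl ltl]; rewrite !inE.
move=> /predU1P[->|pl] /predU1P[->|ql] pq; first by rewrite ltxx in pq.
- exact: rx.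
- by have := lt_trans (xl p pl) pq; rewrite ltxx.
- exact: IH.
Qed.

Lemma fock_hw : exists u : fock R (modes d L),
  [/\ u != 0, forall p q, p \in win L -> q \in win L -> p < q -> EFl R d L p q u = 0
    & forall p, p \in win L -> EFl R d L p p u = (zz m (Ncnt lam) (Hcnt lam) p + base d p)%:~R *: u].
Proof.
have [u [u0 wu pu]] := chain_neg (leqnn m); exists u; split=> //.
  move=> p q /mem_full pl /mem_full ql pq.
  by have /asboolP := pairwise_lt_rel pu full_sorted pl ql pq.
move=> p pL; rewrite wu ?mem_full //; congr (_%:~R *: _); rewrite addrC /etaY; congr (_ + _).
rewrite /zz /pass_state /pass_count /=; rewrite mem_win in pL.
have pm : (`|p|./2 <= m)%N by lia.
have e : odd `|p| = oddz p by [].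
rewrite !e; case: (boolP (oddz p)) => po; last by rewrite !(minn_idPr pm); case: (0 < p).
have pm1 : (`|p|./2 < m)%N by move: po; rewrite /oddz; lia.
by rewrite !pm1; case: (0 < p).
Qed.

End Chain.

(** * The projection onto the highest weight vector *)

Section Straighten.
(** The parameter in [S] stands for the vector acted on: a last letter of degree 0 is absorbed by
    replacing that vector. *)
Variables (C : pzRingType) (S T : Type) (deg : T -> int) (f : S -> seq T -> C).
Hypothesis f_swap : forall s X x y Z, exists (c : C) (l : seq (C * T)),
  f s (X ++ x :: y :: Z) = c * f s (X ++ y :: x :: Z) + \sum_(a <- l) a.1 * f s (X ++ a.2 :: Z).
Hypothesis f_neg : forall s x Z, deg x < 0 -> f s (x :: Z) = 0.
Hypothesis f_pos : forall s x Z, 0 < deg x -> f s (rcons Z x) = 0.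
Hypothesis f_zero : forall s x, deg x = 0 -> exists c s', forall Z, f s (rcons Z x) = c * f s' Z.
Hypothesis f_nil : forall s, f s [::] = 0.

(* Move the last letter to the front: the swaps only create shorter words. *)
Lemma straighten s Y : f s Y = 0.
Proof.
have [n] := ubnP (size Y); elim: n s Y => // n IH s Y /ltnSE Yn.
case/lastP: Y Yn => [//|Y x]; rewrite size_rcons => Yn.
case: (ltrgtP (deg x) 0) => dx; [|exact: f_pos|]; last first.
  by have [c [s' ->]] := f_zero s dx; rewrite IH ?mulr0.
rewrite -cats1; have {Yn} : (size Y + size (@nil T) < n)%N by rewrite addn0.
move: [::] => Z; elim/last_ind: Y Z => [|Y y IHY] Z; first by move=> _; exact: f_neg.
rewrite size_rcons cat_rcons => Yn; have [c [l ->]] := f_swap s Y y x Z.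
rewrite (IHY (y :: Z)); last by rewrite /= addnS.
by rewrite mulr0 add0r big1 // => a _; rewrite IH ?mulr0 // size_cat /= addnS.
Qed.

End Straighten.

Section Highest.
Variable R : realType.
Local Notation C := (R[i]).

Lemma bracket_degree k l (x y : glhat R) : has_degree k x -> has_degree l y ->
  has_degree (k + l) (bracket x y).
Proof.
move=> hx hy; have [px _] := degree_parity hx; have [py _] := degree_parity hy.
have [dx _] := hx; have [dy _] := hy; split=> [i j|kl].
  rewrite /bracket (bracket_glE px py) !glE.
  have [A0|/mul_gl_neq0[t [/dx h1 /dy h2] _]] := eqVneq (mul_gl x.1 y.1 i j) 0; last by lia.
  have [B0|/mul_gl_neq0[t [/dy h1 /dx h2] _]] := eqVneq (mul_gl y.1 x.1 i j) 0; last by lia.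
  by rewrite A0 B0 mulr0 subr0 eqxx.
apply: fsbig1 => r _; apply/eqP; rewrite mulf_eq0; apply/orP; right.
apply: contrapT => /negP/mul_gl_neq0[t []].
by rewrite bracket_J mulf_eq0 negb_or => /andP[_ /dx h1] /dy h2; lia.
Qed.

Definition diag_gl (g : int -> C^o) : gl R := Gl (diag_inf_banded g).

Lemma diag_glE g i j : diag_gl g i j = if i == j then g i else 0.
Proof. by []. Qed.

Lemma bracket_diag g (x : glhat R) k c : has_degree k x ->
  bracket (diag_gl g, c) x = (bracket_gl (diag_gl g) x.1, 0) /\
  forall i j, bracket_gl (diag_gl g) x.1 i j = (g i - g j) * x.1 i j.
Proof.
move=> hx; have [px _] := degree_parity hx.
have pg : parity_gl false (diag_gl g).
  by move=> i j; rewrite diag_glE; case: (i =P j) => [->|_]; rewrite ?subrr ?eqxx.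
split.
  congr pair; apply: fsbig1 => r _; apply/eqP; rewrite mulf_eq0; apply/orP; right; apply/eqP.
  apply: fsbig1 => t _; rewrite bracket_J diag_glE.
  by case: (r =P t) => [->|_]; rewrite ?subrr !(mulr0, mul0r).
move=> i j; rewrite (bracket_glE pg px) expr0 scale1r !glE.
rewrite (@mul_gl_delta _ _ _ i j i) => [|t ti]; last first.
  by left; rewrite diag_glE eq_sym (negbTE ti).
rewrite (@mul_gl_delta _ _ _ i j j) => [|t tj]; last first.
  by right; rewrite diag_glE (negbTE tj).
by rewrite !diag_glE !eqxx mulrBl [g j * _]mulrC.
Qed.

Lemma diag_degree g c : has_degree 0 ((diag_gl g, c) : glhat R).
Proof.
split=> // i j; rewrite diag_glE; case: (i =P j) => [->|_]; by rewrite ?subrr ?eqxx.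
Qed.

Lemma degree0_diag (x : glhat R) : has_degree 0 x -> x = cartan_incl ((fun i => x.1 i i), x.2).
Proof.
move=> [dx _]; rewrite [LHS]surjective_pairing; congr pair.
apply: glP => i j; rewrite -[RHS]/(diag_gl _ i j) diag_glE.
case: (i =P j) => [->//|ij]; apply/eqP; apply: contraT => /dx e.
by case: ij; lia.
Qed.

Section Span.
Variable M : glhat_module R.
Implicit Types (S : set M) (u w : M).

Lemma lin_span_ind S (P : M -> Prop) : P 0 -> (forall a u w, S u -> P w -> P (a *: u + w)) ->
  forall u, lin_span S u -> P u.
Proof.
move=> P0 Pc u [n [c [w [Sw ->]]]].
elim: n c w Sw => [|n IH] c w Sw; first by rewrite big_ord0.
by rewrite big_ord_recl; apply: Pc => //; apply: IH.
Qed.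

Lemma lin_span0 S : lin_span S 0.
Proof. by exists 0%N, (fun=> 0), (fun=> 0); split=> [[]|]; rewrite ?big_ord0. Qed.

Lemma lin_span_cons S a u w : S u -> lin_span S w -> lin_span S (a *: u + w).
Proof.
move=> Su [n [c [t [St ->]]]].
exists n.+1, (fun i => if unlift ord0 i is Some j then c j else a),
  (fun i => if unlift ord0 i is Some j then t j else u); split.
  by move=> i; case: unliftP.
rewrite big_ord_recl unlift_none; congr (_ + _).
by apply: eq_bigr => i _; rewrite liftK.
Qed.

Lemma lin_span_mem S u : S u -> lin_span S u.
Proof. by move=> Su; have := lin_span_cons 1 Su (lin_span0 S); rewrite scale1r addr0. Qed.

Lemma lin_span_lin S a u w : lin_span S u -> lin_span S w -> lin_span S (a *: u + w).
Proof.
move=> Su Sw; move: u Su; apply: lin_span_ind => [|b u t Su]; first by rewrite scaler0 add0r.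
by rewrite scalerDr -addrA scalerA; exact: lin_span_cons.
Qed.

Lemma lin_spanD S u w : lin_span S u -> lin_span S w -> lin_span S (u + w).
Proof. by move=> Su Sw; rewrite -[u]scale1r; exact: lin_span_lin. Qed.

Lemma lin_spanZ S a u : lin_span S u -> lin_span S (a *: u).
Proof. by move=> Su; rewrite -[_ *: _]addr0; apply: lin_span_lin => //; exact: lin_span0. Qed.

Lemma lin_spanB S u w : lin_span S u -> lin_span S w -> lin_span S (u - w).
Proof. by move=> Su Sw; rewrite -scaleN1r addrC; exact: lin_span_lin. Qed.

(** Applying D - t.1 cancels one summand and multiplies u by the non-zero number a - t.1, so u is
    already a sum of eigenvectors from the shorter list. *)
Lemma eigen_sum (D : {linear M -> M}) (s : seq (C * M)) (a : C) u :
  (forall t, t \in s -> D t.2 = t.1 *: t.2 /\ t.1 != a) ->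
  u = \sum_(t <- s) t.2 -> D u = a *: u -> u = 0.
Proof.
have [n] := ubnP (size s); elim: n s u => // n IH [|t s] u sn hs; first by rewrite big_nil.
have [ht ta] := hs t (mem_head _ _); rewrite big_cons => eu Du.
have ta0 : a - t.1 != 0 by rewrite subr_eq0 eq_sym.
have Ds : D (\sum_(t' <- s) t'.2) = \sum_(t' <- s) t'.1 *: t'.2.
  rewrite linear_sum big_seq [RHS]big_seq; apply: eq_bigr => t' ts.
  by have [] := hs t' (mem_behead (s := t :: s) ts).
have e : (a - t.1) *: u = \sum_(t' <- s) (t'.1 - t.1) *: t'.2.
  rewrite scalerBl -Du eu linearD Ds ht scalerDr opprD addrACA subrr add0r.
  by rewrite scaler_sumr -sumrB; apply: eq_bigr => t' _; rewrite scalerBl.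
pose s' := [seq (t'.1, ((a - t.1)^-1 * (t'.1 - t.1)) *: t'.2) | t' <- s].
apply: (IH s' u _ _ _ Du) => [|x /mapP[t' ts ->]|]; first by rewrite size_map; exact: ltnSE sn.
  2: {
    rewrite big_map -[LHS](scalerK ta0) e scaler_sumr.
    by apply: eq_bigr => t' _; rewrite scalerA. }
have [ht' t'a] := hs t' (mem_behead (s := t :: s) ts).
by rewrite /= linearZ /= ht' !scalerA [t'.1 * _]mulrC.
Qed.

Variables (xi : {scalar cartan R}) (v : M).
Hypothesis hwv : is_hw_vector xi v.

Let v0 : v != 0. Proof. by case: hwv. Qed.

Definition height : cartan R := ((fun j => j%:~R), 0).
(** The degree operator, normalised to kill v; it acts by -k in degree k. As a module carries only a
    parity and no Z-grading in its structure, degrees are separated through these eigenvalues. *)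
Definition Dh (u : M) : M := gm_act (cartan_incl height) u - xi height *: u.

Lemma Dh_linear : linear Dh.
Proof.
move=> a u w; rewrite /Dh actDr actZr scalerDr scalerA [_ * a]mulrC -scalerA scalerBr opprD.
by rewrite addrACA.
Qed.
HB.instance Definition _ := GRing.isLinear.Build C M M *:%R Dh Dh_linear.

Lemma act_cartan_comm g c k (x : glhat R) (u : M) : has_degree k x ->
  gm_act (cartan_incl (g, c)) (gm_act x u) =
  gm_act x (gm_act (cartan_incl (g, c)) u) + gm_act (bracket_gl (diag_gl g) x.1, 0) u.
Proof.
move=> hx; have := gm_act_bracket u (degree_parity (diag_degree g c)) (degree_parity hx).
rewrite [oddz 0]/= expr0 scale1r => /esym/(canRL (subrK _)) ->.
by have [-> _] := bracket_diag g c hx; rewrite addrC.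
Qed.

Lemma Dh_act k (x : glhat R) (u : M) : has_degree k x -> k != 0 ->
  Dh (gm_act x u) = gm_act x (Dh u) - k%:~R *: gm_act x u.
Proof.
move=> hx k0; rewrite /Dh (act_cartan_comm _ _ _ hx) actBr actZr addrAC; congr (_ + _).
have [_ e] := bracket_diag (fun j => j%:~R) 0 hx; have [dx x2] := hx.
rewrite -scaleNr -actZl; congr (gm_act _ u).
rewrite [RHS]surjective_pairing; congr pair; last by rewrite /= x2 // scaler0.
apply: glP => i j; rewrite e [RHS](scale_glE _ x.1).
have [->|/dx ij] := eqVneq (x.1 i j) 0; first by rewrite !mulr0.
by rewrite -ij -rmorphB -rmorphN opprB.
Qed.

Lemma lowering_le k u : lowering v k u -> k <= 0.
Proof. by elim=> // {}k l x w k0 _ _ l0; lia. Qed.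

Lemma Dh_v : Dh v = 0.
Proof. by case: hwv => _ h _ _; rewrite /Dh h subrr. Qed.

Lemma Dh_lowering k u : lowering v k u -> Dh u = (- k)%:~R *: u.
Proof.
elim=> [|{}k l x w k0 hx _ IH]; first by rewrite Dh_v scale0r.
rewrite (Dh_act _ hx) ?lt_eqF // IH actZr -scalerBl; congr (_ *: _).
by rewrite -rmorphB; congr (_%:~R); lia.
Qed.

Definition Mneg : set M := lin_span [set u | exists k, k < 0 /\ lowering v k u]%classic.

Lemma Mneg_eigen u : Mneg u -> exists s : seq (C * M),
  (forall t, t \in s -> Dh t.2 = t.1 *: t.2 /\ t.1 != 0) /\ u = \sum_(t <- s) t.2.
Proof.
move: u; apply: (@lin_span_ind [set u | exists k, k < 0 /\ lowering v k u]%classic) => [|a w t [k [k0 lw]] [s [hs ->]]].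
  by exists [::]; split=> //; rewrite big_nil.
exists (((- k)%:~R, a *: w) :: s); split; last by rewrite big_cons.
move=> x; rewrite inE => /predU1P[->|/hs //]; split=> /=.
  by rewrite linearZ /= (Dh_lowering lw) !scalerA mulrC.
by rewrite intr_eq0 oppr_eq0 lt_eqF.
Qed.

Lemma Mneg_Dh0 u : Mneg u -> Dh u = 0 -> u = 0.
Proof.
move=> /Mneg_eigen[s [hs eu]] Du.
by apply: (@eigen_sum Dh s 0 u hs eu); rewrite scale0r.
Qed.

Lemma Mneg_scale_v c : Mneg (c *: v) -> c = 0.
Proof.
move=> h; have : c *: v = 0 by apply: Mneg_Dh0 => //; rewrite linearZ /= Dh_v scaler0.
by move/eqP; rewrite scaler_eq0 (negbTE v0) orbF => /eqP.
Qed.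

Lemma lowering_split k u : lowering v k u -> u = v \/ Mneg u.
Proof.
case=> [|{}k l x w k0 hx lw]; first by left.
right; apply: lin_span_mem; exists (k + l); split; last exact: lowering_cons.
by have := lowering_le lw; lia.
Qed.

Lemma proj_ex u : exists c : C, Mneg (u - c *: v).
Proof.
case: hwv => _ _ _ hT.
have : lin_span [set u | exists k, lowering v k u]%classic u by rewrite hT.
move: u; apply: lin_span_ind => [|a u w [k lu] [c hc]].
  by exists 0; rewrite scale0r subrr; exact: lin_span0.
case: (lowering_split lu) => [->|nu].
  by exists (a + c); rewrite scalerDl opprD addrACA subrr add0r.
by exists c; rewrite -addrA; apply: lin_span_lin.
Qed.

Definition proj (u : M) : C := xget 0 [set c : C | Mneg (u - c *: v)]%classic.

Lemma projP u : Mneg (u - proj u *: v).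
Proof. by have [c hc] := proj_ex u; exact: (@xgetPex _ 0 [set c | Mneg (u - c *: v)]%classic (ex_intro _ c hc)). Qed.

Lemma proj_uniq u c : Mneg (u - c *: v) -> proj u = c.
Proof.
move=> hc; apply/eqP; rewrite -subr_eq0; apply/eqP; apply: Mneg_scale_v.
have := lin_spanB hc (projP u); rewrite opprB addrC addrA subrK.
by rewrite scalerBl.
Qed.

Lemma proj_linear : linear_for *%R proj.
Proof.
move=> a u w; apply: proj_uniq.
have := lin_span_lin a (projP u) (projP w).
by rewrite scalerDl scalerBr opprD addrACA scalerA.
Qed.

Lemma proj_v : proj v = 1.
Proof. by apply: proj_uniq; rewrite scale1r subrr; exact: lin_span0. Qed.

Lemma proj_Mneg u : Mneg u -> proj u = 0.
Proof. by move=> hu; apply: proj_uniq; rewrite scale0r subr0. Qed.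

Lemma act_neg_Mneg k (x : glhat R) u : has_degree k x -> k < 0 -> Mneg (gm_act x u).
Proof.
move=> hx k0; case: hwv => _ _ _ hT.
have : lin_span [set u | exists k, lowering v k u]%classic u by rewrite hT.
move: u; apply: lin_span_ind => [|a u w [l lu] IH]; first by rewrite act0r; exact: lin_span0.
rewrite actDr actZr; apply: lin_span_lin => //; apply: lin_span_mem; exists (k + l).
by split; [have := lowering_le lu; lia|exact: lowering_cons].
Qed.

Lemma proj_act_neg k (x : glhat R) u : has_degree k x -> k < 0 -> proj (gm_act x u) = 0.
Proof. by move=> hx k0; apply: proj_Mneg; exact: act_neg_Mneg hx k0. Qed.

Lemma Dh0_v u : Dh u = 0 -> u = proj u *: v.
Proof.
move=> Du; apply/eqP; rewrite -subr_eq0; apply/eqP; apply: Mneg_Dh0 (projP u) _.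
by rewrite linearB linearZ /= Du Dh_v scaler0 subrr.
Qed.

End Span.
End Highest.

(** * The radical of the projection, and singular vectors *)

Section Radical.
Variable R : realType.
Local Notation C := (R[i]).

Lemma deg_banded (k : int) (A : gl R) :
  ((fun i j => if j - i == k then A i j else 0) : matrix_inf R) \in @banded R.
Proof.
have /asboolP[N hN] := valP A; apply/asboolP; exists N => i j h.
by case: ifP => // _; exact: hN.
Qed.
Definition deg_gl (k : int) (A : gl R) : gl R := Gl (deg_banded k A).

Lemma deg_glE k A i j : deg_gl k A i j = if j - i == k then A i j else 0.
Proof. by []. Qed.

Record homogeneous := Homogeneous {
  hom_elt :> glhat R; hom_deg : int; hom_degP : has_degree hom_deg hom_elt }.

Lemma deg_hom_degree k A (c : C) : has_degree k ((deg_gl k A, (k == 0)%:R * c) : glhat R).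
Proof.
split=> [i j|k0]; first by rewrite deg_glE; case: (j - i =P k) => [//|]; rewrite eqxx.
by rewrite /= (negbTE k0) mul0r.
Qed.
Definition deg_hom k A c := Homogeneous (deg_hom_degree k A c).

Lemma gl_deg_sum N (A : gl R) : band N A -> A = \sum_(k <- win N) deg_gl k A.
Proof.
move=> bA; apply: glP => i j; rewrite glE.
have [A0|A0] := eqVneq (A i j) 0.
  by rewrite A0 big1 // => k _; rewrite deg_glE A0 if_same.
have ij : j - i \in win N by rewrite mem_win distnC; exact: bA.
rewrite (@big_win1 _ N (j - i)) ?ij ?deg_glE ?eqxx // => k kn.
by rewrite deg_glE eq_sym (negbTE kn).
Qed.

Lemma hom_decomp (x : glhat R) : exists s : seq homogeneous, x = \sum_(y <- s) hom_elt y.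
Proof.
have [N bN] := band_ex x.1.
exists [seq deg_hom k x.1 x.2 | k <- win N]; rewrite big_map.
rewrite [LHS]surjective_pairing [RHS]surjective_pairing; congr pair.
  by rewrite {1}(gl_deg_sum bN); elim/big_rec2: _ => // k a b _ ->.
have n0 : 0 \in win N by rewrite mem_win.
have sndE (r : seq int) : (\sum_(k <- r) (hom_elt (deg_hom k x.1 x.2))).2 = \sum_(k <- r) (k == 0)%:R * x.2.
  by elim/big_rec2: _ => // k a b _ <-.
by rewrite sndE (@big_win1 _ N 0) ?n0 ?mul1r // => k /negbTE ->; rewrite mul0r.
Qed.

Variable M : glhat_module R.
Variables (xi : {scalar cartan R}) (v : M).
Hypothesis hwv : is_hw_vector xi v.
Hypothesis M_irr : irreducible M.

Let v0 : v != 0. Proof. by case: hwv. Qed.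
Let par0 b : (0 : M) \in gm_par b. Proof. by have [] := gm_par_submod M b. Qed.
Let parL b a (u w : M) : u \in gm_par b -> w \in gm_par b -> a *: u + w \in gm_par b.
Proof. by have [_ h] := gm_par_submod M b; exact: h. Qed.
Let parZ b a (u : M) : u \in gm_par b -> a *: u \in gm_par b.
Proof. by move=> hu; have := parL a hu (par0 b); rewrite addr0. Qed.
Let parD b (u w : M) : u \in gm_par b -> w \in gm_par b -> u + w \in gm_par b.
Proof. by move=> hu hw; have := parL 1 hu hw; rewrite scale1r. Qed.
Let parN b (u : M) : u \in gm_par b -> - u \in gm_par b.
Proof. by move=> hu; have := parZ (-1) hu; rewrite scaleN1r. Qed.
Let par_disj b (u : M) : u \in gm_par b -> u \in gm_par (~~ b) -> u = 0.
Proof. by case: b => /= h1 h2; apply: gm_par_direct. Qed.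

Local Notation pr := (proj v).

Lemma projL a (u w : M) : pr (a *: u + w) = a * pr u + pr w.
Proof. exact: (proj_linear hwv). Qed.
Lemma projD (u w : M) : pr (u + w) = pr u + pr w.
Proof. by have := projL 1 u w; rewrite scale1r mul1r. Qed.
Lemma proj0 : pr 0 = 0.
Proof. by apply: (proj_Mneg hwv); exact: lin_span0. Qed.
Lemma projZ a (u : M) : pr (a *: u) = a * pr u.
Proof. by have := projL a u 0; rewrite !addr0 proj0 addr0. Qed.
Lemma proj_sum (I : Type) (r : seq I) (F : I -> M) : pr (\sum_(i <- r) F i) = \sum_(i <- r) pr (F i).
Proof. by elim/big_rec2: _ => [|i y x _ <-]; rewrite ?proj0 ?projD. Qed.

Lemma Dh_par b u : u \in gm_par b -> Dh xi u \in @gm_par _ M b.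
Proof.
move=> ub; rewrite /Dh; apply: parD; last by apply: parN; exact: parZ.
have := gm_act_par (degree_parity (diag_degree (fun j => j%:~R) 0)) ub.
by rewrite [oddz 0]/= addFb.
Qed.

(** The operator [Dh] preserves parity and its kernel is the line of v. Both parity components of v
    lie in this kernel, so one of them must vanish. *)
Lemma hw_homogeneous : exists a, v \in gm_par a.
Proof.
have [u0 [u1 [p0 p1 e]]] := gm_par_sum v.
have Dsum : Dh xi u0 + Dh xi u1 = 0 by rewrite -(linearD (Dh xi)) -e; exact: Dh_v hwv.
have D0 : Dh xi u0 = 0.
  apply: gm_par_direct (Dh_par p0) _.
  by move/eqP: Dsum; rewrite addr_eq0 => /eqP ->; apply: parN; exact: Dh_par.
have := Dh0_v hwv D0; set c := pr u0; rewrite e scalerDr => ec.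
have c1 : c *: u1 = 0.
  apply: gm_par_direct (parZ c p1).
  have -> : c *: u1 = - c *: u0 + u0 by rewrite scaleNr addrC {1}ec addrAC subrr add0r.
  exact: parL.
have [c0|cn0] := eqVneq c 0.
  by exists true; rewrite ec c0 !scale0r !add0r.
move/eqP: c1; rewrite scaler_eq0 (negbTE cn0) => /eqP u10.
by exists false; rewrite u10 addr0.
Qed.

Lemma Mneg_par_split a b m : v \in gm_par a -> Mneg v m ->
  exists m0 m1, [/\ Mneg v m0, m0 \in gm_par b, Mneg v m1, m1 \in gm_par (~~ b) & m = m0 + m1].
Proof.
move=> va; have lpar k u : lowering v k u -> u \in gm_par (oddz k (+) a).
  elim=> [|{}k l x w k0 hx _ IH]; first by rewrite addFb.
  by rewrite oddzD -addbA; exact: gm_act_par (degree_parity hx) IH.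
move: m; apply: (@lin_span_ind _ _ [set u | exists k, k < 0 /\ lowering v k u]%classic).
  by exists 0, 0; split; rewrite ?addr0 //; exact: lin_span0.
move=> c u w [k [k0 lu]] [m0 [m1 [h1 h2 h3 h4 ->]]].
have cu : Mneg v (c *: u) by apply: lin_spanZ; apply: lin_span_mem; exists k.
have up := lpar _ _ lu; have [e|ne] := eqVneq (oddz k (+) a) b.
  exists (c *: u + m0), m1; split; rewrite ?addrA //; first exact: lin_spanD.
  by apply: parL => //; rewrite -e.
exists m0, (c *: u + m1); split; rewrite ?addrA //; [exact: lin_spanD| |by rewrite [c *: u + m0]addrC].
apply: parL => //; have -> : ~~ b = oddz k (+) a by move: ne; case: b {h2 h4}; case: (_ (+) _).
exact: up.
Qed.

(** With v homogeneous, [Mneg] splits into parities, so the coefficient of v only sees the parity of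
    v. *)
Lemma proj_par a u : v \in gm_par a -> u \in gm_par (~~ a) -> pr u = 0.
Proof.
move=> va ua; have hp := projP hwv u.
have [m0 [m1 [h1 h2 h3 h4 e]]] := Mneg_par_split a va hp.
have e2 : u - m1 = pr u *: v + m0.
  by apply/eqP; rewrite subr_eq -addrA -e addrC subrK.
have z : pr u *: v + m0 = 0.
  apply: (@par_disj a); first exact: parL.
  by rewrite -e2; apply: parD => //; exact: parN.
apply: (Mneg_scale_v hwv); move/eqP: z; rewrite addr_eq0 => /eqP ->.
by rewrite -[- m0]scaleN1r; exact: lin_spanZ.
Qed.

Fixpoint hact (Y : seq homogeneous) (u : M) : M :=
  if Y is y :: Y' then gm_act y (hact Y' u) else u.

Lemma hact_cat Y Z u : hact (Y ++ Z) u = hact Y (hact Z u).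
Proof. by elim: Y => //= y Y ->. Qed.

Lemma hact_lin Y a u w : hact Y (a *: u + w) = a *: hact Y u + hact Y w.
Proof. by elim: Y => //= y Y ->; rewrite actDr actZr. Qed.

Lemma hact_par Y b u : u \in gm_par b ->
  hact Y u \in @gm_par _ M (foldr (fun y c => oddz (hom_deg y) (+) c) b Y).
Proof.
by move=> ub; elim: Y => //= y Y IH; exact: gm_act_par (degree_parity (hom_degP y)) IH.
Qed.

Definition radical (u : M) : Prop := forall Y, pr (hact Y u) = 0.

Lemma radical_lin a u w : radical u -> radical w -> radical (a *: u + w).
Proof. by move=> hu hw Y; rewrite hact_lin projL hu hw mulr0 addr0. Qed.

Lemma radical0 : radical 0.
Proof.
have h0 Y : hact Y 0 = 0 by elim: Y => //= y Y ->; rewrite act0r.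
by move=> Y; rewrite h0 proj0.
Qed.

(** The radical is a submodule that misses v. Submodules are required to be graded by parity, which
    is what the preceding parity lemmas supply. *)
Lemma radical_eq0 u : radical u -> u = 0.
Proof.
have [a va] := hw_homogeneous.
have subU : is_submodule (M := M) (fun u : M => `[< radical u >]).
  split.
  - split; first exact/asboolP/radical0.
    by move=> c x y /asboolP hx /asboolP hy; apply/asboolP; exact: radical_lin.
  - move=> x /asboolP hx; have [x0 [x1 [p0 p1 e]]] := gm_par_sum x.
    (* For each word, the images of x' and of x - x' have opposite parities, so at most one of them
       has a non-zero projection; their sum projects to zero because x is in the radical. *)
    have hb b (x' : M) : x' \in gm_par b -> x - x' \in gm_par (~~ b) -> radical x'.
      move=> xb xb' Y.
      have hY := hact_par Y xb; have hY' := hact_par Y xb'.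
      set c := foldr _ _ _ in hY; set c' := foldr _ _ _ in hY'.
      have cc : c' = ~~ c.
        by rewrite /c /c'; elim: (Y) => //= y Y' ->; rewrite -addbN.
      have [e1|e1] := eqVneq c a; last first.
        by apply: (proj_par va); have <- : c = ~~ a by move: e1; case: (c); case: (a).
      have := hx Y; rewrite -[x](subrK x') -[x - x']scale1r hact_lin projL mul1r.
      by rewrite (proj_par va) ?add0r // -e1 -cc.
    exists x0, x1; split=> //; apply/asboolP.
      by apply: (hb false) => //; rewrite e addrC addKr.
    by apply: (hb true) => //; rewrite e addrK.
  - move=> x w /asboolP hw; apply/asboolP.
    have [s ->] := hom_decomp x; rewrite act_suml.
    elim/big_rec: _ => [|y t _ ht]; first exact: radical0.
    rewrite -[gm_act y w]scale1r; apply: radical_lin => // Y.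
    by have := hw (rcons Y y); rewrite -cats1 hact_cat.
have [_ /(_ _ subU)[h hu|h]] := M_irr; first by apply: h; apply/asboolP.
have /asboolP/(_ [::]) := h v; rewrite /= (proj_v hwv) => /eqP.
by rewrite oner_eq0.
Qed.

Lemma Mneg_deg0 h u : has_degree 0 h -> Mneg v u -> Mneg v (gm_act h u).
Proof.
move=> hh; have key k w : lowering v k w -> lin_span (lowering v k) (gm_act h w).
  elim=> [|{}k l x t k0 hx lt IH].
    rewrite (degree0_diag hh); case: hwv => _ -> _ _.
    by apply: lin_spanZ; apply: lin_span_mem; exact: lowering_nil.
  rewrite (degree0_diag hh) (act_cartan_comm _ _ _ hx) -(degree0_diag hh).
  apply: lin_spanD.
    move: (gm_act h t) IH; apply: lin_span_ind => [|a w' t' lw' IH].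
      by rewrite act0r; exact: lin_span0.
    by rewrite actDr actZr; apply: lin_span_cons => //; exact: lowering_cons.
  apply: lin_span_mem; apply: lowering_cons => //.
  have [_ e] := bracket_diag (fun i => h.1 i i) 0 hx; have [dx _] := hx.
  split=> // i j /=; rewrite e mulf_eq0 negb_or => /andP[_]; exact: dx.
move: u; apply: (@lin_span_ind _ _ [set u | exists k, k < 0 /\ lowering v k u]%classic).
  by rewrite act0r; exact: lin_span0.
move=> a u w [k [k0 /key lu]] IH; rewrite actDr actZr; apply: lin_spanD => //; apply: lin_spanZ.
move: (gm_act h u) lu; apply: lin_span_ind => [|b t t' lt IH']; first exact: lin_span0.
by apply: lin_span_cons => //; exists k.
Qed.

Lemma hom_bracket_degree (x y : homogeneous) : has_degree (hom_deg x + hom_deg y) (bracket x y).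
Proof. exact: bracket_degree (hom_degP x) (hom_degP y). Qed.
Definition hom_bracket x y := Homogeneous (hom_bracket_degree x y).

Lemma hact_swap X x y Z u : hact (X ++ x :: y :: Z) u =
  (-1) ^+ (oddz (hom_deg x) && oddz (hom_deg y)) *: hact (X ++ y :: x :: Z) u
  + hact (X ++ hom_bracket x y :: Z) u.
Proof.
rewrite !hact_cat /=.
have -> := gm_act_bracket (hact Z u) (degree_parity (hom_degP x)) (degree_parity (hom_degP y)).
by rewrite -hact_lin addrC subrK.
Qed.

(** Straightening any word applied to u: a lowering letter in front has no projection, a raising
    letter at the end kills the vector, and a letter of degree 0 at the end yields another singular
    vector of [Mneg]. Hence u is in the radical. *)
Lemma singular_eq0 u : Mneg v u ->
  (forall k x, 0 < k -> has_degree k x -> gm_act x u = 0) -> u = 0.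
Proof.
move=> nu su; apply: radical_eq0.
pose S := {w : M | Mneg v w /\ forall k x, 0 < k -> has_degree k x -> gm_act x w = 0}.
move=> Y; have := @straighten C S homogeneous hom_deg (fun s Y => pr (hact Y (sval s))) _ _ _ _ _
  (exist _ u (conj nu su)) Y.
apply.
- move=> [w hw] X x y Z /=.
  exists ((-1) ^+ (oddz (hom_deg x) && oddz (hom_deg y))), [:: (1, hom_bracket x y)].
  by rewrite big_seq1 /= mul1r hact_swap projL.
- by move=> [w hw] x Z dx /=; exact: (proj_act_neg hwv _ (hom_degP x)).
- move=> [w [nw sw]] x Z dx /=; rewrite -cats1 hact_cat /= (sw _ _ dx (hom_degP x)).
  by have := radical0 Z.
- move=> [w [nw sw]] x dx.
  have dx0 : has_degree 0 x by rewrite -dx; exact: hom_degP.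
  have hw' : Mneg v (gm_act x w) /\ forall k y, 0 < k -> has_degree k y -> gm_act y (gm_act x w) = 0.
    split; first exact: Mneg_deg0.
    move=> k y k0 hy; have := gm_act_bracket w (degree_parity hy) (degree_parity dx0).
    rewrite andbF expr0 scale1r (sw _ _ k0 hy) act0r subr0 => <-.
    by apply: (sw k) => //; have := bracket_degree hy dx0; rewrite addr0.
  by exists 1, (@exist _ _ (gm_act x w) hw' : S) => Z /=; rewrite mul1r -cats1 hact_cat.
- by move=> [w [nw sw]] /=; exact: (proj_Mneg hwv).
Qed.

End Radical.

(** * Reduction to finite windows *)

Section Words.
Variable R : realType.
Local Notation C := (R[i]).
Variables (V : lmodType C) (E : int -> int -> {linear V -> V}).

Definition wact (Z : seq (int * int)) (u : V) : V := foldr (fun pq => E pq.1 pq.2) u Z.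

Lemma wact_cat Y Z u : wact (Y ++ Z) u = wact Y (wact Z u).
Proof. exact: foldr_cat. Qed.

Lemma wact_linear Z : linear (wact Z).
Proof. by move=> a u w; elim: Z => //= y Z ->; rewrite linearP. Qed.
HB.instance Definition _ Z := GRing.isLinear.Build C V V *:%R (wact Z) (wact_linear Z).

Lemma wact_swap p q r s X Z u :
  (forall w, E p q (E r s w) = usgn R p q r s *: E r s (E p q w) + (q == r)%:R *: E p s w
                               - (usgn R p q r s * (p == s)%:R) *: E r q w) ->
  wact (X ++ (p, q) :: (r, s) :: Z) u =
    usgn R p q r s *: wact (X ++ (r, s) :: (p, q) :: Z) u
    + (q == r)%:R *: wact (X ++ (p, s) :: Z) u
    + (- (usgn R p q r s * (p == s)%:R)) *: wact (X ++ (r, q) :: Z) u.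
Proof.
by move=> comm; rewrite scaleNr !wact_cat /= comm linearB linearD !linearZ.
Qed.

End Words.

Section Truncation.
Variable R : realType.
Local Notation C := (R[i]).
Variables (M : glhat_module R) (xi : {scalar cartan R}) (v : M).
Hypothesis hwv : is_hw_vector xi v.
Hypothesis M_irr : irreducible M.
Variables (z : int -> int) (d L0 : nat).
Hypothesis xiE : xi =1 wsum L0 z d.

Lemma far_le L L' (A : gl R) : (L <= L')%N -> far L' A -> far L A.
Proof. by move=> LL fA i j /fA[h1 h2]; split; apply: leq_ltn_trans LL _. Qed.

Lemma degree_band k (x : glhat R) : has_degree k x -> band `|k| x.1.
Proof. by move=> [h _] i j /h; lia. Qed.

(** Induction on the depth n. A raising operator y turns A v into [y, A] v, of smaller depth and
    still far, without cocycle by [alpha0]; so A v is singular and vanishes. Each bracket uses up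
    part of the margin n. At depth 0 the diagonal misses the support of the weight. *)
Lemma far_hom n (A : gl R) : has_degree (- n%:Z) ((A, 0) : glhat R) -> far (L0 + n) A ->
  gm_act (A, 0) v = 0.
Proof.
have [m] := ubnP n; elim: m n A => // m IH n A /ltnSE nm dA fA.
have [n0|n0] := posnP n.
  move: dA fA; rewrite n0 oppr0 addn0 => dA fA; rewrite (degree0_diag dA) /=.
  case: hwv => _ -> _ _; rewrite xiE /wsum /= mulr0 addr0 big_seq big1 ?scale0r // => j.
  rewrite mem_win => jL; have [->|/fA[]] := eqVneq (A j j) 0; first by rewrite mulr0.
  by rewrite ltnNge jL.
have neg : - n%:Z < 0 by lia.
apply: (singular_eq0 hwv M_irr); first exact: (act_neg_Mneg hwv _ dA neg).
move=> k y k0 hy; case: (hwv) => _ _ hplus _.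
have := gm_act_bracket v (degree_parity hy) (degree_parity dA).
rewrite (hplus _ _ k0 hy) act0r scaler0 subr0 => <-.
have [kn|nk] := ltrP n%:Z k.
  apply: (hplus (k + - n%:Z)); first by lia.
  exact: bracket_degree.
have kn : (`|k| <= n)%N by lia.
have bk : band `|k| y.1 by exact: degree_band.
have := bracket_degree hy dA; rewrite /bracket /=.
rewrite (@alpha0 _ (L0 + n) `|k|); [|lia|by left|by right].
move=> hd; apply: (IH (n - `|k|)%N); first by lia.
  by rewrite (_ : - (n - `|k|)%N%:Z = k - n%:Z) //; lia.
have fA' : far (L0 + (n - `|k|) + `|k|) A by rewrite -addnA subnK.
by have [_] := far_bracket fA' bk.
Qed.

(** The distance may depend on the bandwidth, because commuting past an element of degree k widens
    the band by |k|. *)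
Definition farkill (u : M) := forall N, exists L, forall A : gl R, band N A -> far L A -> gm_act (A, 0) u = 0.

Lemma pair0_sum (I : Type) (r : seq I) (F : I -> gl R) :
  ((\sum_(i <- r) F i, 0) : glhat R) = \sum_(i <- r) (F i, 0).
Proof.
elim: r => [|i r IH]; first by rewrite !big_nil.
by rewrite !big_cons -IH; congr pair; rewrite /= addr0.
Qed.

Lemma farkill_v : farkill v.
Proof.
move=> N; exists (L0 + N)%N => A bA fA.
rewrite (gl_deg_sum bA) pair0_sum act_suml big_seq big1 // => k kN.
have dk : has_degree k ((deg_gl k A, 0) : glhat R).
  by have := deg_hom_degree k A 0; rewrite mulr0.
have [k0|k0] := ltrP 0 k; first by case: hwv => _ _ h _; exact: h k0 dk.
move: kN; rewrite mem_win => kN.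
apply: (@far_hom `|k|); first by rewrite lez0_abs // opprK.
have fA' : far (L0 + `|k|) A by apply: far_le fA; rewrite leq_add2l.
move=> i j; rewrite deg_glE; case: (j - i =P k) => _; [exact: fA'|by rewrite eqxx].
Qed.

Lemma farkill_lin a u w : farkill u -> farkill w -> farkill (a *: u + w).
Proof.
move=> hu hw N; have [L1 h1] := hu N; have [L2 h2] := hw N.
exists (maxn L1 L2) => A bA fA; rewrite actDr actZr h1 ?h2 ?scaler0 ?addr0 //.
  by apply: far_le fA; exact: leq_maxr.
by apply: far_le fA; exact: leq_maxl.
Qed.

Lemma farkill_act k x u : has_degree k x -> farkill u -> farkill (gm_act x u).
Proof.
move=> hx hu N; have bx := degree_band hx.
have [L1 h1] := hu N; have [L2 h2] := hu (N + `|k|)%N.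
exists (maxn L1 (L2 + `|k|)) => A bA fA.
have key b : gm_act (par_gl b A, 0) (gm_act x u) = 0.
  have parE i j : par_gl b A i j != 0 -> A i j != 0 by rewrite /= /parmx; case: ifP => // _; rewrite eqxx.
  have bb : band N (par_gl b A) by move=> i j /parE/bA.
  have fb : far (maxn L1 (L2 + `|k|)) (par_gl b A) by move=> i j /parE/fA.
  have pb : has_parity b ((par_gl b A, 0) : glhat R) by split=> //; exact: par_gl_parity.
  have := gm_act_bracket u pb (degree_parity hx).
  rewrite (h1 (par_gl b A)) ?act0r ?scaler0 ?subr0 => [<-||] //; last first.
    by apply: far_le fb; exact: leq_maxl.
  rewrite /bracket /= (@alpha0 _ (maxn L1 (L2 + `|k|)) `|k|); [|lia|by right|by left].
  apply: h2; first exact: band_bracket.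
  have fb' : far (L2 + `|k|) (par_gl b A) by apply: far_le fb; exact: leq_maxr.
  by have [] := far_bracket fb' bx.
rewrite (par_gl_sum A); have -> : ((par_gl false A + par_gl true A, 0) : glhat R) =
    (par_gl false A, 0) + (par_gl true A, 0) by congr pair; rewrite /= addr0.
by rewrite actDl !key addr0.
Qed.

Lemma hw_ind (P : M -> Prop) : P v -> (forall a u w, P u -> P w -> P (a *: u + w)) ->
  (forall k x u, has_degree k x -> P u -> P (gm_act x u)) -> forall u, P u.
Proof.
move=> Pv Pl Pa u; case: hwv => _ _ _ hT.
have P0 : P 0 by have := Pl (-1) v v Pv Pv; rewrite scaleN1r addNr.
have : lin_span [set u | exists k, lowering v k u]%classic u by rewrite hT.
move: u; apply: lin_span_ind => // a u w [k lu] Pw; apply: Pl => //.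
by elim: lu => // {}k l x t k0 hx _; exact: Pa hx.
Qed.

Lemma farkill_all u : farkill u.
Proof.
move: u; apply: hw_ind; [exact: farkill_v|exact: farkill_lin|exact: farkill_act].
Qed.

Lemma act_central (c : C) (u : M) : gm_act ((0, c) : glhat R) u = (c * d%:R) *: u.
Proof.
move: u; apply: hw_ind => [|a u w hu hw|k x u hx hu].
- have -> : ((0, c) : glhat R) = cartan_incl (0, c).
    congr pair; apply: glP => i j; rewrite -[RHS]/(diag_gl _ i j) diag_glE.
    by case: ifP.
  case: hwv => _ -> _ _; rewrite xiE /wsum /= big1 => [|j _]; last exact: mulr0.
  by rewrite add0r mulrC.
- by rewrite actDr actZr hu hw scalerDr !scalerA mulrC.
- have p0 : has_parity false ((0, c) : glhat R) by split=> // i j; rewrite glE eqxx.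
  have := gm_act_bracket u p0 (degree_parity hx).
  rewrite expr0 scale1r hu actZr => /esym/(canRL (subrK _)) ->.
  suff -> : bracket ((0, c) : glhat R) x = 0 by rewrite act0l add0r.
  congr pair.
    have p0' : parity_gl false (0 : gl R) by have [] := p0.
    have [px _] := degree_parity hx.
    by rewrite (bracket_glE p0' px) mul_gl0l mul_gl0r scaler0 subr0.
  apply: fsbig1 => r _; apply/eqP; rewrite mulf_eq0; apply/orP; right; apply/eqP.
  by apply: fsbig1 => t _; rewrite bracket_J glE mulr0 mul0r.
Qed.

Definition trunc_gl L (A : gl R) : gl R := \sum_(i <- win L) \sum_(j <- win L) A i j *: unit_gl R i j.

Lemma trunc_glE L A i j : trunc_gl L A i j = if (i \in win L) && (j \in win L) then A i j else 0.
Proof.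
have uE (i' j' : int) : (A i' j' *: unit_gl R i' j' : gl R) i j = A i' j' * ((i == i') && (j == j'))%:R.
  by rewrite [LHS](scale_glE (A i' j')) unit_glE.
rewrite /trunc_gl sum_glE (@big_win1 _ L i) => [|i' ii]; last first.
  by rewrite sum_glE big1 // => j' _; rewrite uE eq_sym (negbTE ii) mulr0.
rewrite sum_glE (@big_win1 _ L j) => [|j' jj]; last by rewrite uE eq_sym (negbTE jj) andbF mulr0.
by rewrite uE !eqxx mulr1; case: (i \in _).
Qed.

Lemma pair_sum (I : Type) (r : seq I) (F : I -> glhat R) :
  \sum_(i <- r) F i = (\sum_(i <- r) (F i).1, \sum_(i <- r) (F i).2).
Proof. by elim/big_rec3: _ => // i x y w _ ->. Qed.

Lemma ehat_sum L (A : gl R) : \sum_(i <- win L) \sum_(j <- win L) A i j *: ehat R i j =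
  (trunc_gl L A, \sum_(i <- win L) A i i * shift R i).
Proof.
rewrite pair_sum; congr pair.
  by apply: eq_bigr => i _; rewrite pair_sum.
rewrite big_seq [RHS]big_seq; apply: eq_bigr => i iL; rewrite pair_sum /=.
rewrite (@big_win1 _ L i) ?iL ?eqxx ?mul1r // => j.
by rewrite eq_sym => /negbTE ->; rewrite mul0r scaler0.
Qed.

(* The scalar by which [x] exceeds its truncation to the window [L]. *)
Definition kappa L (x : glhat R) : C := (x.2 - \sum_(i <- win L) x.1 i i * shift R i) * d%:R.

Lemma act_trunc x u : exists L1, forall L, (L1 <= L)%N -> gm_act x u =
  \sum_(i <- win L) \sum_(j <- win L) x.1 i j *: EM M i j u + kappa L x *: u.
Proof.
have [N bN] := band_ex x.1; have [L1 hL] := farkill_all u N.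
(* An entry with one index outside the window of radius L1 + N and bandwidth N has both indices
   beyond L1. *)
exists (L1 + N)%N => L LL.
have e : x = (x.1 - trunc_gl L x.1, 0) + \sum_(i <- win L) \sum_(j <- win L) x.1 i j *: ehat R i j
    + (0, x.2 - \sum_(i <- win L) x.1 i i * shift R i).
  rewrite ehat_sum [LHS]surjective_pairing; congr pair; rewrite /= ?subrK ?addr0 //.
  by rewrite add0r addrC subrK.
rewrite {1}e !actDl act_central (hL (x.1 - trunc_gl L x.1)) ?add0r.
- congr (_ + _); rewrite act_suml; apply: eq_bigr => i _.
  by rewrite act_suml; apply: eq_bigr => j _; rewrite actZl.
- move=> i j; rewrite add_glE opp_glE trunc_glE => h; apply: bN; apply: contra_neq h => ->.
  by rewrite if_same subrr.
- move=> i j; rewrite add_glE opp_glE trunc_glE; case: ifP => ij; first by rewrite subrr eqxx.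
  rewrite subr0 => /bN h; move/negbT: ij; rewrite !mem_win negb_and; lia.
Qed.

Local Notation uw := (wact (EM M)).

Definition word_comb (s : seq (C * seq (int * int))) : M := \sum_(a <- s) a.1 *: uw a.2 v.

Lemma word_comb_span u : exists s, u = word_comb s.
Proof.
have lin a u1 w1 : (exists s, u1 = word_comb s) -> (exists s, w1 = word_comb s) -> exists s, a *: u1 + w1 = word_comb s.
  move=> [s ->] [t ->]; exists ([seq (a * b.1, b.2) | b <- s] ++ t).
  rewrite /word_comb big_cat /= big_map scaler_sumr; congr (_ + _).
  by apply: eq_bigr => b _; rewrite scalerA.
have e0 : exists s, 0 = word_comb s by exists [::]; rewrite /word_comb big_nil.
move: u; apply: hw_ind => // [|k x u _ [s us]].
  by exists [:: (1, [::])]; rewrite /word_comb big_seq1 scale1r.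
have [L hL] := act_trunc x u; rewrite (hL L) //.
have sumE (r : seq int) (F : int -> M) : (forall i, exists s, F i = word_comb s) -> exists s, \sum_(i <- r) F i = word_comb s.
  move=> hF; elim: r => [|i r IH]; first by rewrite big_nil.
  by rewrite big_cons -[F i]scale1r; apply: (lin _ _ _).
rewrite -[X in X + _]scale1r; apply: (lin _ _ _); last first.
  by rewrite -[_ *: u]addr0; apply: (lin _ _ _) => //; exists s.
apply: (sumE _ _) => i; apply: (sumE _ _) => j; rewrite -[_ *: _]addr0; apply: (lin _ _ _) => //.
exists [seq (a.1, (i, j) :: a.2) | a <- s]; rewrite us /word_comb big_map linear_sum.
by apply: eq_bigr => a _; rewrite linearZ.
Qed.

End Truncation.

(** * The contravariant form *)

Section Contravariant.
Variable R : realType.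
Local Notation C := (R[i]).
Variables (M : glhat_module R) (xi : {scalar cartan R}) (v : M).
Hypothesis hwv : is_hw_vector xi v.
Hypothesis M_irr : irreducible M.
Variables (d L0 : nat) (z : int -> int).
Hypothesis xiE : xi =1 wsum L0 z d.

Local Notation word := (seq (int * int)).
Local Notation uwM := (wact (EM M)).
Local Notation uwF L := (wact (EFl R d L)).
Local Notation fform L := (@fform R (modes d L) (@mfer d L)).
Local Notation pr := (proj v).
Local Notation ev := (word_comb v).

Hypothesis fockH : forall N : nat, exists L, (N <= L)%N /\ exists u : fock R (modes d L),
  [/\ u != 0, forall p q, p \in win L -> q \in win L -> p < q -> EFl R d L p q u = 0
    & forall p, p \in win L -> EFl R d L p p u = (zwt xi p + shift R p * dwt xi) *: u].

(** Together with the sign [wsgn Z], this is the image of the word under the star-structure. *)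
Definition flip (Z : word) : word := rev [seq (x.2, x.1) | x <- Z].
Definition wsgn (Z : word) : C := \prod_(x <- Z) (ssgn R x.1 * ssgn R x.2).

Lemma flipK : involutive flip.
Proof.
by move=> Z; rewrite /flip map_rev revK -map_comp map_id_in // => -[].
Qed.

Lemma flip_cat Y Z : flip (Y ++ Z) = flip Z ++ flip Y.
Proof. by rewrite /flip map_cat rev_cat. Qed.

Lemma wsgn_cat Y Z : wsgn (Y ++ Z) = wsgn Y * wsgn Z.
Proof. by rewrite /wsgn big_cat. Qed.

Lemma wsgn_flip Z : wsgn (flip Z) = wsgn Z.
Proof.
elim: Z => // x Z IH; rewrite -cat1s flip_cat !wsgn_cat IH mulrC; congr (_ * _).
by rewrite /wsgn !big_seq1 /= mulrC.
Qed.

Lemma ssgn_conj p : (ssgn R p)^* = ssgn R p.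
Proof. by rewrite /ssgn rmorphXn rmorphN1. Qed.

Lemma wsgn_sq Z : wsgn Z * wsgn Z = 1.
Proof.
elim: Z => [|x Z IH]; first by rewrite /wsgn big_nil mulr1.
rewrite /wsgn !big_cons mulrACA IH mulr1.
by rewrite mulrACA !ssgn_sq mulr1.
Qed.

Lemma wsgn_conj Z : (wsgn Z)^* = wsgn Z.
Proof.
rewrite /wsgn rmorph_prod; apply: eq_bigr => x _.
by rewrite /= conjCM !ssgn_conj.
Qed.

Definition wwin L (Z : word) := all (fun x => (x.1 \in win L) && (x.2 \in win L)) Z.

Lemma wwin_ex (Z : word) : exists N, forall L, (N <= L)%N -> wwin L Z.
Proof.
elim: Z => [|x Z [N IH]]; first by exists 0%N.
exists (maxn N (maxn `|x.1| `|x.2|)) => L /=; rewrite !geq_max => /and3P[/IH -> h1 h2].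
by rewrite !mem_win h1 h2.
Qed.

Lemma fform_flip L Z (f g : fock R (modes d L)) :
  fform L (uwF L Z f) g = wsgn Z * fform L f (uwF L (flip Z) g).
Proof.
elim: Z f g => [|x Z IH] f g; first by rewrite /wsgn big_nil mul1r.
rewrite -cat1s flip_cat wsgn_cat wact_cat [uwF L _ g]wact_cat -mulrA -IH /=.
by rewrite [LHS]EF_adj /wsgn big_seq1.
Qed.

Lemma fform0r L (f : fock R (modes d L)) : fform L f 0 = 0.
Proof. by have := fform_sumr (Nil unit) (fun=> 0) f; rewrite !big_nil. Qed.

(* Both sides are functionals on words in the [E p q] with the same straightening
   rules, so they agree; this transports positivity from Fock space to [M]. *)
Lemma proj_fock L (u : fock R (modes d L)) Z :
  u != 0 -> (forall p q, p \in win L -> q \in win L -> p < q -> EFl R d L p q u = 0) ->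
  (forall p, p \in win L -> EFl R d L p p u = (zwt xi p + shift R p * dwt xi) *: u) ->
  wwin L Z -> pr (uwM Z v) = fform L (uwF L Z u) u / fform L u u.
Proof.
move=> u0 hwF wtF; pose T := {x : int * int | (x.1 \in win L) && (x.2 \in win L)}.
have fuu : fform L u u != 0 by rewrite gt_eqF // fform_pos.
pose f (_ : unit) (Y : seq T) : C :=
  pr (uwM (map val Y) v) * fform L u u - fform L (uwF L (map val Y) u) u.
suff f0 Y : f tt Y = 0.
  move=> zL; have [Y eY] : exists Y : seq T, map val Y = Z.
    exists (pmap insub Z); rewrite (pmap_filter (insubK _)); apply/all_filterP.
    by apply: sub_all zL => x xL; rewrite insubT.
  by have /eqP := f0 Y; rewrite /f eY subr_eq0 => /eqP <-; rewrite mulfK.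
apply: (@straighten C unit T (fun x => (val x).2 - (val x).1) f) => {Y}.
- move=> s X [[p q] /= pqL] [[r t] /= rtL] Z' /=.
  have /andP[pL qL] := pqL; have /andP[rL tL] := rtL.
  have ptL : (p \in win L) && (t \in win L) by rewrite pL.
  have rqL : (r \in win L) && (q \in win L) by rewrite rL.
  exists (usgn R p q r t), [:: ((q == r)%:R, exist _ (p, t) ptL : T);
    (- (usgn R p q r t * (p == t)%:R), exist _ (r, q) rqL : T)].
  rewrite big_cons big_seq1 /f /= !map_cat /=.
  rewrite (wact_swap (E := EM M)) => [|w]; last exact: EM_comm.
  rewrite (wact_swap (E := EFl R d L)) => [|w]; last exact: EF_comm.
  rewrite !(projD hwv) !(projZ hwv).
  have fD a b c : fform L (a + b) c = fform L a c + fform L b c.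
    by have := fform_linl (@mfer d L) c 1 a b; rewrite scale1r mul1r.
  have fZ k a c : fform L (k *: a) c = k * fform L a c.
    by apply: (formZl (form := fform L)); exact: fform_linl.
  by rewrite !fD !fZ; ring.
- move=> s [[p q] /= pqL] Y qp; rewrite /f /=.
  have /andP[pL qL] := pqL.
  rewrite (proj_act_neg hwv _ (ehat_degree R p q) qp) mul0r sub0r.
  by rewrite [X in - X]EF_adj -[EF q p u]/(EFl R d L q p u) hwF ?fform0r ?mulr0 ?oppr0 //; lia.
- move=> s [[p q] /= pqL] Y pq; rewrite /f map_rcons -cats1 !wact_cat /=.
  have /andP[pL qL] := pqL.
  rewrite hwF ?(EM_hw hwv) ?(linear0 (wact (EM M) _)) ?(linear0 (wact (EFl R d L) _)) ?(proj0 hwv) ?mul0r ?sub0r //; [|lia..].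
  by have := fform_suml (Nil unit) (fun=> 0) u; rewrite !big_nil => ->; rewrite oppr0.
- move=> s [[p q] /= pqL] pq; exists (zwt xi p + shift R p * dwt xi), tt => Y.
  have /andP[pL qL] := pqL; have {pq} e : q = p by lia.
  rewrite /f map_rcons -cats1 !wact_cat /= e wtF // (EM_wt hwv).
  rewrite (linearZ_LR (wact (EM M) _)) (linearZ_LR (wact (EFl R d L) _)) (projZ hwv).
  rewrite (formZl (form := fform L)); last exact: fform_linl.
  by ring.
- by move=> s; rewrite /f /= (proj_v hwv) mul1r subrr.
Qed.

(** Hermitian symmetry is inherited from the Fock form, in a window containing the indices of both
    words. *)
Lemma proj_flip Z : pr (uwM Z v) = wsgn Z * (pr (uwM (flip Z) v))^*.
Proof.
have [N1 h1] := wwin_ex Z; have [N2 h2] := wwin_ex (flip Z).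
have [L [NL [u [u0 hwF wtF]]]] := fockH (maxn N1 N2).
move: NL; rewrite geq_max => /andP[/h1 z1 /h2 z2].
rewrite (proj_fock u0 hwF wtF z1) (proj_fock u0 hwF wtF z2).
rewrite conjCM fmorphV /= -!(fform_herm (@mfer d L)) mulrA; congr (_ / _).
by rewrite fform_flip.
Qed.

(** The value of the contravariant form at u and [ev t], obtained by moving the words of t to the
    left argument. A priori it depends on the presentation t and not only on [ev t]. *)
Definition pairing (u : M) (t : seq (C * word)) : C :=
  \sum_(b <- t) b.1^* * (wsgn b.2 * pr (uwM (flip b.2) u)).

Lemma pairing_linear t : linear_for *%R (pairing^~ t).
Proof.
move=> a u w; rewrite /pairing mulr_sumr -big_split; apply: eq_bigr => b _ /=.
by rewrite linearP (projL hwv); ring.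
Qed.

Lemma pairing_herm s t : pairing (ev s) t = (pairing (ev t) s)^*.
Proof.
have E s' t' : pairing (ev s') t' = \sum_(b <- t') \sum_(a <- s')
    b.1^* * a.1 * (wsgn b.2 * pr (uwM (flip b.2 ++ a.2) v)).
  apply: eq_bigr => b _; rewrite /word_comb linear_sum (proj_sum hwv) !mulr_sumr.
  by apply: eq_bigr => a _; rewrite linearZ /= (projZ hwv) wact_cat; ring.
rewrite !E exchange_big rmorph_sum; apply: eq_bigr => a _.
rewrite /= rmorph_sum; apply: eq_bigr => b _ /=.
rewrite [in LHS]proj_flip flip_cat flipK wsgn_cat wsgn_flip !conjCM conjCK wsgn_conj.
by ring: (wsgn_sq b.2).
Qed.

Lemma pairing_ge0 s : 0 <= pairing (ev s) s.
Proof.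
have [N hN] : exists N, forall L, (N <= L)%N -> all (fun a => wwin L a.2) s.
  elim: s => [|a s [N IH]]; first by exists 0%N.
  have [N' h'] := wwin_ex a.2; exists (maxn N N') => L.
  by rewrite geq_max /= => /andP[/IH -> /h' ->].
have [L [/hN/allP sL [u [u0 hwF wtF]]]] := fockH N.
pose g := \sum_(a <- s) a.1 *: uwF L a.2 u.
have fuu : 0 < fform L u u by exact: fform_pos.
suff -> : pairing (ev s) s = fform L g g / fform L u u.
  apply: divr_ge0 (ltW fuu).
  by have [->|/(fform_pos (@mfer d L))/ltW //] := eqVneq g 0; rewrite fform0r.
have fZl c a b : fform L (c *: a) b = c * fform L a b.
  by apply: (formZl (form := fform L)); exact: fform_linl.
have fZr c a b : fform L a (c *: b) = c^* * fform L a b.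
  by rewrite fform_herm fZl conjCM -fform_herm.
rewrite /pairing {2}/g fform_sumr mulr_suml big_seq [RHS]big_seq; apply: eq_bigr => b /sL bL.
rewrite fZr /word_comb linear_sum (proj_sum hwv) /g fform_suml !mulr_sumr mulr_suml.
rewrite big_seq [RHS]big_seq; apply: eq_bigr => a /sL aL.
have baL : wwin L (flip b.2 ++ a.2).
  rewrite /wwin all_cat [X in _ && X]aL andbT all_rev all_map.
  by apply: sub_all bL => x /=; rewrite andbC.
rewrite (linearZ_LR (wact (EM M) _)) (projZ hwv) /= -wact_cat (proj_fock u0 hwF wtF baL).
rewrite fZl wact_cat fform_flip flipK wsgn_flip.
by ring: (wsgn_sq b.2).
Qed.

Lemma pairing_adj p q (u : M) t :
  pairing (EM M p q u) t = ssgn R p * ssgn R q * pairing u [seq (b.1, (q, p) :: b.2) | b <- t].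
Proof.
rewrite /pairing big_map mulr_sumr; apply: eq_bigr => b _ /=.
rewrite -[(q, p) :: b.2]cat1s flip_cat wsgn_cat wact_cat /= {2}/wsgn big_seq1 /=.
by ring: (ssgn_sq R p) (ssgn_sq R q).
Qed.

Definition rep (u : M) : seq (C * word) := sval (cid (word_comb_span hwv M_irr xiE u)).

Lemma repP u : u = ev (rep u).
Proof. exact: (svalP (cid (word_comb_span hwv M_irr xiE u))). Qed.

Definition contraform (u w : M) : C := pairing u (rep w).

(** Independence of the presentation: after exchanging the arguments by [pairing_herm], t enters
    only through [ev t]. *)
Lemma contraform_comb u t : contraform u (ev t) = pairing u t.
Proof. by rewrite /contraform [u in LHS]repP [u in RHS]repP !(pairing_herm (rep u)) -repP. Qed.

Lemma contraform_linl w : linear_for *%R (contraform^~ w).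
Proof. exact: pairing_linear. Qed.

Lemma contraform_herm u w : contraform u w = (contraform w u)^*.
Proof. by rewrite {1}/contraform {1}[u]repP pairing_herm -repP. Qed.

Lemma contraform_ge0 u : 0 <= contraform u u.
Proof. by rewrite /contraform {1}[u]repP pairing_ge0. Qed.

Lemma contraform_adj p q u w :
  contraform (EM M p q u) w = ssgn R p * ssgn R q * contraform u (EM M q p w).
Proof.
rewrite {1}/contraform pairing_adj -contraform_comb; congr (_ * contraform _ _).
rewrite {2}[w]repP /word_comb big_map linear_sum; apply: eq_bigr => b _.
by rewrite linearZ.
Qed.

Lemma contraform_v u : contraform u v = pr u.
Proof.
have {1}-> : v = ev [:: (1, [::])] by rewrite /word_comb big_seq1 scale1r.
by rewrite contraform_comb /pairing big_seq1 /= rmorph1 /wsgn big_nil !mul1r.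
Qed.

Lemma contraform_linr u : linear_for (Num.conj \; *%R) (contraform u).
Proof.
move=> a w w'; rewrite contraform_herm contraform_linl rmorphD /= conjCM.
by rewrite -!contraform_herm.
Qed.

Lemma contraformDl u u' w : contraform (u + u') w = contraform u w + contraform u' w.
Proof. by have := contraform_linl w 1 u u'; rewrite scale1r mul1r. Qed.
Lemma contraform0l w : contraform 0 w = 0.
Proof. by have := contraform_linl w (-1) w w; rewrite scaleN1r addNr mulN1r addNr. Qed.
Lemma contraformZl a u w : contraform (a *: u) w = a * contraform u w.
Proof. by have := contraform_linl w a u 0; rewrite !addr0 contraform0l addr0. Qed.
Lemma contraformDr u w w' : contraform u (w + w') = contraform u w + contraform u w'.
Proof. by rewrite contraform_herm contraformDl rmorphD /= -!contraform_herm. Qed.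
Lemma contraform0r u : contraform u 0 = 0.
Proof. by rewrite contraform_herm contraform0l rmorph0. Qed.
Lemma contraformZr a u w : contraform u (a *: w) = a^* * contraform u w.
Proof.
by rewrite contraform_herm contraformZl conjCM -contraform_herm.
Qed.
Lemma contraform_suml (r : seq int) (F : int -> M) w :
  contraform (\sum_(i <- r) F i) w = \sum_(i <- r) contraform (F i) w.
Proof. by elim/big_rec2: _ => [|i y x _ <-]; rewrite ?contraform0l ?contraformDl. Qed.
Lemma contraform_sumr (r : seq int) (F : int -> M) u :
  contraform u (\sum_(i <- r) F i) = \sum_(i <- r) contraform u (F i).
Proof. by elim/big_rec2: _ => [|i y x _ <-]; rewrite ?contraform0r ?contraformDr. Qed.

Lemma kappa_star L (x : glhat R) : kappa d L (star x) = (kappa d L x)^*.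
Proof.
rewrite /kappa conjCM conjC_nat rmorphB rmorph_sum; congr ((_ - _) * _).
apply: eq_bigr => i _ /=; rewrite conjCM shift_conj /starmx; congr (_ * _).
by rewrite exprD -expr2 sqrr_sign mul1r.
Qed.

(** In one window large enough for x on u and for its star on w, both sides expand into matrix
    units, which are adjoint by [contraform_adj], and scalars that are conjugate by [kappa_star]. *)
Lemma contraform_star x u w : contraform (gm_act x u) w = contraform u (gm_act (star x) w).
Proof.
have [L1 h1] := act_trunc hwv M_irr xiE x u.
have [L2 h2] := act_trunc hwv M_irr xiE (star x) w.
have [l1 l2] := (leq_maxl L1 L2, leq_maxr L1 L2).
rewrite (h1 _ l1) (h2 _ l2); move: (maxn L1 L2) => L {h1 h2 l1 l2}.
rewrite contraformDl contraformDr contraformZl contraformZr kappa_star conjCK.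
congr (_ + _); rewrite contraform_suml contraform_sumr.
under eq_bigr do rewrite contraform_suml.
under [RHS]eq_bigr do rewrite contraform_sumr.
rewrite exchange_big; apply: eq_bigr => j _; apply: eq_bigr => i _.
rewrite contraformZl contraformZr contraform_adj mulrA; congr (_ * _).
rewrite [star x]/(star _) /= /starmx conjCM conjCK exprD -[(-1) ^+ negodd i]/(ssgn R i) -[(-1) ^+ negodd j]/(ssgn R j).
by rewrite conjCM !ssgn_conj; ring.
Qed.

Lemma contraform_null u : contraform u u = 0 -> forall w, contraform u w = 0.
Proof.
move=> uu w; set b := contraform u w; have [//|b0] := eqVneq b 0.
have wu : contraform w u = b^* by exact: contraform_herm.
have ww : 0 <= contraform w w by exact: contraform_ge0.
have bb : 2 * `|b| ^+ 2 != 0 by rewrite mulf_neq0 ?pnatr_eq0 ?expf_neq0 ?normr_eq0.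
(* This real t makes the square of t b^* u + w equal to -1, contradicting semidefiniteness. *)
have [t [tr tE]] : exists t : C, t^* = t /\ t * (2 * `|b| ^+ 2) = - (contraform w w + 1).
  exists (- (contraform w w + 1) / (2 * `|b| ^+ 2)); split; last by rewrite divfK.
  apply: conj_Creal; rewrite rpred_div // ?rpredN ?rpredD ?rpredM ?rpredX ?normr_real ?rpred1 ?realn //.
  exact: ger0_real.
have := contraform_ge0 ((t * b^*) *: u + w).
rewrite contraformDl !contraformDr !contraformZl !contraformZr uu -/b wu !conjCM tr conjCK !mulr0 add0r.
have -> : t * b^* * b + (t * b * b^* + contraform w w) = t * (2 * `|b| ^+ 2) + contraform w w.
  by rewrite normCK; ring.
by rewrite tE opprD addrAC addNr sub0r oppr_ge0 ler10.
Qed.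

(** A null vector is orthogonal to everything, hence so are all its images under words; pairing
    these with v shows that it lies in the radical. *)
Lemma contraform_pos u : u != 0 -> 0 < contraform u u.
Proof.
move=> u0; rewrite lt_def contraform_ge0 andbT; apply: contra_neq u0 => uu.
apply: (radical_eq0 hwv M_irr) => Y; rewrite -contraform_v; move: v.
by elim: Y => [|y Y IH] w; [exact: contraform_null|rewrite /= contraform_star IH].
Qed.

End Contravariant.

(** * From a positive definite Hermitian form to a dot product structure *)

Section DotProduct.
Variables (R : realType) (V : lmodType R[i]) (f : V -> V -> R[i]).
Hypothesis f_linl : forall w, linear_for *%R (f^~ w).
Hypothesis f_linr : forall u, linear_for (Num.conj \; *%R) (f u).
Hypothesis f_herm : forall u w, f u w = (f w u)^*.
Hypothesis f_pos : forall u, u != 0 -> 0 < f u u.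

(** An alias of the variable [f], giving the structure instances a constant to attach to. *)
Definition dot_of : V -> V -> R[i] := f.

HB.instance Definition _ := isBilinear.Build R[i] V V R[i] *%R (Num.conj \; *%R) dot_of
  (fun w => zmod_morphism_linear (f_linl w)) (fun u => zmod_morphism_linear (f_linr u))
  (fun w => scalable_linear (f_linl w)) (fun u => scalable_linear (f_linr u)).

Lemma dot_of_herm u w : dot_of u w = (-1) ^+ false * (dot_of w u)^*.
Proof. by rewrite expr0 mul1r; exact: f_herm. Qed.
HB.instance Definition _ := isHermitianSesquilinear.Build R[i] V false Num.conj dot_of dot_of_herm.
HB.instance Definition _ := isDotProduct.Build R[i] V dot_of f_pos.

Lemma dot_of_ex : exists form : {dot V for (@Num.conj R[i])}, forall u w, form u w = f u w.
Proof. by exists dot_of. Qed.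

End DotProduct.

(** * Assembling both directions of the equivalences *)

Lemma wsum_indep (R : realType) (z : int -> int) d L L' (h : cartan R) :
  (forall j : int, (L < `|j|)%N -> z j = 0) -> (forall j : int, (L' < `|j|)%N -> z j = 0) ->
  wsum L z d h = wsum L' z d h.
Proof.
move=> zL zL'.
have zE j : z j = if - (L.+1)%:Z * 2 + 1 <= j <= (L.+1)%:Z * 2 then z j else 0.
  by case: ifP => // hj; rewrite zL //; lia.
by rewrite -(weight_wsum d h zE zL) -(weight_wsum d h zE zL').
Qed.

Lemma wcond_Lambda (R : realType) (z : int -> int) d L :
  wcond z d -> (forall j : int, (L < `|j|)%N -> z j = 0) ->
  exists lam : d.-tuple int, gen_partition lam /\ forall h : cartan R, wsum L z d h = Lambda lam h.
Proof.
move=> /wcond_lambda[lam [gl [m1 zE]]] zL; exists lam; split=> // h.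
have [m2 /(_ (maxn m1 m2) (leq_maxr _ _))[L' [zL' ->]]] := Lambda_wsum gl.
have {}zE := zE (maxn m1 m2) (leq_maxl _ _).
have -> : wsum L' (zz (maxn m1 m2) (Ncnt lam) (Hcnt lam)) d h = wsum L' z d h.
  by congr (_ + _); apply: eq_bigr => j _; rewrite zE.
by apply: wsum_indep => // j jL; rewrite zE zL'.
Qed.

Lemma zwt_wsum (R : realType) (xi : {scalar cartan R}) L (z : int -> int) d :
  (forall j : int, (L < `|j|)%N -> z j = 0) -> xi =1 wsum L z d ->
  (forall p, zwt xi p = (z p)%:~R) /\ dwt xi = d%:R.
Proof.
move=> zL xiE; split=> [p|]; rewrite /zwt /dwt xiE /wsum /=; last first.
  by rewrite big1 ?add0r ?mulr1 // => j _; rewrite mulr0.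
rewrite mulr0 addr0 /ind (@big_win1 _ L p) => [|j /negbTE ->]; last exact: mulr0.
by case: ifP => pL; rewrite ?eqxx ?mulr1 // zL //; move/negbT: pL; rewrite mem_win -ltnNge.
Qed.

Lemma cnt_small d (lam : d.-tuple int) : exists m, forall j, (m < j)%N -> Ncnt lam j = 0%N /\ Hcnt lam j = 0%N.
Proof.
have [m hm] : exists m : nat, forall x : int, x \in tval lam -> (`|x| <= m)%N.
  elim: (tval lam) => [|x s [m IH]]; first by exists 0%N => x; rewrite in_nil.
  exists (maxn `|x| m) => y /predU1P[->|/IH yx]; first exact: leq_maxl.
  exact: leq_trans yx (leq_maxr _ _).
exists m => j mj; split; apply/eqP; rewrite -leqn0 leqNgt -has_count; apply/hasPn => x /hm; lia.
Qed.

Lemma Lambda_unitarizable (R : realType) (M : glhat_module R) (xi : {scalar cartan R}) (v : M)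
    d (lam : d.-tuple int) : is_hw_vector xi v -> irreducible M ->
  gen_partition lam -> xi =1 @Lambda d lam R -> unitarizable M.
Proof.
move=> hwv M_irr gl xiL; have [m1 hm1] := Lambda_wsum gl; have [m2 hm2] := cnt_small lam.
have [L0 [_ LE]] := hm1 m1 (leqnn _).
have xiE h : xi h = wsum L0 (zz m1 (Ncnt lam) (Hcnt lam)) d h by rewrite xiL LE.
have fockH (N : nat) : exists L, (N <= L)%N /\ exists u : fock R (modes d L),
  [/\ u != 0, forall p q, p \in win L -> q \in win L -> p < q -> EFl R d L p q u = 0
    & forall p, p \in win L -> EFl R d L p p u = (zwt xi p + shift R p * dwt xi) *: u].
  (* Large enough for [zz] to agree with Lambda(lambda), for all columns beyond m to be empty, and
     for the window to contain the requested one. *)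
  pose m := (m1 + m2 + N)%N; exists m.*2; split; first by rewrite /m; lia.
  have [|u [u0 hwu wtu]] := @fock_hw R d m lam; first by move=> j mj; apply: hm2; rewrite /m in mj; lia.
  exists u; split=> // p /wtu ->.
  have [L [zL LE']] := hm1 m (leq_trans (leq_addr _ _) (leq_addr _ _)).
  have [zE dE] := zwt_wsum zL (fun h => etrans (xiL h) (LE' R h)).
  rewrite zE dE rmorphD /=; congr ((_ + _) *: _); rewrite /base /shift.
  by case: ifP => _; rewrite ?mulr0 ?mul0r // mulr1; case: oddz; rewrite ?rmorphN /= ?mulN1r ?mul1r.
have [form formE] := dot_of_ex (contraform_linl hwv M_irr xiE) (contraform_linr hwv M_irr xiE fockH)
  (contraform_herm hwv M_irr xiE fockH) (contraform_pos hwv M_irr xiE fockH).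
by exists form => x u w; rewrite !formE; exact: (contraform_star hwv M_irr xiE fockH).
Qed.

Theorem theorem5p2 (R : realType) (M : glhat_module R)
    (xi : {scalar cartan R}) (v : M)
    (M_hw : is_hw_vector xi v)
    (M_irr : irreducible M)
    (M_qf : quasi_finite v) :
  (unitarizable M <->
     exists (d : nat) (lam : d.-tuple int),
       gen_partition lam /\ xi =1 @Lambda d lam R)
  /\
  (unitarizable M <->
     exists (d : nat) (s r : int) (xi_ : halfZ -> int),
       [/\ s <= -1 /\ 1 <= r, xi =1 weight s r d xi_,
           cond_i r xi_, cond_ii s xi_ & cond_iii d xi_]).
Proof.
have unit_of_lam d (lam : d.-tuple int) : gen_partition lam -> xi =1 @Lambda d lam R -> unitarizable M.
  exact: Lambda_unitarizable M_hw M_irr.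
split; split.
- move=> /(unitarizable_wcond M_hw M_qf)[z [d [L [zL wz xiE]]]].
  have [lam [gl LE]] := wcond_Lambda R wz zL.
  by exists d, lam; split=> // h; rewrite xiE LE.
- by move=> [d [lam [gl xiE]]]; exact: unit_of_lam gl xiE.
- move=> /(unitarizable_wcond M_hw M_qf)[z [d [L [zL wz xiE]]]].
  have [s [r [sr ci cii ciii zE]]] := wcond_conds wz zL.
  by exists d, s, r, z; split=> // h; rewrite xiE (weight_wsum d h zE zL).
- move=> [d [s [r [xi_ [[s1 r1] xiE ci cii ciii]]]]].
  have wz := conds_wcond s1 r1 ci cii ciii.
  pose L := (`|(s * 2 + 1)%R| + `|(r * 2)%R|)%N.
  have zL (j : int) : (L < `|j|)%N -> (if s * 2 + 1 <= j <= r * 2 then xi_ j else 0) = 0.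
    by rewrite /L => jL; case: ifP => //; lia.
  have [lam [gl LE]] := wcond_Lambda R wz zL.
  by apply: (unit_of_lam _ _ gl) => h; rewrite -LE xiE; exact: weight_wsum.
Qed.
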